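(* For every fixed integer $d\ge 1$, asymptotically almost surely $M_{d\text{-GR}}=M_{d+1}$; that is, $\mathbb P\left(M_{d\text{-GR}}=M_{d+1}\right)\to 1$ as $n\to\infty$, where $M_{d\text{-GR}}=\min\{M: G(n,M)\text{ is globally } d\text{-rigid}\}$ and $M_{d+1}=\min\{M:\delta(G(n,M))=d+1\}$ are defined in terms of the Erdős–Rényi random graph evolution $(G(n,M))_{0\le M\le \binom n2}$ on $n$ vertices.
   Context: Random graph evolution: $G(n,0)$ is the empty graph on the vertex set $[n]=\{1,\dots,n\}$, and for $1\le M\le \binom n2$, $G(n,M)=G(n,M-1)\cup\{e\}$, where $e$ is sampled uniformly at random from the pairs in $\binom{[n]}{2}$ that are not edges of $G(n,M-1)$. An event holds asymptotically almost surely (a.a.s.) if its probability tends to $1$ as $n\to\infty$. $\delta(G)$ denotes the minimum degree of a graph $G$. Global rigidity: For a finite simple graph $G=(V,E)$ and a map $\mathbf p:V\to\mathbb R^d$ (called an embedding), the framework $(G,\mathbf p)$ is globally $d$-rigid if every embedding $\mathbf q:V\to\mathbb R^d$ with $\|\mathbf q(u)-\mathbf q(v)\|=\|\mathbf p(u)-\mathbf p(v)\|$ for every edge $uv\in E$ is obtained from $\mathbf p$ by an isometry of $\mathbb R^d$. The embedding $\mathbf p$ is generic if its $d|V|$ coordinates are algebraically independent over $\mathbb Q$. The graph $G$ is globally $d$-rigid if $(G,\mathbf p)$ is globally $d$-rigid for some generic embedding $\mathbf p$ (equivalently, by theorems of Connelly and of Gortler, Healy and Thurston, for every generic $\mathbf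 p$). *)

(* Defs.v *)
From HB Require Import structures.
From mathcomp Require Import all_boot all_order all_algebra.
From mathcomp Require Import boolp reals.
From mathcomp Require mpoly.

Set Implicit Arguments.
Unset Strict Implicit.
Unset Printing Implicit Defensive.
Import Order.TTheory GRing.Theory Num.Theory.
Import (canonicals, coercions) mpoly.
Local Open Scope ring_scope.

Definition edge (V : finType) := {e : {set V} | #|e| == 2}.

Definition graph (V : finType) := {set edge V}.

Definition adj (V : finType) (G : graph V) (u v : V) : bool :=
  [exists e in G, val e == [set u; v]].

Definition degree (V : finType) (G : graph V) (v : V) : nat :=
  #|[set u | adj G v u]|.

(* Degrees are smaller than #|V|, so the idx #|V| does not affect the minimum
   unless V is empty. *)
Definition min_degree (V : finType) (G : graph V) : nat :=
  \big[minn/#|V|]_(v : V) degree G v.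

(* The canonical norm of 'rV[R]_d is the sup norm, hence this definition. *)
Definition enorm (R : realType) (d : nat) (x : 'rV[R]_d) : R :=
  Num.sqrt (\sum_(i < d) x 0 i ^+ 2).

Definition isometry (R : realType) (d : nat) (f : 'rV[R]_d -> 'rV[R]_d) : Prop :=
  forall x y, enorm (f x - f y) = enorm (x - y).

Definition framework_globally_rigid (R : realType) (d : nat) (V : finType)
    (G : graph V) (p : V -> 'rV[R]_d) : Prop :=
  forall q : V -> 'rV[R]_d,
    (forall u v, adj G u v -> enorm (q u - q v) = enorm (p u - p v)) ->
    exists2 f, isometry f & forall v, q v = f (p v).

(* [mpoly.mmap ratr c f] is the value of f, with coefficients sent to R, at the
   point c. *)
Definition alg_independent (R : realType) (I : finType) (x : I -> R) : Prop :=
  forall f : mpoly.mpoly #|I| rat,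
    mpoly.mmap ratr (fun k : 'I_#|I| => x (enum_val k)) f = 0 -> f = 0.

Definition generic (R : realType) (d : nat) (V : finType)
    (p : V -> 'rV[R]_d) : Prop :=
  alg_independent (fun vi : V * 'I_d => p vi.1 0 vi.2).

Definition globally_rigid (R : realType) (d : nat) (V : finType)
    (G : graph V) : Prop :=
  exists2 p : V -> 'rV[R]_d, generic p & framework_globally_rigid G p.

(* A trajectory of the evolution lists the successively added pairs; there are
   'C(n, 2) pairs, see [card_edge]. *)
Definition trajectory (n : nat) := ('C(n, 2)).-tuple (edge 'I_n).

Definition evolution (n : nat) (w : trajectory n) (M : nat) : graph 'I_n :=
  [set e in take M w].

(* The conditional probability that e is the next pair, given the present
   graph G. *)
Definition step_prob (R : realType) (V : finType) (G : graph V) (e : edge V) : R :=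
  if e \in G then 0 else #|~: G|%:R^-1.

Definition trajectory_prob (R : realType) (n : nat) (w : trajectory n) : R :=
  \prod_(M < 'C(n, 2)) step_prob R (evolution w M) (tnth w M).

Definition evolution_Pr (R : realType) (n : nat) (A : pred (trajectory n)) : R :=
  \sum_(w | A w) trajectory_prob R w.

(* min {M | 0 <= M <= 'C(n, 2), P M}, with value 'C(n, 2).+1 if there is no
   such M. *)
Definition first_time (n : nat) (P : pred nat) : nat :=
  find P (iota 0 'C(n, 2).+1).

Definition M_GR (R : realType) (d n : nat) (w : trajectory n) : nat :=
  first_time n (fun M => `[< globally_rigid R d (evolution w M) >]).

Definition M_deg (k n : nat) (w : trajectory n) : nat :=
  first_time n (fun M => min_degree (evolution w M) == k).

Lemma card_edge (n : nat) : #|{: edge 'I_n}| = 'C(n, 2).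
Proof.
rewrite card_sig -[n in RHS]card_ord -cardsT -cards_draws -[RHS]cardsE.
by apply: eq_card => A; rewrite !inE subsetT.
Qed.

Lemma evolution0 (n : nat) (w : trajectory n) : evolution w 0 = set0.
Proof. by apply/setP => e; rewrite !inE take0. Qed.

Lemma evolutionS (n : nat) (w : trajectory n) (M : 'I_('C(n, 2))) :
  evolution w M.+1 = (tnth w M) |: evolution w M.
Proof.
apply/setP => e; rewrite !inE (tnth_nth (tnth w M)) (take_nth (tnth w M)).
  by rewrite mem_rcons inE.
by rewrite size_tuple.
Qed.

Lemma trajectory_prob_sum1 (R : realType) (n : nat) :
  \sum_(w : trajectory n) trajectory_prob R w = 1.
Proof.
set T := edge 'I_n.
pose g (X : {set T}) k (w : k.-tuple T) : R :=
  \prod_(M < k) step_prob R (X :|: [set e in take M w]) (tnth w M).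
suff H k : forall X : {set T}, (k <= #|~: X|)%N -> \sum_w g X k w = 1.
  rewrite -[RHS](H 'C(n, 2) set0); last by rewrite setC0 cardsT card_edge.
  apply: eq_bigr => w _; apply: eq_bigr => M _.
  by rewrite set0U.
elim: k => [|k IHk] X kX.
  rewrite (big_pred1 [tuple]) /g ?big_ord0 // => w; apply/esym/eqP.
  by rewrite tuple0.
rewrite (reindex (fun p : T * k.-tuple T => [tuple of p.1 :: p.2])) /=; last first.
  exists (fun w => (thead w, [tuple of behead w])) => [[x w] _|w _] /=.
    by congr pair; apply: val_inj.
  by apply/val_inj; rewrite /= [in RHS](tuple_eta w).
rewrite -(pair_bigA _ (fun x (w : k.-tuple T) => g X k.+1 [tuple of x :: w])) /=.
have gS x (w : k.-tuple T) :
    g X k.+1 [tuple of x :: w] = step_prob R X x * g (x |: X) k w.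
  rewrite /g big_ord_recl /=; congr (step_prob R _ _ * _).
    by apply/setP => e; rewrite !inE orbF.
  apply: eq_bigr => M _; rewrite tnthS; congr step_prob.
  by apply/setP => e; rewrite !inE orbCA orbA.
under eq_bigr => x _ do under eq_bigr => w _ do rewrite gS.
have X0 : (0 < #|~: X|)%N by apply: leq_trans kX.
transitivity (\sum_(x in ~: X) (#|~: X|%:R^-1 : R)).
  rewrite [RHS]big_mkcond; apply: eq_bigr => x _.
  rewrite -mulr_sumr inE /step_prob; case: ifP => xX /=; first by rewrite mul0r.
  rewrite IHk ?mulr1 //.
  have -> : ~: (x |: X) = ~: X :\ x.
    by apply/setP => e; rewrite !inE negb_or.
  by move: kX; rewrite (cardsD1 x (~: X)) inE xX.
by rewrite sumr_const -[X in X = _]mulr_natr mulVf // pnatr_eq0 -lt0n.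
Qed.

(* Main.v *)
Require Import Defs.
From mathcomp Require Import boolp classical_sets cardinality reals topology.
From mathcomp Require Import normedtype sequences exp ereal lebesgue_measure.
From mathcomp Require Import all_boot all_order all_algebra.
From mathcomp Require Import ring lra zify.
From mathcomp Require mpoly.
Import (canonicals, coercions) mpoly.
Import Order.TTheory GRing.Theory Num.Theory.
Import numFieldNormedType.Exports.
Local Open Scope ring_scope.

(** Global rigidity needs minimum degree [d + 1]: a vertex with at most [d]
    neighbours can be reflected in a hyperplane through them
    ([globally_rigid_degree]). One edge raises the minimum degree by at most one,
    so the theorem says that, with high probability, minimum degree [d + 1] is
    also sufficient when it first occurs.

    Rigidity of a core. Colour the vertices with [d] colours so that the graph
    spanned by any two colours, and by any single one, stays connected after
    deleting a vertex. With the [i]-th colour class on the [i]-th coordinate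
    axis, two linear problems can be solved by hand: the infinitesimal motions
    are the trivial ones ([axis_motion]), and the only functions [x] on the
    vertices such that, for every vertex [w], some velocity field changes the
    lengths of the edges at [w] according to the differences of [x], and no other
    length, are the affine functions of the position ([axis_affine]). Together
    they say that a complex of matrices whose entries are polynomials in the
    framework is exact, and exactness passes from one framework to every generic
    one ([zariski_exact]). Let now [q] have the same edge lengths as a generic
    [p]. Differentiating the lengths along derivations of the reals shows that
    the image of the rigidity map at [p] lies in the image at [q]
    ([generic_velocity]); the rank is maximal at [p], so the images are equal.
    The coordinates of [q] satisfy the condition on [x] at [q], moving one vertex
    at a time along a coordinate axis, hence they satisfy it at [p]: [q] is an
    affine image of [p], and infinitesimal rigidity makes the affine map an
    isometry ([core_congruent]).

    The random graph. At time [M1], about [(2/5) n ln n], any two disjoint sets of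
    linear size are joined by an edge ([not_joined_Pr]); deleting a small set then
    leaves a core as above for an arbitrary balanced colouring ([core_exists]).
    Let [X] be the set of vertices at which some [q] with the edge lengths of [p]
    differs from the isometric image of [p] provided by the core. A vertex
    outside the core with more than [d] neighbours off [X] is not in [X]
    ([lateration]). So, once the minimum degree is [d + 1], each vertex of [X]
    has at most [d] neighbours outside [X] and at least one inside. A union
    bound excludes such sets, taking the edges inside [X] at time [M2], about
    [n ln n], and those leaving [X] at time [M1] ([detached_Pr]). Finally the
    hitting time lies between [M1] and [M2], because there still is an isolated
    vertex at [M1] ([no_isolated_Pr], a second moment argument) and no vertex of
    degree at most [d] at [M2] ([low_degree_Pr]). The union bounds rest on one
    estimate, [pattern_Pr], obtained by conditioning on the present graph step
    by step ([expectation_weights]). *)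

Set Implicit Arguments.
Unset Strict Implicit.
Unset Printing Implicit Defensive.

(** * Polynomial functions of a framework *)

Section PolyFun.
Context {R : realType} {d : nat} {V : finType}.
Implicit Types (p : V -> 'rV[R]_d) (F : (V -> 'rV[R]_d) -> R).

Definition eval_conf (f : mpoly.mpoly #|{: V * 'I_d}| rat) p : R :=
  mpoly.mmap ratr (fun k => p (enum_val k).1 0 (enum_val k).2) f.

Definition polyfun F := exists f, forall p, F p = eval_conf f p.

Lemma polyfun_const (a : rat) : polyfun (fun=> ratr a).
Proof. by exists (mpoly.mpolyC _ a) => p; rewrite /eval_conf mpoly.mmapC. Qed.

Lemma polyfun0 : polyfun (fun=> 0).
Proof. by have [f fE] := polyfun_const 0; exists f => p; rewrite -fE rmorph0. Qed.

Lemma polyfun1 : polyfun (fun=> 1).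
Proof. by have [f fE] := polyfun_const 1; exists f => p; rewrite -fE rmorph1. Qed.

Lemma polyfun_coord v i : polyfun (fun p => p v 0 i).
Proof.
exists (mpoly.mpolyX _ (mpoly.mnm1 (enum_rank (v, i)))) => p.
by rewrite /eval_conf mpoly.mmapX mpoly.mmap1U enum_rankK.
Qed.

Lemma polyfunD F G : polyfun F -> polyfun G -> polyfun (fun p => F p + G p).
Proof.
by move=> [f fE] [g gE]; exists (f + g) => p; rewrite /eval_conf mpoly.mmapD fE gE.
Qed.

Lemma polyfunM F G : polyfun F -> polyfun G -> polyfun (fun p => F p * G p).
Proof.
by move=> [f fE] [g gE]; exists (f * g) => p; rewrite /eval_conf rmorphM fE gE.
Qed.

Lemma polyfunN F : polyfun F -> polyfun (fun p => - F p).
Proof. by move=> [f fE]; exists (- f) => p; rewrite /eval_conf mpoly.mmapN fE. Qed.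

Lemma polyfunB F G : polyfun F -> polyfun G -> polyfun (fun p => F p - G p).
Proof. by move=> hF hG; apply: polyfunD => //; apply: polyfunN. Qed.

Lemma polyfun_sum I (r : seq I) (P : pred I) (F : I -> (V -> 'rV[R]_d) -> R) :
  (forall i, polyfun (F i)) -> polyfun (fun p => \sum_(i <- r | P i) F i p).
Proof.
move=> hF; elim: r => [|i r IHr].
  by have [f fE] := polyfun0; exists f => p; rewrite big_nil.
case Pi: (P i); last by case: IHr => f fE; exists f => p; rewrite big_cons Pi.
have [f fE] := polyfunD (hF i) IHr.
by exists f => p; rewrite big_cons Pi fE.
Qed.

Lemma polyfun_prod I (r : seq I) (P : pred I) (F : I -> (V -> 'rV[R]_d) -> R) :
  (forall i, polyfun (F i)) -> polyfun (fun p => \prod_(i <- r | P i) F i p).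
Proof.
move=> hF; elim: r => [|i r IHr].
  by have [f fE] := polyfun1; exists f => p; rewrite big_nil.
case Pi: (P i); last by case: IHr => f fE; exists f => p; rewrite big_cons Pi.
have [f fE] := polyfunM (hF i) IHr.
by exists f => p; rewrite big_cons Pi fE.
Qed.

Lemma polyfunX F k : polyfun F -> polyfun (fun p => F p ^+ k).
Proof.
move=> hF; elim: k => [|k IHk]; first exact: polyfun1.
by have [f fE] := polyfunM hF IHk; exists f => p; rewrite exprS fE.
Qed.

Lemma polyfun_det n (A : (V -> 'rV[R]_d) -> 'M[R]_n) :
  (forall i j, polyfun (fun p => A p i j)) -> polyfun (fun p => \det (A p)).
Proof.
move=> hA; rewrite /determinant.
apply: polyfun_sum => s; apply: polyfunM; last by apply: polyfun_prod => i.
apply: polyfunX; have [f fE] := polyfun_const (-1).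
by exists f => p; rewrite -fE rmorphN1.
Qed.

(** The only consequence of genericity that rank arguments need; unlike
    algebraic independence it passes to sub-configurations for free. *)
Definition zariski_generic p := forall F, polyfun F ->
  (exists p0, F p0 != 0) -> F p != 0.

Lemma generic_zariski p : generic p -> zariski_generic p.
Proof.
move=> gp F [f fE] [p0]; rewrite fE => fp0; rewrite fE; apply: contra_neq fp0.
by move=> /gp ->; rewrite /eval_conf mpoly.mmap0.
Qed.

(** Minors of full size are polynomial functions, so rank can only drop at
    special configurations. *)
Lemma zariski_mxrank m n (A : (V -> 'rV[R]_d) -> 'M[R]_(m, n)) p p0 :
  zariski_generic p -> (forall i j, polyfun (fun p => A p i j)) ->
  (\rank (A p0) <= \rank (A p))%N.
Proof.
move=> gp hA.
have fA := maxrowsub_free (A p0).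
set f := maxrankfun (A p0) in fA.
have fAT : row_full (rowsub f (A p0))^T by rewrite /row_full mxrank_tr.
have := fullrowsub_unit fAT; set g := fullrankfun fAT.
rewrite unitmxE unitfE => detp0.
have := gp (fun p => \det (rowsub g (rowsub f (A p))^T)).
case/(_ _ _)/Wrap => [||detp].
- apply: polyfun_det => i j.
  by have [h hE] := hA (f j) (g i); exists h => q; rewrite !mxE hE.
- by exists p0.
have /mxrank_unit rk : rowsub g (rowsub f (A p))^T \in unitmx.
  by rewrite unitmxE unitfE.
rewrite -{1}rk (leq_trans (mxrankS (rowsub_sub _ _))) //.
by rewrite mxrank_tr mxrankS // rowsub_sub.
Qed.

End PolyFun.

Lemma zariski_comp (R : realType) (d : nat) (U V : finType) (h : U -> V)
    (p : V -> 'rV[R]_d) :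
  injective h -> zariski_generic p -> zariski_generic (p \o h).
Proof.
move=> hI gp F [f fE] [p0 Fp0].
have := gp (fun q => F (q \o h)); apply.
  suff [g gE] : polyfun (fun q : V -> 'rV[R]_d => eval_conf f (q \o h)).
    by exists g => q; rewrite fE gE.
  rewrite /eval_conf /mpoly.mmap; apply: polyfun_sum => m.
  apply: polyfunM; first exact: polyfun_const.
  rewrite /mpoly.mmap1; apply: polyfun_prod => i; apply: polyfunX.
  exact: polyfun_coord.
pose p1 v := if [pick u | h u == v] is Some u then p0 u else 0.
exists p1; suff -> : p1 \o h = p0 by [].
apply/funext => u /=; rewrite /p1; case: pickP => [u' /eqP/hI -> //|].
by move/(_ u); rewrite eqxx.
Qed.

(** * Exactness is an open condition *)

Section PolyLin.
Context {R : realType} {d : nat} {V : finType}.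
Local Notation conf := (V -> 'rV[R]_d).

Definition polylin (I : finType) (F : conf -> (I -> R) -> R) :=
  exists2 a : I -> conf -> R, (forall i, polyfun (a i)) &
    forall p c, F p c = \sum_i c i * a i p.

Lemma polylin_coord (I : finType) (i : I) : polylin (fun _ c => c i).
Proof.
exists (fun j _ => (j == i)%:R) => [j|p c].
  by case: (j == i); [exact: polyfun1|exact: polyfun0].
rewrite (bigD1 i) //= eqxx mulr1 big1 ?addr0 // => j /negPf ->.
by rewrite mulr0.
Qed.

Lemma polylinM (I : finType) g (F : conf -> (I -> R) -> R) :
  polyfun g -> polylin F -> polylin (fun p c => g p * F p c).
Proof.
move=> hg [a ha aE]; exists (fun i p => g p * a i p) => [i|p c].
  exact: polyfunM.
by rewrite aE mulr_sumr; apply: eq_bigr => i _; rewrite mulrCA.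
Qed.

Lemma polylinD (I : finType) (F G : conf -> (I -> R) -> R) :
  polylin F -> polylin G -> polylin (fun p c => F p c + G p c).
Proof.
move=> [a ha aE] [b hb bE]; exists (fun i p => a i p + b i p) => [i|p c].
  exact: polyfunD.
by rewrite aE bE -big_split; apply: eq_bigr => i _; rewrite mulrDr.
Qed.

Lemma polylinN (I : finType) (F : conf -> (I -> R) -> R) :
  polylin F -> polylin (fun p c => - F p c).
Proof.
move=> [a ha aE]; exists (fun i p => - a i p) => [i|p c].
  exact: polyfunN.
by rewrite aE -sumrN; apply: eq_bigr => i _; rewrite mulrN.
Qed.

Lemma polylinB (I : finType) (F G : conf -> (I -> R) -> R) :
  polylin F -> polylin G -> polylin (fun p c => F p c - G p c).
Proof. by move=> hF hG; apply: polylinD => //; apply: polylinN. Qed.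

Lemma polylin_sum (I : finType) K (r : seq K) (F : K -> conf -> (I -> R) -> R) :
  (forall k, polylin (F k)) -> polylin (fun p c => \sum_(k <- r) F k p c).
Proof.
move=> hF; elim: r => [|k r [a ha aE]].
  exists (fun _ _ => 0) => [i|p c]; first exact: polyfun0.
  by rewrite big_nil big1 // => i _; rewrite mulr0.
have [b hb bE] := hF k.
exists (fun i p => b i p + a i p) => [i|p c]; first exact: polyfunD.
rewrite big_cons aE bE -big_split; apply: eq_bigr => i _.
by rewrite mulrDr.
Qed.

Definition row_of (J : finType) (x : J -> R) : 'rV[R]_#|J| :=
  \row_j x (enum_val j).

Definition mx_of (I J : finType) (L : (I -> R) -> J -> R) : 'M[R]_(#|I|, #|J|) :=
  \matrix_(i, j) L (fun i' => (i' == enum_val i)%:R) (enum_val j).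

Lemma row_ofP (J : finType) (u : 'rV[R]_#|J|) :
  row_of (fun j => u 0 (enum_rank j)) = u.
Proof. by apply/rowP => j; rewrite mxE enum_valK. Qed.

Lemma row_of_inj (J : finType) (x y : J -> R) : row_of x = row_of y -> x =1 y.
Proof. by move=> /rowP xy j; move: (xy (enum_rank j)); rewrite !mxE enum_rankK. Qed.

Lemma mulmx_row_of (I J : finType) (F : conf -> (I -> R) -> J -> R) p x :
  (forall j, polylin (fun p c => F p c j)) ->
  row_of x *m mx_of (F p) = row_of (F p x).
Proof.
move=> hF; apply/rowP => j; rewrite !mxE.
have [a ha aE] := hF (enum_val j); rewrite aE.
rewrite [RHS](reindex _ (onW_bij _ (enum_val_bij I))).
apply: eq_bigr => i _; rewrite !mxE; congr (_ * _).
rewrite aE (bigD1 (enum_val i)) //= eqxx mul1r big1 ?addr0 // => k /negPf ->.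
by rewrite mul0r.
Qed.

Lemma polyfun_mx_of (I J : finType) (F : conf -> (I -> R) -> J -> R) i j :
  (forall j, polylin (fun p c => F p c j)) ->
  polyfun (fun p => mx_of (F p) i j).
Proof.
move=> hF; have [a ha aE] := hF (enum_val j).
have [f fE] := ha (enum_val i); exists f => p.
rewrite !mxE aE (bigD1 (enum_val i)) //= eqxx mul1r big1 ?addr0 ?fE // => k.
by move=> /negPf ->; rewrite mul0r.
Qed.

(** Both ranks can only grow when leaving [p0], and at [p0] they already add up
    to the dimension of the middle space. *)
Lemma zariski_exact (I J K : finType) (F : conf -> (I -> R) -> J -> R)
    (G : conf -> (J -> R) -> K -> R) p0 p :
  zariski_generic p ->
  (forall j, polylin (fun p c => F p c j)) ->
  (forall k, polylin (fun p c => G p c k)) ->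
  (forall q c k, G q (F q c) k = 0) ->
  (forall x, (forall k, G p0 x k = 0) -> exists c, x =1 F p0 c) ->
  forall x, (forall k, G p x k = 0) -> exists c, x =1 F p c.
Proof.
move=> gp hF hG GF0 ex0 x Gx0.
have FG q : (mx_of (F q) <= kermx (mx_of (G q)))%MS.
  apply/row_subP => i; apply/sub_kermxP; rewrite rowE.
  rewrite -(row_ofP (delta_mx 0 i)) !mulmx_row_of //.
  by apply/rowP => k; rewrite !mxE GF0.
have exF : (kermx (mx_of (G p0)) <= mx_of (F p0))%MS.
  apply/row_subP => i; set u := row i _.
  have : u *m mx_of (G p0) = 0 by apply/sub_kermxP; exact: row_sub.
  rewrite -(row_ofP u) mulmx_row_of // => /rowP Gu0.
  have [|c cE] := ex0 (fun j => u 0 (enum_rank j)).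
    by move=> k; move: (Gu0 (enum_rank k)); rewrite !mxE enum_rankK.
  rewrite (_ : row_of _ = row_of (F p0 c)); last first.
    by apply/rowP => j; rewrite [LHS]mxE [RHS]mxE -cE.
  by rewrite -mulmx_row_of // submxMl.
have rkF : (\rank (kermx (mx_of (G p))) <= \rank (mx_of (F p)))%N.
  apply: (@leq_trans (\rank (mx_of (F p0)))); last first.
    apply: (@zariski_mxrank _ _ _ _ _ (fun q => mx_of (F q))) => // i j.
    exact: polyfun_mx_of.
  apply: leq_trans (mxrankS exF); rewrite !mxrank_ker leq_sub2l //.
  apply: (@zariski_mxrank _ _ _ _ _ (fun q => mx_of (G q))) => // i j.
  exact: polyfun_mx_of.
have : (kermx (mx_of (G p)) <= mx_of (F p))%MS.
  by rewrite -(geq_leqif (mxrank_leqif_sup (FG p))).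
have xker : (row_of x <= kermx (mx_of (G p)))%MS.
  apply/sub_kermxP; rewrite mulmx_row_of //.
  by apply/rowP => k; rewrite !mxE Gx0.
move=> /(submx_trans xker)/submxP[c]; rewrite -(row_ofP c) mulmx_row_of //.
by move=> /row_of_inj xE; exists (fun j => c 0 (enum_rank j)).
Qed.

(** The rank of [G] is maximal at [p], so an image at [q] that contains the
    image at [p] is equal to it. *)
Lemma zariski_image_sub (J K : finType) (G : conf -> (J -> R) -> K -> R) p q :
  zariski_generic p -> (forall k, polylin (fun p c => G p c k)) ->
  (forall v, exists z, G p v =1 G q z) ->
  forall z, exists v, G q z =1 G p v.
Proof.
move=> gp hG pq.
have pqS : (mx_of (G p) <= mx_of (G q))%MS.
  apply/row_subP => i; rewrite rowE -(row_ofP (delta_mx 0 i)) mulmx_row_of //.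
  have [z zE] := pq (fun j => (delta_mx 0 i : 'rV[R]_#|J|) 0 (enum_rank j)).
  rewrite (_ : row_of _ = row_of (G q z)); first by rewrite -mulmx_row_of // submxMl.
  by apply/rowP => k; rewrite !mxE zE.
have : (mx_of (G q) <= mx_of (G p))%MS.
  rewrite -(geq_leqif (mxrank_leqif_sup pqS)).
  apply: (@zariski_mxrank _ _ _ _ _ (fun q => mx_of (G q))) => // i j.
  exact: polyfun_mx_of.
move=> qpS z.
have /submx_trans/(_ qpS)/submxP[v] : (row_of z *m mx_of (G q) <= mx_of (G q))%MS.
  exact: submxMl.
rewrite -(row_ofP v) !mulmx_row_of // => /row_of_inj vE.
by exists (fun j => v 0 (enum_rank j)).
Qed.

End PolyLin.

(** * Derivations of finitely generated subrings of the reals *)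

Section Derivation.
Context {R : realType}.

(** The graph of a derivation on a subring of [R], seen as a subring of the dual
    numbers [R + R eps] that meets [R eps] only in [0]. *)
Record derivation_graph (S : R -> R -> Prop) : Prop := DerivationGraph {
  dg1 : S 1 0;
  dgB : forall x x' y y', S x x' -> S y y' -> S (x - y) (x' - y');
  dgM : forall x x' y y', S x x' -> S y y' -> S (x * y) (x' * y + x * y');
  dg_fun0 : forall y, S 0 y -> y = 0 }.

Section Graph.
Variables (S : R -> R -> Prop) (dS : derivation_graph S).

Lemma dg0 : S 0 0.
Proof. by have := dgB dS (dg1 dS) (dg1 dS); rewrite !subrr. Qed.

Lemma dgN x x' : S x x' -> S (- x) (- x').
Proof. by move=> /(dgB dS dg0); rewrite !sub0r. Qed.

Lemma dgD x x' y y' : S x x' -> S y y' -> S (x + y) (x' + y').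
Proof. by move=> Sx /dgN/(dgB dS Sx); rewrite !opprK. Qed.

Lemma dg_sum I (r : seq I) (F F' : I -> R) :
  (forall i, S (F i) (F' i)) -> S (\sum_(i <- r) F i) (\sum_(i <- r) F' i).
Proof.
move=> SF; elim: r => [|i r IHr]; first by rewrite !big_nil; exact: dg0.
by rewrite !big_cons; apply: dgD.
Qed.

Lemma dgMn x x' n : S x x' -> S (x *+ n) (x' *+ n).
Proof.
move=> Sx; elim: n => [|n IHn]; first by rewrite !mulr0n; exact: dg0.
by rewrite !mulrS; apply: dgD.
Qed.

Lemma dg_fun x y y' : S x y -> S x y' -> y = y'.
Proof.
move=> Sy Sy'; apply/eqP; rewrite -subr_eq0; apply/eqP; apply: (dg_fun0 dS).
by rewrite -[X in S X _](subrr x); apply: dgB.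
Qed.

Definition polyS (f f' : {poly R}) := forall k, S f`_k f'`_k.

Lemma polySC x x' : S x x' -> polyS x%:P x'%:P.
Proof. by move=> Sx k; rewrite !coefC; case: eqP => // _; exact: dg0. Qed.

Lemma polySX : polyS 'X 0.
Proof.
by move=> k; rewrite coefX coef0; case: eqP => _; [exact: dg1|exact: dg0].
Qed.

Lemma polySB f f' g g' : polyS f f' -> polyS g g' -> polyS (f - g) (f' - g').
Proof. by move=> Sf Sg k; rewrite !coefB; apply: dgB. Qed.

Lemma polySM f f' g g' :
  polyS f f' -> polyS g g' -> polyS (f * g) (f' * g + f * g').
Proof.
move=> Sf Sg k; rewrite coefD !coefM -big_split; apply: dg_sum => i.
exact: dgM.
Qed.

Lemma polySXn n : polyS 'X^n 0.
Proof.
elim: n => [|n IHn].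
  by rewrite expr0 -[0]polyC0; apply: polySC; exact: dg1.
by have := polySM polySX IHn; rewrite mul0r mulr0 addr0 -exprS.
Qed.

Lemma polyS_deriv f f' : polyS f f' -> polyS f^`() f'^`().
Proof. by move=> Sf k; rewrite !coef_deriv; apply: dgMn. Qed.

(** Coefficient of [eps] in the value of [f + f' eps] at [b + b' eps]. *)
Definition eps_part (b b' : R) (f f' : {poly R}) := f'.[b] + f^`().[b] * b'.

Lemma eps_partM b b' f f' g g' :
  eps_part b b' (f * g) (f' * g + f * g') =
  eps_part b b' f f' * g.[b] + f.[b] * eps_part b b' g g'.
Proof.
rewrite /eps_part derivM !hornerE; set t := f'.[b]; set t' := f^`().[b].
by set s := g'.[b]; set s' := g^`().[b]; ring.
Qed.

Lemma eps_partB b b' f f' g g' :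
  eps_part b b' (f - g) (f' - g') = eps_part b b' f f' - eps_part b b' g g'.
Proof. by rewrite /eps_part derivB !hornerE; ring. Qed.

(** A value [b'] making the derivative of every relation vanish: forced by a
    relation of minimal degree if [b] is algebraic over the subring, arbitrary
    otherwise. *)
Lemma eps_part_exists b :
  exists b', forall f f', polyS f f' -> f.[b] = 0 -> eps_part b b' f f' = 0.
Proof.
have S0 f f' : polyS f f' -> f = 0 -> f' = 0.
  move=> Sf f0; apply/polyP => k; rewrite coef0; apply: (dg_fun0 dS).
  by have := Sf k; rewrite f0 coef0.
pose rel n := `[< exists f f', [/\ polyS f f', f.[b] = 0, f != 0 & size f = n] >].
have [[n0 reln0]|norel] := pselect (exists n, rel n); last first.
  exists 0 => f f' Sf fb; have [f0|fN0] := eqVneq f 0; last first.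
    by case: norel; exists (size f); apply/asboolP; exists f, f'.
  by rewrite /eps_part (S0 _ _ Sf f0) f0 deriv0 !horner0 mulr0 addr0.
have [n /asboolP[f [f' [Sf fb fN0 fn]]] minn] :=
  ex_minnP (ex_intro (fun n => rel n) n0 reln0).
have dfb : f^`().[b] != 0.
  apply/eqP => dfb; have [df0|dfN0] := eqVneq f^`() 0.
    have fC : f = (f`_0)%:P.
      apply/polyP => -[|k]; rewrite coefC //=.
      have := congr1 (fun g : {poly R} => g`_k) df0.
      by rewrite coef_deriv coef0 => /eqP; rewrite mulrn_eq0 /= => /eqP.
    by move: fb fN0; rewrite fC hornerC => ->; rewrite polyC0 eqxx.
  have : (n <= size f^`())%N.
    apply: minn; apply/asboolP; exists f^`(), f'^`(); split=> //.
    exact: polyS_deriv.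
  by rewrite leqNgt -fn lt_size_deriv.
pose b' := - f'.[b] / f^`().[b]; exists b'.
have ef : eps_part b b' f f' = 0.
  by rewrite /eps_part /b' mulrC divfK // subrr.
suff ind k (h h' : {poly R}) : (size h <= k)%N -> polyS h h' -> h.[b] = 0 ->
    eps_part b b' h h' = 0 by move=> h h'; apply: ind (leqnn _).
elim: k h h' => [|k IHk] h h' hk Sh hb.
  have h0 : h = 0 by apply/eqP; rewrite -size_poly_leq0.
  by rewrite /eps_part (S0 _ _ Sh h0) h0 deriv0 !horner0 mul0r addr0.
have [h0|hN0] := eqVneq h 0.
  by rewrite /eps_part (S0 _ _ Sh h0) h0 deriv0 !horner0 mul0r addr0.
have nh : (n <= size h)%N.
  by apply: minn; apply/asboolP; exists h, h'.
pose a := lead_coef f; pose a' := f'`_(size f).-1.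
pose c := lead_coef h; pose c' := h'`_(size h).-1.
pose e := (size h - size f)%N.
have Sa : polyS a%:P a'%:P by apply: polySC; apply: Sf.
have Sc : polyS c%:P c'%:P by apply: polySC; apply: Sh.
have Sah := polySM Sa Sh.
have Scf := polySM (polySM Sc (polySXn e)) Sf.
have Sg := polySB Sah Scf.
set g := (X in polyS X _) in Sg; set g' := (X in polyS _ X) in Sg.
have gb : g.[b] = 0 by rewrite /g !hornerE fb hb !mulr0 subrr.
have gk : (size g <= k)%N.
  have hgt0 : (0 < size h)%N by rewrite size_poly_gt0.
  have fgt0 : (0 < size f)%N by rewrite size_poly_gt0.
  suff : (size g < size h)%N by move=> /leq_trans/(_ hk).
  rewrite -(prednK hgt0) ltnS; apply/leq_sizeP => j hj.
  rewrite /g coefB coefCM -mulrA coefCM coefXnM.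
  have [je|je] := ltnP j e; first by exfalso; move: hj je; rewrite /e; lia.
  have [jh|jh] := eqVneq j (size h).-1.
    rewrite (_ : (j - e)%N = (size f).-1); last first.
      by move: jh nh; rewrite /e -fn; lia.
    by rewrite jh -[h`_ _]/c -[f`_ _]/a mulrC subrr.
  have {}jh : (size h <= j)%N by move: jh hj; lia.
  rewrite nth_default // mulr0 nth_default ?mulr0 ?subrr //.
  by move: jh nh; rewrite /e -fn; move: (size f) (size h) => s t; lia.
have := IHk _ _ gk Sg gb.
rewrite /g /g' eps_partB !eps_partM fb hb ef !mulr0 add0r addr0 subr0 hornerC.
by move/eqP; rewrite mulf_eq0 lead_coef_eq0 (negPf fN0) => /eqP.
Qed.

Lemma derivation_graph_adjoin b :
  exists S' b', [/\ derivation_graph S', forall x x', S x x' -> S' x x' & S' b b'].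
Proof.
have [b' b'P] := eps_part_exists b.
pose S' x y := exists f f', [/\ polyS f f', x = f.[b] & y = eps_part b b' f f'].
exists S', b'; split; first split.
- exists 1%:P, 0; split; first by rewrite -[0]polyC0; apply/polySC/(dg1 dS).
    by rewrite hornerC.
  by rewrite /eps_part derivC !horner0 mul0r addr0.
- move=> x x' y y' [f [f' [Sf -> ->]]] [g [g' [Sg -> ->]]].
  exists (f - g), (f' - g'); split; first exact: polySB.
    by rewrite !hornerE.
  by rewrite eps_partB.
- move=> x x' y y' [f [f' [Sf -> ->]]] [g [g' [Sg -> ->]]].
  exists (f * g), (f' * g + f * g'); split; first exact: polySM.
    by rewrite !hornerE.
  by rewrite eps_partM.
- by move=> y [f [f' [Sf fb ->]]]; apply: b'P.
- move=> x x' Sx; exists x%:P, x'%:P; split; first exact: polySC.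
    by rewrite hornerC.
  by rewrite /eps_part derivC horner0 mul0r addr0 hornerC.
- exists 'X, 0; split; first exact: polySX; first by rewrite hornerX.
  by rewrite /eps_part derivX horner0 hornerC mul1r add0r.
Qed.

End Graph.

Lemma derivation_graph_extend S (s : seq R) : derivation_graph S ->
  exists S', [/\ derivation_graph S', forall x x', S x x' -> S' x x' &
    forall b, b \in s -> exists b', S' b b'].
Proof.
elim: s S => [|b s IHs] S dS; first by exists S; split.
have [S1 [b' [dS1 sub1 S1b]]] := derivation_graph_adjoin dS b.
have [S2 [dS2 sub2 S2s]] := IHs _ dS1.
exists S2; split=> [||c]; first by [].
  by move=> x x' /sub1/sub2.
by rewrite inE => /orP[/eqP ->|/S2s //]; exists b'; apply: sub2.
Qed.

End Derivation.

Section Lifting.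
Context {R : realType} {d : nat} {V : finType}.

(** The derivation sends [f(p)] to the derivative of [f] at [p] in the direction
    [v]; algebraic independence makes this well defined. *)
Lemma generic_derivation (p v : V -> 'rV[R]_d) : generic p ->
  exists S : R -> R -> Prop, derivation_graph S /\
    forall u i, S (p u 0 i) (v u 0 i).
Proof.
move=> gp.
pose D f := \sum_k eval_conf (mpoly.mderiv k f) p * v (enum_val k).1 0 (enum_val k).2.
exists (fun x y => exists2 f, x = eval_conf f p & y = D f); split; first split.
- exists 1; first by rewrite /eval_conf rmorph1.
  by rewrite /D big1 // => k _; rewrite mpoly.mderivC /eval_conf mpoly.mmap0 mul0r.
- move=> _ _ _ _ [f -> ->] [g -> ->]; exists (f - g).
    by rewrite /eval_conf mpoly.mmapB.
  rewrite /D -sumrB; apply: eq_bigr => k _.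
  by rewrite mpoly.mderivB /eval_conf mpoly.mmapB mulrBl.
- move=> _ _ _ _ [f -> ->] [g -> ->]; exists (f * g).
    by rewrite /eval_conf rmorphM.
  rewrite /D mulr_suml mulr_sumr -big_split; apply: eq_bigr => k _.
  rewrite mpoly.mderivM /eval_conf mpoly.mmapD !rmorphM mulrDl.
  by congr (_ + _); rewrite -?mulrA // [X in _ * X]mulrC mulrA.
- move=> y [f /esym/gp -> ->].
  by rewrite /D big1 // => k _; rewrite mpoly.mderiv0 /eval_conf mpoly.mmap0 mul0r.
- move=> u i; exists (mpoly.mpolyX _ (mpoly.mnm1 (enum_rank (u, i)))).
    by rewrite /eval_conf mpoly.mmapX mpoly.mmap1U enum_rankK.
  rewrite /D (bigD1 (enum_rank (u, i))) //= enum_rankK /=.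
  rewrite mpoly.mderivX mpoly.mnm1E eqxx scale1r.
  set m := mpoly.mnm_sub _ _; have -> : m = mpoly.mnm0.
    by apply/mpoly.mnmP => j; rewrite mpoly.mnmBE subnn mpoly.mnm0E.
  rewrite mpoly.mpolyX0 /eval_conf rmorph1 mul1r big1 ?addr0 // => k kN.
  rewrite mpoly.mderivX mpoly.mnm1E eq_sym (negPf kN) scale0r.
  by rewrite mpoly.mmap0 mul0r.
Qed.

(** Differentiate the squared lengths along a derivation that moves [p] with
    velocity [v]; extended to the coordinates of [q], the same derivation gives
    [q] its velocity [z]. *)
Lemma generic_velocity (p q v : V -> 'rV[R]_d) : generic p ->
  exists z : V -> 'rV[R]_d, forall u w,
    \sum_i (p u 0 i - p w 0 i) ^+ 2 = \sum_i (q u 0 i - q w 0 i) ^+ 2 ->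
    \sum_i (p u 0 i - p w 0 i) * (v u 0 i - v w 0 i) =
    \sum_i (q u 0 i - q w 0 i) * (z u 0 i - z w 0 i).
Proof.
move=> /(@generic_derivation p v)[S0 [dS0 S0p]].
pose s := [seq q x.1 0 x.2 | x : V * 'I_d].
have [S [dS sub Sq]] := derivation_graph_extend s dS0.
have /choice[z zP] : forall x : V * 'I_d, exists y, S (q x.1 0 x.2) y.
  by move=> x; apply: Sq; apply: map_f; rewrite mem_enum.
exists (fun u => \row_i z (u, i)) => u w eqd.
have Ssq (x x' y y' : 'I_d -> R) : (forall i, S (x i) (x' i)) ->
    (forall i, S (y i) (y' i)) ->
    S (\sum_i (x i - y i) ^+ 2) ((\sum_i (x i - y i) * (x' i - y' i)) *+ 2).
  move=> Sx Sy; rewrite -sumrMnl; apply: (dg_sum dS) => i.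
  have Sxy := dgB dS (Sx i) (Sy i).
  by have := dgM dS Sxy Sxy; rewrite [(x' i - y' i) * _]mulrC -mulr2n -expr2.
have := Ssq _ _ _ _ (fun i => sub _ _ (S0p u i)) (fun i => sub _ _ (S0p w i)).
have := Ssq _ _ _ _ (fun i => zP (u, i)) (fun i => zP (w, i)).
rewrite /= -eqd => S1 S2; have := dg_fun dS S2 S1.
have two0 : 2%:R != 0 :> R by rewrite pnatr_eq0.
rewrite -[LHS]mulr_natr -[RHS]mulr_natr => /(mulIf two0) ->.
by apply: eq_bigr => i _; rewrite !mxE.
Qed.

End Lifting.

(** * Frameworks on the coordinate axes *)

(** Connectivity of the graph of each pair of colours after deleting at most one
    vertex [z], phrased as constancy of real functions because that is the form
    in which motions use it. For [i = j] the graph is the one induced on a colour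
    class, otherwise it is bipartite. *)
Definition colour_connected (R : realType) (d : nat) (V : finType)
    (e : rel V) (chi : V -> 'I_d) :=
  forall (i j : 'I_d) (z : option V) (g : V -> R),
    (forall a b, Some a != z -> Some b != z -> e a b ->
       chi a = i -> chi b = j -> g a = g b) ->
    forall a b, Some a != z -> Some b != z ->
      chi a \in [:: i; j] -> chi b \in [:: i; j] -> g a = g b.

Section Axis.
Context {R : realType} {d : nat} {V : finType}.
Variables (e : rel V) (chi : V -> 'I_d).
Hypothesis esym : symmetric e.
Hypothesis conn : colour_connected R e chi.
Hypothesis big : forall i, exists u u', [/\ u != u', chi u = i & chi u' = i].

(** Any distinct nonzero positions on the axes would do. *)
Definition lam (v : V) : R := (enum_rank v).+1%:R.

Definition axis_conf (v : V) : 'rV[R]_d := \row_k (lam v * (k == chi v)%:R).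

Lemma lam_neq0 v : lam v != 0.
Proof. by rewrite pnatr_eq0. Qed.

Lemma lam_inj : injective lam.
Proof.
by move=> u v /eqP; rewrite eqr_nat eqSS => /eqP/val_inj/enum_rank_inj.
Qed.

Lemma lamB_eq0 u v : (lam u - lam v == 0) = (u == v).
Proof. by rewrite subr_eq0 (inj_eq lam_inj). Qed.

Lemma axis_dot (a : V) (t : 'I_d -> R) :
  \sum_k axis_conf a 0 k * t k = lam a * t (chi a).
Proof.
rewrite (bigD1 (chi a)) //= mxE eqxx mulr1 big1 ?addr0 // => k /negPf kN.
by rewrite mxE kN mulr0 mul0r.
Qed.

Lemma axis_dotB (a b : V) (t : 'I_d -> R) :
  \sum_k (axis_conf a 0 k - axis_conf b 0 k) * t k =
  lam a * t (chi a) - lam b * t (chi b).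
Proof.
by rewrite -!axis_dot -sumrB; apply: eq_bigr => k _; rewrite mulrBl.
Qed.

Lemma other_vertex i v : exists2 u, chi u = i & u != v.
Proof.
have [u [u' [uu' ui u'i]]] := big i.
by have [uv|] := eqVneq u v; [exists u' => //; rewrite -uv eq_sym|exists u].
Qed.

Lemma class_const i (z : option V) (g : V -> R) :
  (forall a b, Some a != z -> Some b != z -> e a b -> chi a = i -> chi b = i ->
     g a = g b) ->
  forall a b, Some a != z -> Some b != z -> chi a = i -> chi b = i -> g a = g b.
Proof.
by move=> gE a b az bz ai bi; apply: (conn gE) => //; rewrite ?ai ?bi mem_head.
Qed.

Definition motion (p : V -> 'rV[R]_d) (y : V -> 'I_d -> R) :=
  forall a b, e a b ->
    \sum_k (p a 0 k - p b 0 k) * (y a k - y b k) = 0.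

(** Along the axis [i] a motion is constant on the [i]-th class; between two
    classes the rescaled transversal components agree along edges, and their
    common value is an entry of a skew-symmetric matrix. *)
Lemma axis_motion y : motion axis_conf y ->
  exists (c : 'I_d -> R) (S : 'I_d -> 'I_d -> R), forall v k,
    y v k = c k + \sum_l (S k l - S l k) * axis_conf v 0 l.
Proof.
move=> my.
have /choice[r rP] : forall i, exists u, chi u = i.
  by move=> i; have [u [_ [_ ui _]]] := big i; exists u.
pose c k := y (r k) k.
have yc i a : chi a = i -> y a i = c i.
  move=> ai; apply: (@class_const i None (fun a => y a i)) => // u v _ _ uv ui vi.
  have := my _ _ uv; rewrite axis_dotB ui vi => /eqP.
  rewrite -mulrBl mulf_eq0 lamB_eq0 subr_eq0.
  by case/orP=> /eqP // ->.
pose S k i := if k == i then 0 else (y (r i) k - c k) / lam (r i) / 2%:R.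
exists c, S => v k; set i := chi v.
under eq_bigr do rewrite mulrC; rewrite axis_dot -/i.
have [->|ki] := eqVneq k i; first by rewrite subrr mulr0 addr0 yc.
pose g a := if chi a == i then (y a k - c k) / lam a else - (y a i - c i) / lam a.
have gE a b : Some a != None -> Some b != None -> e a b -> chi a = i ->
    chi b = k -> g a = g b.
  move=> _ _ ab ai bk; rewrite /g ai bk eqxx (negPf ki).
  have := my _ _ ab; rewrite axis_dotB ai bk (yc _ a ai) (yc _ b bk) => E.
  have := lam_neq0 a; have := lam_neq0 b => b0 a0.
  apply: (mulIf a0); rewrite divfK //; apply: (mulIf b0).
  rewrite mulrAC divfK //; apply/eqP; rewrite -subr_eq0 -oppr_eq0; apply/eqP.
  by rewrite -E; ring.
have gv : g v = g (r i).
  by apply: (conn gE) => //; rewrite ?rP !inE eqxx.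
have gr : g v = g (r k).
  by apply: (conn gE) => //; rewrite ?rP !inE eqxx ?orbT.
move: gv gr; rewrite /g -/i !rP eqxx (negPf ki) => gv gr.
rewrite /S (negPf ki) eq_sym (negPf ki) -gv.
move: gr; rewrite mulNr => /(congr1 -%R); rewrite opprK => <-.
have := lam_neq0 v; move: (lam v) (y v k) (c k) => l t s l0.
by field.
Qed.

(** A vertex with a single neighbour of the other colour would be cut off by
    deleting that neighbour. *)
Lemma two_neighbours i j : i != j ->
  exists w b b', [/\ e w b, e w b' & b != b'] /\
    [/\ chi w = i, chi b = j & chi b' = j].
Proof.
move=> ij; have [w [w' [ww' wi w'i]]] := big i.
have [u [_ [_ uj _]]] := big j.
have nbr z : (forall b, Some b = z -> chi b = j) ->
    exists b, [/\ e w b, chi b = j & Some b != z].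
  move=> zj; apply: contrapT => nb.
  have wz : Some w != z.
    by apply/eqP => /zj wj; move: ij; rewrite -wi wj eqxx.
  have w'z : Some w' != z.
    by apply/eqP => /zj wj; move: ij; rewrite -w'i wj eqxx.
  have := @conn i j z (fun a => (a == w)%:R).
  case/(_ _ w w' wz w'z)/Wrap => [|H].
  - move=> a b az bz ab ai bj; congr (_ %:R).
    have [aw|aw] := eqVneq a w; first by case: nb; exists b; rewrite -aw.
    case: eqVneq => // bw.
    by move: ij; rewrite -bj bw wi eqxx.
  have := H; rewrite wi w'i mem_head => /(_ isT isT)/eqP.
  rewrite eqxx [w' == _]eq_sym (negPf ww').
  by rewrite oner_eq0.
have [//|b [wb bj _]] := nbr None.
have [b0 [->] //|b' [wb' b'j bb']] := nbr (Some b).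
by exists w, b, b'; do !split=> //; rewrite eq_sym.
Qed.

(** Deleting [w] shows that all edges of its class at [w] have the same slope
    for [x]; two neighbours of [w] in another class then force the intercepts
    of the two classes to agree. *)
Lemma axis_affine (x : V -> R) (Y : V -> V -> 'I_d -> R) :
  (forall w a b, e a b ->
     \sum_k (axis_conf a 0 k - axis_conf b 0 k) * (Y w a k - Y w b k) =
     ((w == a)%:R - (w == b)%:R) * (x a - x b)) ->
  exists (tau : R) (sigma : 'I_d -> R), forall v,
    x v = tau + \sum_k sigma k * axis_conf v 0 k.
Proof.
move=> xY.
have Yc w i a b : a != w -> b != w -> chi a = i -> chi b = i ->
    Y w a i = Y w b i.
  move=> aw bw ai bi.
  apply: (@class_const i (Some w) (fun a => Y w a i)) => //= u v uw vw uv ui vi.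
  have := xY w _ _ uv; rewrite axis_dotB ui vi ![w == _]eq_sym.
  rewrite (negPf (uw : u != w)) (negPf (vw : v != w)) subrr mul0r => /eqP.
  rewrite -mulrBl mulf_eq0 lamB_eq0 subr_eq0.
  by case/orP=> /eqP // ->.
have Yc' w i a b : i != chi w -> chi a = i -> chi b = i -> Y w a i = Y w b i.
  move=> iw ai bi; apply: Yc => //; first by apply: contraNneq iw => <-; rewrite ai.
  by apply: contraNneq iw => <-; rewrite bi.
have /choice[o oP] : forall w, exists u, chi u = chi w /\ u != w.
  by move=> w; have [u] := other_vertex (chi w) w; exists u.
pose s w := Y w w (chi w) - Y w (o w) (chi w).
have sE w b : e w b -> chi b = chi w -> w != b ->
    s w * (lam w - lam b) = x w - x b.
  move=> wb bi nwb; have := xY w _ _ wb.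
  rewrite axis_dotB eqxx (negPf nwb) subr0 mul1r bi => <-.
  have [oi ow] := oP w.
  by rewrite /s (Yc w (chi w) (o w) b) // 1?eq_sym //; ring.
have sc w b : chi b = chi w -> s w = s b.
  move=> bi; apply: (@class_const (chi w) None s) => // a c _ _ ac ai ci.
  have [->//|nac] := eqVneq a c.
  have nz : lam a - lam c != 0 by rewrite lamB_eq0.
  apply: (mulIf nz); rewrite sE ?ai ?ci // -[x a - x c]opprB.
  by rewrite -(sE c a) ?ai ?ci 1?esym // 1?eq_sym //; ring.
have /choice[r rP] : forall i, exists u, chi u = i.
  by move=> i; have [u [_ [_ ui _]]] := big i; exists u.
pose sigma i := s (r i).
have ssig w : s w = sigma (chi w) by apply: sc; rewrite rP.
pose tau i := x (r i) - sigma i * lam (r i).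
have xE v : x v = tau (chi v) + sigma (chi v) * lam v.
  set i := chi v; suff : x v - sigma i * lam v = tau i.
    by move=> <-; rewrite subrK.
  apply: (@class_const i None (fun v => x v - sigma i * lam v)) => //.
  move=> a b _ _ ab ai bi; have [->//|nab] := eqVneq a b.
  have := @sE a b ab; rewrite ai bi ssig ai => /(_ erefl nab) E.
  by move: E; lra.
have tauE i j : tau i = tau j.
  have [->//|ij] := eqVneq i j.
  have [w [b [b' [[wb wb' bb'] [wi bj b'j]]]]] := two_neighbours ij.
  have ji : j != chi w by rewrite wi eq_sym.
  have bw : b != w by apply: contraNneq ji => <-; rewrite bj.
  have b'w : b' != w by apply: contraNneq ji => <-; rewrite b'j.
  have [oi ow] := oP w; rewrite wi in oi.
  (* [cj] and [ci] are the values of the longitudinal components off [w]. *)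
  pose ci := Y w (o w) i; pose cj := Y w (r j) j.
  pose g a := if chi a == i then (Y w a j - cj) / lam a
              else - (Y w a i - ci) / lam a.
  have gbb' : g b = g b'.
    apply: (@conn i j (Some w) g) => //; last 2 first.
    - by rewrite bj !inE eqxx orbT.
    - by rewrite b'j !inE eqxx orbT.
    move=> a c aw cw ac ai cj'; have {}aw : a != w := aw; have {}cw : c != w := cw.
    rewrite /g ai cj' eqxx eq_sym (negPf ij).
    have := xY w _ _ ac; rewrite axis_dotB ai cj' ![w == _]eq_sym (negPf aw).
    rewrite (negPf cw) subrr mul0r (Yc w i a (o w)) // -/ci (Yc' w j c (r j)) ?rP //.
    rewrite -/cj => E.
    have := lam_neq0 a; have := lam_neq0 c => c0 a0.
    apply: (mulIf a0); rewrite divfK //; apply: (mulIf c0).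
    rewrite mulrAC divfK //; apply/eqP; rewrite -subr_eq0 -oppr_eq0; apply/eqP.
    by rewrite -E; ring.
  have key c : e w c -> chi c = j ->
      (tau i - tau j) / lam c = lam w * g c - (Y w w j - cj) + sigma j.
    move=> wc cj'; have wNc : w != c.
      by apply: contraNneq ij => wc'; rewrite -wi -cj' wc'.
    have := xY w _ _ wc.
    rewrite eqxx (negPf wNc) subr0 mul1r axis_dotB wi cj'.
    rewrite !xE wi cj' (Yc' w j c (r j)) ?rP // -/cj /g cj' eq_sym (negPf ij).
    have : Y w w i = ci + sigma i by rewrite -wi -ssig /s wi /ci addrC subrK.
    move=> -> E; have c0 := lam_neq0 c; apply: (mulIf c0); rewrite divfK //.
    rewrite (_ : _ * lam c = - (lam w * (Y w c i - ci)) - lam c * (Y w w j - cj)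
      + lam c * sigma j); first by move: E; lra.
    by move: (lam c) c0 => l l0; field.
  have := key b wb bj; rewrite gbb' -key // => /eqP; rewrite -subr_eq0 -mulrBr.
  rewrite mulf_eq0 subr_eq0 => /orP[/eqP //|].
  by rewrite subr_eq0 (inj_eq invr_inj) (inj_eq lam_inj) (negPf bb').
have i0 : 'I_d + ('I_d -> False).
  by case: (d) => [|n]; [right => -[]|left; exact: ord0].
case: i0 => [i0|nod].
  exists (tau i0), sigma => v; under eq_bigr do rewrite mulrC.
  by rewrite axis_dot xE (tauE _ i0) [_ * lam v]mulrC.
by exists 0, (fun=> 0) => v; case: (nod (chi v)).
Qed.

End Axis.

(** * The core is congruent in every realisation *)

Section Complex.
Context {R : realType} {d : nat} {V : finType}.
Variables (e : rel V).
Local Notation conf := (V -> 'rV[R]_d).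

(** The complex whose middle space consists of a function [x] on the vertices and
    of velocity fields [Y w], one for each vertex [w]. The system requires [Y w]
    to change the squared length of each edge at [w] by the difference of [x]
    along it and to preserve the other lengths. Its evident solutions are: [x]
    affine, and [Y w] the translation of [w] alone along the linear part of [x]
    plus an infinitesimal isometry. *)
Definition system_param : finType := (option 'I_d + V * ('I_d + 'I_d * 'I_d))%type.
Definition system_var : finType := (V + V * (V * 'I_d))%type.

Definition trivial_solution (q : conf) (c : system_param -> R) (j : system_var) : R :=
  match j with
  | inl v => c (inl None) + \sum_k q v 0 k * c (inl (Some k))
  | inr (w, (a, k)) => c (inr (w, inl k)) +
      \sum_l q a 0 l * (c (inr (w, inr (k, l))) - c (inr (w, inr (l, k)))) +
      (a == w)%:R * c (inl (Some k))
  end.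

Definition edge_system (q : conf) (y : system_var -> R) (t : V * (V * V)) : R :=
  let: (w, (a, b)) := t in
  (e a b)%:R *
  (\sum_k (q a 0 k - q b 0 k) * (y (inr (w, (a, k))) - y (inr (w, (b, k)))) -
   ((w == a)%:R - (w == b)%:R) * (y (inl a) - y (inl b))).

Lemma polyfun_bool (b : bool) : polyfun (fun _ : conf => b%:R).
Proof. by case: b; [exact: polyfun1|exact: polyfun0]. Qed.

Lemma polylin_trivial_solution j : polylin (fun q c => trivial_solution q c j).
Proof.
case: j => [v|[w [a k]]] /=.
  apply: polylinD; first exact: polylin_coord.
  apply: polylin_sum => k; apply: polylinM; last exact: polylin_coord.
  exact: polyfun_coord.
apply: polylinD; last first.
  by apply: polylinM; [exact: polyfun_bool|exact: polylin_coord].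
apply: polylinD; first exact: polylin_coord.
apply: polylin_sum => l; apply: polylinM; first exact: polyfun_coord.
by apply: polylinB; apply: polylin_coord.
Qed.

Lemma polylin_edge_system t : polylin (fun q y => edge_system q y t).
Proof.
case: t => w [a b] /=; apply: polylinM; first exact: polyfun_bool.
apply: polylinB.
  apply: polylin_sum => l; apply: polylinM.
    by apply: polyfunB; apply: polyfun_coord.
  by apply: polylinB; apply: polylin_coord.
apply: polylinM; first by apply: polyfunB; apply: polyfun_bool.
by apply: polylinB; apply: polylin_coord.
Qed.

Lemma skew_sum (x : 'I_d -> R) (S : 'I_d -> 'I_d -> R) :
  \sum_k x k * (\sum_l x l * (S k l - S l k)) = 0.
Proof.
under eq_bigr do rewrite mulr_sumr; under eq_bigr do under eq_bigr do rewrite 2!mulrBr.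
under eq_bigr do rewrite sumrB; rewrite sumrB [X in _ - X]exchange_big /=.
apply/eqP; rewrite subr_eq0; apply/eqP; apply: eq_bigr => k _.
by apply: eq_bigr => l _; rewrite mulrCA.
Qed.

Lemma edge_system_trivial q c t : edge_system q (trivial_solution q c) t = 0.
Proof.
case: t => w [a b] /=; have [ab|] := boolP (e a b); last by rewrite mul0r.
rewrite mul1r; set z := fun k => q a 0 k - q b 0 k.
set A := fun k l => c (inr (w, inr (k, l))) - c (inr (w, inr (l, k))).
rewrite [X in X - _](_ : _ = \sum_k (z k * (\sum_l z l * A k l) +
   ((w == a)%:R - (w == b)%:R) * (z k * c (inl (Some k))))); last first.
  apply: eq_bigr => k _; rewrite mulrCA -mulrDr; congr (_ * _).
  rewrite (_ : \sum_l z l * A k l = \sum_l q a 0 l * A k l - \sum_l q b 0 l * A k l).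
    by rewrite /A ![w == _]eq_sym; ring.
  by rewrite -sumrB; apply: eq_bigr => l _; rewrite mulrBl.
rewrite big_split /= skew_sum add0r -mulr_sumr -mulrBr.
have -> : \sum_k z k * c (inl (Some k)) =
  \sum_k q a 0 k * c (inl (Some k)) - \sum_k q b 0 k * c (inl (Some k)).
  by rewrite -sumrB; apply: eq_bigr => k _; rewrite mulrBl.
by ring.
Qed.

(** [x] is affine by [axis_affine]; subtracting the solution that it induces
    leaves an infinitesimal motion for each [w], which [axis_motion] describes. *)
Lemma axis_exact (chi : V -> 'I_d) : symmetric e ->
  colour_connected R e chi ->
  (forall i, exists u u', [/\ u != u', chi u = i & chi u' = i]) ->
  forall x, (forall t, edge_system (axis_conf chi) x t = 0) ->
  exists c, x =1 trivial_solution (axis_conf chi) c.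
Proof.
move=> esym conn big x Gx0; set p0 := axis_conf chi.
have xY w a b : e a b -> \sum_k (p0 a 0 k - p0 b 0 k) *
     (x (inr (w, (a, k))) - x (inr (w, (b, k)))) =
     ((w == a)%:R - (w == b)%:R) * (x (inl a) - x (inl b)).
  move=> ab; have := Gx0 (w, (a, b)); rewrite /= ab mul1r => /eqP.
  by rewrite subr_eq0 => /eqP.
have [tau [sigma xE]] := axis_affine esym conn big xY.
have my w : motion e p0 (fun a k => x (inr (w, (a, k))) - (a == w)%:R * sigma k).
  move=> a b ab.
  rewrite [LHS](_ : _ = \sum_k (p0 a 0 k - p0 b 0 k) *
     (x (inr (w, (a, k))) - x (inr (w, (b, k)))) -
     ((w == a)%:R - (w == b)%:R) * \sum_k sigma k * (p0 a 0 k - p0 b 0 k)).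
    rewrite xY // !xE.
    have -> : \sum_k sigma k * (p0 a 0 k - p0 b 0 k) =
        \sum_k sigma k * p0 a 0 k - \sum_k sigma k * p0 b 0 k.
      by rewrite -sumrB; apply: eq_bigr => k _; rewrite mulrBr.
    by ring.
  rewrite mulr_sumr -sumrB; apply: eq_bigr => k _.
  by rewrite ![w == _]eq_sym; ring.
have /choice[cS cSP] : forall w, exists cS : ('I_d -> R) * ('I_d -> 'I_d -> R),
    forall v k, x (inr (w, (v, k))) - (v == w)%:R * sigma k =
      cS.1 k + \sum_l (cS.2 k l - cS.2 l k) * p0 v 0 l.
  by move=> w; have [c [S cSE]] := axis_motion conn big (my w); exists (c, S).
exists (fun i => match i with
  | inl None => tau | inl (Some k) => sigma k
  | inr (w, inl k) => (cS w).1 k | inr (w, inr (k, l)) => (cS w).2 k l end).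
case=> [v|[w [a k]]] /=.
  by rewrite xE; congr (_ + _); apply: eq_bigr => k _; rewrite mulrC.
have /eqP := cSP w a k; rewrite subr_eq => /eqP ->; congr (_ + _ + _).
by apply: eq_bigr => l _; rewrite mulrC.
Qed.

End Complex.

Section Core.
Context {R : realType} {d : nat} {V : finType}.
Variables (e : rel V).
Local Notation conf := (V -> 'rV[R]_d).

Definition affinely_spanning (p : conf) :=
  forall (al : 'I_d -> R) (be : R),
    (forall v, \sum_k p v 0 k * al k = be) -> forall k, al k = 0.

Definition rigidity_map (q : conf) (y : V * 'I_d -> R) (t : V * V) : R :=
  (e t.1 t.2)%:R *
  \sum_k (q t.1 0 k - q t.2 0 k) * (y (t.1, k) - y (t.2, k)).

Lemma polylin_rigidity_map t : polylin (fun q y => rigidity_map q y t).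
Proof.
apply: polylinM; first exact: polyfun_bool.
apply: polylin_sum => l; apply: polylinM.
  by apply: polyfunB; apply: polyfun_coord.
by apply: polylinB; apply: polylin_coord.
Qed.

(** Moving [w] alone along a coordinate axis shows that the coordinates of [q]
    solve the system at [q], hence at [p], so they are affine functions of [p].
    The quadratic form [A A^T - 1] then vanishes on the edges, so it defines a
    motion: it is both symmetric and skew. *)
Lemma core_congruent (chi : V -> 'I_d) (p q : conf) :
  symmetric e -> colour_connected R e chi ->
  (forall i, exists u u', [/\ u != u', chi u = i & chi u' = i]) ->
  zariski_generic p -> affinely_spanning p ->
  (forall v : conf, exists z : conf, forall a b, e a b ->
     \sum_k (p a 0 k - p b 0 k) * (v a 0 k - v b 0 k) =
     \sum_k (q a 0 k - q b 0 k) * (z a 0 k - z b 0 k)) ->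
  (forall a b, e a b ->
     \sum_k (p a 0 k - p b 0 k) ^+ 2 = \sum_k (q a 0 k - q b 0 k) ^+ 2) ->
  exists (A : 'M[R]_d) (t : 'rV[R]_d),
    A *m A^T = 1%:M /\ forall v, q v = p v *m A + t.
Proof.
move=> syme conn big gp span vel len.
have exact_p : forall x, (forall t, edge_system e p x t = 0) -> exists c, x =1 trivial_solution p c.
  apply: (zariski_exact gp (@polylin_trivial_solution _ _ _) (polylin_edge_system e) (edge_system_trivial e)).
  exact: (axis_exact syme conn big).
have img : forall z, exists v, rigidity_map q z =1 rigidity_map p v.
  apply: zariski_image_sub gp polylin_rigidity_map _ => v.
  have [z zE] := vel (fun a => \row_k v (a, k)).
  exists (fun t => z t.1 0 t.2) => -[a b]; rewrite /rigidity_map /=.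
  case: (boolP (e a b)) => [ab|_]; last by rewrite !mul0r.
  rewrite -zE //; congr (_ * _); apply: eq_bigr => k _.
  by rewrite !mxE.
have /choice[st stP] : forall k0, exists st : R * ('I_d -> R),
    forall v, q v 0 k0 = st.1 + \sum_k p v 0 k * st.2 k.
  move=> k0.
  have /choice[Y YP] := fun w => img (fun t => ((t.1 == w) && (t.2 == k0))%:R).
  pose x (j : @system_var d V) := match j with inl v => q v 0 k0 | inr (w, t) => Y w t end.
  have [|c cE] := exact_p x.
    case=> w [a b] /=; have := YP w (a, b); rewrite /rigidity_map /=.
    rewrite mulrBr => <-; rewrite -mulrBr.
    rewrite (bigD1 k0) //= eqxx !andbT big1 => [|k /negPf ->]; last first.
      by rewrite !andbF subrr mulr0.
    by rewrite ![w == _]eq_sym; case: (e a b); rewrite ?mul0r // mul1r; ring.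
  by exists (c (inl None), fun k => c (inl (Some k))) => v; rewrite -[LHS]/(x (inl v)) cE.
pose A : 'M[R]_d := \matrix_(k, k0) (st k0).2 k.
pose t : 'rV[R]_d := \row_k0 (st k0).1.
have qE v : q v = p v *m A + t.
  apply/rowP => k0; rewrite !mxE stP addrC; congr (_ + _).
  by apply: eq_bigr => k _; rewrite !mxE.
exists A, t; split=> //.
pose Q : 'M[R]_d := A *m A^T - 1%:M.
have Qsym : Q^T = Q by rewrite /Q linearB /= trmx_mul trmxK trmx1.
have sqE (u : 'rV[R]_d) : \sum_k u 0 k ^+ 2 = (u *m u^T) 0 0.
  by rewrite mxE; apply: eq_bigr => k _; rewrite mxE expr2.
have [w _|V0] := pickP (fun _ : V => true); last first.
  have no (k : 'I_d) : False.
    have : (1 : R) = 0 by apply: (span (fun=> 1) 0 _ k) => v; have := V0 v.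
    by move/eqP; rewrite oner_eq0.
  by apply/matrixP => k; case: (no k).
pose x (j : @system_var d V) := match j with inl v => 0 : R
  | inr (w, (a, k)) => (p a *m Q) 0 k end.
have [|c cE] := exact_p x.
  case=> w' [a b] /=; have [ab|_] := boolP (e a b); last by rewrite mul0r.
  rewrite mul1r subrr mulr0 subr0.
  set u := p a - p b.
  transitivity ((u *m Q *m u^T) 0 0).
    rewrite mxE; apply: eq_bigr => k _.
    by rewrite [u^T _ _]mxE mulrC mulmxBl !mxE.
  rewrite /Q mulmxBr mulmx1 mulmxBl mulmxA -[_ *m A^T *m _]mulmxA -trmx_mul.
  have -> : u *m A = q a - q b.
    by rewrite !qE opprD addrACA subrr addr0 mulmxBl.
  rewrite mxE [X in _ + X]mxE -!sqE.
  have := len _ _ ab.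
  rewrite (eq_bigr (fun k => u 0 k ^+ 2)) => [->|k _]; last by rewrite !mxE.
  by apply/eqP; rewrite subr_eq0; apply/eqP/eq_bigr => k _; rewrite !mxE.
have c0 k : c (inl (Some k)) = 0.
  apply: (span (fun k => c (inl (Some k))) (- c (inl None))) => v.
  by have := cE (inl v); rewrite /= => /esym/eqP; rewrite addrC addr_eq0 => /eqP.
have QS k l : Q l k = c (inr (w, inr (k, l))) - c (inr (w, inr (l, k))).
  apply/eqP; rewrite -subr_eq0; apply/eqP.
  apply: (span (fun l => Q l k - (c (inr (w, inr (k, l))) - c (inr (w, inr (l, k)))))
     (c (inr (w, inl k)))) => v.
  have := cE (inr (w, (v, k))); rewrite /= c0 mulr0 addr0 mxE => /eqP.
  rewrite -subr_eq => /eqP <-; rewrite -sumrB.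
  by apply: eq_bigr => l' _; rewrite mulrBr.
apply/eqP; rewrite -subr_eq0 -/Q; apply/eqP/matrixP => l k.
have : Q k l = Q l k by rewrite -{1}Qsym mxE.
have := QS k l; have := QS l k; rewrite [(0 : 'M_d) l k]mxE.
by move: (Q k l) (Q l k) => x1 x2; lra.
Qed.

End Core.

(** * Existence of generic frameworks *)

Lemma reals_uncountable (R : realType) (A : set R) :
  countable A -> exists x, ~ A x.
Proof.
move=> cA; apply: contrapT => AT.
have : lebesgue_measure `[0%R, 1%R]%classic = 0%E :> \bar R.
  apply: countable_lebesgue_measure0; apply: sub_countable cA.
  by apply: subset_card_le => x _; apply: contrapT => nAx; apply: AT; exists x.
rewrite lebesgue_measure_itv /= lte_fin ltr01 => /eqP.
by rewrite sube0 eqe oner_eq0.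
Qed.

Lemma mpoly_rat_countable n :
  countable [set: mpoly.mpoly n rat]%classic.
Proof.
apply/countable_injP.
pose code (f : mpoly.mpoly n rat) :=
  [seq (m, mpoly.mcoeff m f) | m <- mpoly.msupp f].
exists (pickle \o code) => f g _ _ /= /(pcan_inj pickleK) fg.
have supp : mpoly.msupp f = mpoly.msupp g.
  have fstE h : map fst (code h) = mpoly.msupp h.
    by rewrite /code -map_comp -[RHS]map_id; apply: eq_map.
  by rewrite -!fstE fg.
apply/mpoly.mpolyP => m.
have [mf|mf] := boolP (m \in mpoly.msupp f); last first.
  by rewrite (mpoly.memN_msupp_eq0 mf) mpoly.memN_msupp_eq0 -?supp.
have : (m, mpoly.mcoeff m f) \in code g.
  by rewrite -fg; apply/mapP; exists m.
by case/mapP => m' _ [-> ->].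
Qed.

Lemma muni_eq0 n (f : mpoly.mpoly n.+1 rat) : mpoly.muni f = 0 -> f = 0.
Proof.
move=> f0; apply/mpoly.mpolyP => m; rewrite mpoly.mcoeff0.
pose r (m : mpoly.multinom n.+1) : mpoly.multinom n :=
  mpoly.Multinom [tuple m (widen_ord (leqnSn n) i) | i < n].
have rI (m1 m2 : mpoly.multinom n.+1) : r m1 = r m2 -> m1 ord_max = m2 ord_max -> m1 = m2.
  move=> r12 max12; apply/mpoly.mnmP => i.
  case: (unliftP ord_max i) => [j|] ->; last by [].
  have := congr1 (fun m : mpoly.multinom n => m j) r12.
  rewrite /r !mpoly.mnmE; have -> // : widen_ord (leqnSn n) j = lift ord_max j.
  by apply: val_inj; rewrite /= /bump leqNgt ltn_ord.
have <- : mpoly.mcoeff (r m) (mpoly.muni f)`_(m ord_max) = mpoly.mcoeff m f.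
  rewrite mpoly.muniE coef_sum raddf_sum /=.
  rewrite [LHS](_ : _ = \sum_(m' <- mpoly.msupp f) (m == m')%:R * mpoly.mcoeff m' f).
    have [mf|mf] := boolP (m \in mpoly.msupp f); last first.
      rewrite (mpoly.memN_msupp_eq0 mf) big_seq big1 // => m' m'f.
      by rewrite (_ : m == m' = false) ?mul0r //; apply: contraNF mf => /eqP ->.
    rewrite (bigD1_seq m) ?mpoly.msupp_uniq //= eqxx mul1r big1 ?addr0 // => m'.
    by rewrite eq_sym => /negPf ->; rewrite mul0r.
  apply: eq_bigr => m' _; rewrite coefZ coefXn.
  have [->|mm'] := eqVneq m m'.
    by rewrite eqxx mulr1 mpoly.mcoeffZ mpoly.mcoeffX eqxx mul1r mulr1.
  rewrite mul0r; have [mmax|mmax] := eqVneq (m ord_max) (m' ord_max); last first.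
    by rewrite mulr0 mpoly.mcoeff0.
  rewrite mulr1 mpoly.mcoeffZ mpoly.mcoeffX.
  case: eqP => [rr|_]; last by rewrite mulr0.
  by rewrite (rI _ _ (esym rr) mmax) eqxx in mm'.
by rewrite f0 coef0 mpoly.mcoeff0.
Qed.

Lemma mmap_muni (R : realType) n (x : 'I_n.+1 -> R) (f : mpoly.mpoly n.+1 rat) :
  mpoly.mmap ratr x f =
  (map_poly (mpoly.mmap ratr (fun i => x (widen_ord (leqnSn n) i)))
     (mpoly.muni f)).[x ord_max].
Proof.
rewrite mpoly.muniE rmorph_sum /= horner_sum; apply: eq_bigr => m _.
rewrite map_polyZ map_polyXn hornerZ hornerXn.
rewrite -[X in _ = X * _]/(mpoly.mmap ratr _ _) mpoly.mmapZ -[RHS]mulrA; congr (_ * _).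
rewrite mpoly.mmapX /mpoly.mmap1 big_ord_recr; congr (_ * _).
by apply: eq_bigr => i _; rewrite mpoly.mnmE.
Qed.

Lemma finite_roots (R : realType) (g : {poly R}) :
  g != 0 -> finite_set [set b | root g b]%classic.
Proof.
elim: {g}(size g) {-2}g (leqnn (size g)) => [|k IHk] g.
  by rewrite size_poly_leq0 => ->.
move=> gk g0; have [[b gb]|noroot] := pselect (exists b, root g b); last first.
  rewrite (_ : [set b | root g b]%classic = classical_sets.set0).
    exact: finite_set0.
  by rewrite -classical_sets.subset0 => b gb; apply: noroot; exists b.
have /factor_theorem[h gE] := gb.
have h0 : h != 0 by apply: contra_neq g0 => h0; rewrite gE h0 mul0r.
have hk : (size h <= k)%N.
  by move: gk; rewrite gE size_Mmonic ?monicXsubC // size_XsubC addn2.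
apply: (sub_finite_set (B := ([set b | root h b] `|` [set b])%classic)).
  move=> c /=; rewrite gE rootM root_XsubC => /orP[hc|/eqP ->]; by [left|right].
by rewrite finite_setU; split; [exact: IHk|exact: finite_set1].
Qed.

(** Each new coordinate avoids the countably many roots of the nonzero
    polynomials over the previous ones. *)
Lemma alg_independent_exists (R : realType) n :
  exists x : 'I_n -> R, forall f : mpoly.mpoly n rat,
    mpoly.mmap ratr x f = 0 -> f = 0.
Proof.
elim: n => [|n [x xP]].
  exists (fun=> 0) => f; rewrite (mpoly.nvar0_mpolyC_eq f erefl) mpoly.mmapC.
  by move/eqP; rewrite fmorph_eq0 => /eqP ->; rewrite mpoly.mpolyC0.
pose ev' (f : mpoly.mpoly n.+1 rat) := map_poly (mpoly.mmap ratr x) (mpoly.muni f).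
have [b bP] : exists b, ~ (\bigcup_(f in [set f | ev' f != 0]) [set b | root (ev' f) b])%classic b.
  apply: reals_uncountable; apply: bigcup_countable.
    by apply: sub_countable (mpoly_rat_countable n.+1); apply: subset_card_le.
  move=> f /= f0; apply: finite_set_countable.
  exact: finite_roots.
exists (fun i => if unlift ord_max i is Some j then x j else b) => f.
rewrite mmap_muni unlift_none.
rewrite (_ : mpoly.mmap _ _ = mpoly.mmap ratr x) -/(ev' f); last first.
  congr mpoly.mmap; apply/funext => i.
  have -> : widen_ord (leqnSn n) i = lift ord_max i.
    by apply: val_inj; rewrite /= /bump leqNgt ltn_ord.
  by rewrite liftK.
move=> fb; have [f0|f0] := eqVneq (ev' f) 0; last by case: bP; exists f => //; apply/eqP.
apply: muni_eq0; apply/polyP => k; rewrite coef0; apply: xP.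
by have := congr1 (fun g : {poly R} => g`_k) f0; rewrite /ev' coef_map coef0.
Qed.

Lemma generic_exists (R : realType) (d : nat) (V : finType) :
  exists p : V -> 'rV[R]_d, generic p.
Proof.
have [x xP] := alg_independent_exists R #|{: V * 'I_d}|.
exists (fun v => \row_i x (enum_rank (v, i))) => f.
rewrite (_ : (fun k => _) = x); first exact: xP.
by apply/funext => k; rewrite mxE -surjective_pairing enum_valK.
Qed.

(** * Globally rigid graphs *)

Lemma adj_sym (V : finType) (G : graph V) : symmetric (adj G).
Proof. by move=> u v; rewrite /adj setUC. Qed.

Lemma adj_irr (V : finType) (G : graph V) u : adj G u u = false.
Proof.
apply/existsP => -[f /andP[_ /eqP E]]; have := valP f.
by rewrite E setUid cards1.
Qed.

Lemma adjS (V : finType) (G H : graph V) u v :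
  G \subset H -> adj G u v -> adj H u v.
Proof.
move=> /subsetP GH /existsP[f /andP[fG fE]].
by apply/existsP; exists f; rewrite GH.
Qed.

Section Euclidean.
Context {R : realType} {d : nat}.

Lemma enorm_eqP (x y : 'rV[R]_d) :
  enorm x = enorm y <-> \sum_i x 0 i ^+ 2 = \sum_i y 0 i ^+ 2.
Proof.
split=> [|E]; last by rewrite /enorm E.
have pos (z : 'rV[R]_d) : 0 <= \sum_i z 0 i ^+ 2.
  by apply: sumr_ge0 => i _; rewrite sqr_ge0.
by move=> /(congr1 (fun t => t ^+ 2)); rewrite /enorm !sqr_sqrtr.
Qed.

Lemma sqnormE (x : 'rV[R]_d) : \sum_i x 0 i ^+ 2 = (x *m x^T) 0 0.
Proof. by rewrite mxE; apply: eq_bigr => i _; rewrite mxE expr2. Qed.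

Lemma isometry_orthogonal (A : 'M[R]_d) (t : 'rV[R]_d) :
  A *m A^T = 1%:M -> Defs.isometry (fun x => x *m A + t).
Proof.
move=> AA x y; rewrite opprD addrACA subrr addr0 -mulmxBl.
by apply/enorm_eqP; rewrite !sqnormE trmx_mul mulmxA -[_ *m A *m _]mulmxA AA mulmx1.
Qed.

End Euclidean.

Section GeneralPosition.
Context {R : realType} {d : nat} {V : finType}.
Variable p : V -> 'rV[R]_d.
Hypothesis gp : zariski_generic p.

(** The determinant of the difference vectors does not vanish identically:
    consider the vertices of a standard simplex. *)
Lemma zariski_general_position (h : 'I_d.+1 -> V) (al : 'I_d -> R) (be : R) :
  injective h -> (forall i, \sum_k p (h i) 0 k * al k = be) ->
  forall k, al k = 0.
Proof.
move=> hI hE.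
pose N (q : V -> 'rV[R]_d) : 'M[R]_d :=
  \matrix_(i, k) (q (h (lift ord0 i)) 0 k - q (h ord0) 0 k).
have detN : \det (N p) != 0.
  apply: (gp (F := fun q => \det (N q))).
    apply: polyfun_det => i k.
    have [f fE] := polyfunB (polyfun_coord (R := R) (h (lift ord0 i)) k)
      (polyfun_coord (h ord0) k).
    by exists f => q; rewrite mxE fE.
  pose q0 v : 'rV[R]_d := \row_k (v == h (lift ord0 k))%:R.
  exists q0; rewrite (_ : N q0 = 1%:M) ?det1 ?oner_eq0 //.
  apply/matrixP => i k; rewrite !mxE !(inj_eq hI) (inj_eq lift_inj).
  by rewrite (negPf (neq_lift _ _)) subr0.
have : N p *m \col_k al k = 0.
  apply/matrixP => i j; rewrite !mxE -[RHS](subrr be) -{1}(hE (lift ord0 i)).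
  rewrite -(hE ord0) -sumrB; apply: eq_bigr => k _.
  by rewrite !mxE mulrBl.
move=> /(congr1 (mulmx (invmx (N p)))); rewrite mulKmx ?unitmxE ?unitfE //.
by rewrite mulmx0 => al0 k; have /matrixP/(_ k 0) := al0; rewrite !mxE.
Qed.

Lemma zariski_general_position_set (B : {set V}) (al : 'I_d -> R) (be : R) :
  (d < #|B|)%N -> (forall v, v \in B -> \sum_k p v 0 k * al k = be) ->
  forall k, al k = 0.
Proof.
move=> dB BE.
pose h (i : 'I_d.+1) := enum_val (widen_ord dB i).
apply: (@zariski_general_position h al be) => [i j|i]; last exact/BE/enum_valP.
by move/enum_val_inj/(congr1 val) => /= ij; apply: val_inj.
Qed.

(** A point is determined by its distances to more than [d] points in general
    position: these would all lie on the hyperplane bisecting two candidates. *)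
Lemma lateration (A : 'M[R]_d) (t : 'rV[R]_d) (q : V -> 'rV[R]_d) v (B : {set V}) :
  A *m A^T = 1%:M -> (d < #|B|)%N ->
  (forall u, u \in B -> q u = p u *m A + t) ->
  (forall u, u \in B -> enorm (q v - q u) = enorm (p v - p u)) ->
  q v = p v *m A + t.
Proof.
move=> AA dB Bq Bd; have AA' := mulmx1C AA.
pose z := (q v - t) *m A^T.
have qvE : q v = z *m A + t by rewrite /z -mulmxA AA' mulmx1 subrK.
have al0 : forall k, (p v - z) 0 k = 0.
  apply: (@zariski_general_position_set B _
     ((\sum_k p v 0 k ^+ 2 - \sum_k z 0 k ^+ 2) / 2%:R)) => // u uB.
  have := isometry_orthogonal t AA z (p u); rewrite -qvE -Bq // => zu.
  have := Bd u uB; rewrite zu => /enorm_eqP E.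
  have : \sum_i (z - p u) 0 i ^+ 2 - \sum_i (p v - p u) 0 i ^+ 2 =
    \sum_k z 0 k ^+ 2 - \sum_k p v 0 k ^+ 2 + (\sum_k p u 0 k * (p v - z) 0 k) * 2%:R.
    rewrite mulr_suml -!sumrB -big_split; apply: eq_bigr => k _ /=.
    by rewrite !mxE; ring.
  rewrite E subrr; lra.
rewrite qvE; congr (_ *m _ + _); apply/rowP => k.
by have := al0 k; rewrite !mxE => /eqP; rewrite subr_eq0 => /eqP ->.
Qed.

End GeneralPosition.

Definition colour_connected_in (R : realType) (d : nat) (V : finType)
    (W : {set V}) (e : rel V) (chi : V -> 'I_d) :=
  forall (i j : 'I_d) (z : option V) (g : V -> R),
    (forall a b, a \in W -> b \in W -> Some a != z -> Some b != z -> e a b ->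
       chi a = i -> chi b = j -> g a = g b) ->
    forall a b, a \in W -> b \in W -> Some a != z -> Some b != z ->
      chi a \in [:: i; j] -> chi b \in [:: i; j] -> g a = g b.

Lemma colour_connected_sub (R : realType) (d : nat) (V : finType)
    (W : {set V}) (e : rel V) (chi : V -> 'I_d) :
  colour_connected_in R W e chi ->
  colour_connected R (relpre val e : rel {v | v \in W}) (chi \o val).
Proof.
move=> conn i j z g gE a b az bz ai bi.
pose g' v := if insub v is Some u then g u else 0.
have g'E (u : {v | v \in W}) : g' (val u) = g u by rewrite /g' valK.
have zE (u : {v | v \in W}) : (Some (val u) != omap val z) = (Some u != z).
  by case: z {gE az bz} => [z|] //=; rewrite !(inj_eq Some_inj) val_eqE.
rewrite -!g'E; apply: (conn i j (omap val z) g' _ _ _ (valP a) (valP b)); rewrite ?zE //.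
have UE c : c \in W -> exists u : {v | v \in W}, c = val u.
  by move=> cW; exists (Sub c cW); rewrite SubK.
by move=> c c' /UE[u ->] /UE[u' ->]; rewrite !zE !g'E; apply: gE.
Qed.

(** Every realisation with the same edge lengths agrees with [p] on the core, up
    to an isometry; a set of disagreement would contain a vertex with more than
    [d] neighbours at which the two agree. *)
Lemma globally_rigid_criterion (R : realType) (d : nat) (V : finType)
    (G : graph V) (W : {set V}) (chi : V -> 'I_d) :
  (d < #|W|)%N ->
  colour_connected_in R W (adj G) chi ->
  (forall i, exists u u', [/\ u \in W, u' \in W, u != u', chi u = i & chi u' = i]) ->
  (forall X : {set V}, X \subset ~: W -> X != set0 ->
     exists2 v, v \in X & (d < #|[set u in ~: X | adj G v u]|)%N) ->
  globally_rigid R d G.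
Proof.
move=> dW conn big clos.
have [p gp] := generic_exists R d V; exists p => // q len.
have dp := generic_zariski gp.
pose U : finType := {v : V | v \in W}.
have pU := zariski_comp (h := val : U -> V) val_inj dp.
have vel v := generic_velocity q v gp.
have lenE a b : adj G a b -> \sum_k (p a 0 k - p b 0 k) ^+ 2 =
    \sum_k (q a 0 k - q b 0 k) ^+ 2.
  move=> ab; have /enorm_eqP := len _ _ ab.
  rewrite (eq_bigr (fun k => (q a 0 k - q b 0 k) ^+ 2)) => [->|k _]; last by rewrite !mxE.
  by apply: eq_bigr => k _; rewrite !mxE.
have [|||||||A [t [AA qE]]] :=
    @core_congruent R d U (relpre val (adj G)) (chi \o val) (p \o val) (q \o val).
- by move=> u v; rewrite /= adj_sym.
- exact: colour_connected_sub.
- move=> i; have [u [u' [uW u'W uu' ui u'i]]] := big i.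
  by exists (Sub u uW), (Sub u' u'W); split; rewrite ?/= ?SubK // -val_eqE /= ?SubK.
- exact: pU.
- move=> al be alE; apply: (zariski_general_position_set dp dW (be := be)) => v vW.
  exact: (alE (exist _ v vW)).
- move=> v; have [z zE] := vel (fun w => if insub w is Some u then v u else 0).
  exists (z \o val) => a b ab; have := zE (val a) (val b) (lenE _ _ ab).
  by rewrite !valK.
- by move=> a b /lenE.
exists (fun x => x *m A + t); first exact: isometry_orthogonal.
pose X := [set v | q v != p v *m A + t].
have XE v : (v \in X) = (q v != p v *m A + t) by rewrite inE.
suff X0 : X = set0 by move=> v; apply/eqP; rewrite -[_ == _]negbK -XE X0 inE.
apply/eqP; apply: contraT => /clos[|v vX dv].
  apply/subsetP => v; rewrite XE inE; apply: contra => vW.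
  by apply/eqP; exact: (qE (exist _ v vW)).
suff vE : q v = p v *m A + t by move: vX; rewrite XE vE eqxx.
apply: (lateration dp AA dv) => u.
  by rewrite !inE negbK => /andP[/eqP].
by rewrite !inE => /andP[_] /len.
Qed.

Lemma subset_between (T : finType) (A B : {set T}) k :
  A \subset B -> (#|A| <= k <= #|B|)%N ->
  exists D : {set T}, [/\ A \subset D, D \subset B & #|D| = k].
Proof.
move=> AB /andP[Ak kB].
exists (A :|: [set x in take (k - #|A|) (enum (B :\: A))]); split.
- exact: subsetUl.
- apply/subsetP => x; rewrite !inE => /orP[/(subsetP AB) //|/mem_take].
  by rewrite mem_enum inE => /andP[].
- rewrite cardsU (_ : A :&: _ = set0) ?cards0 ?subn0; last first.
    apply/setP => x; rewrite !inE; apply/negP => /andP[xA /mem_take].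
    by rewrite mem_enum inE xA.
  rewrite cardsE (card_uniqP _) ?take_uniq ?enum_uniq //.
  rewrite size_takel ?subnKC // -cardE cardsD (setIidPr AB).
  by rewrite leq_sub2r.
Qed.

Section LowDegree.
Context {R : realType} {d : nat} {V : finType}.

Lemma hyperplane (p : V -> 'rV[R]_d) (D : {set V}) :
  #|D| = d -> (0 < d)%N -> exists (al : 'I_d -> R) (be : R),
    (exists k, al k != 0) /\
    (forall u, u \in D -> \sum_k p u 0 k * al k = be).
Proof.
move=> Dd d0.
pose h (i : 'I_d) := enum_val (cast_ord (esym Dd) i).
pose M : 'M[R]_(1 + d, d) := col_mx (const_mx (- 1)) (\matrix_(k, i) p (h i) 0 k).
have : kermx M != 0.
  rewrite -mxrank_eq0 mxrank_ker -lt0n subn_gt0.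
  by rewrite (leq_ltn_trans (rank_leq_col M)) // add1n ltnSn.
case/rowV0Pn => x /sub_kermxP xM x0.
have {}xM i : \sum_k p (h i) 0 k * (rsubmx x) 0 k = lsubmx x 0 0.
  have := congr1 (fun y : 'rV_d => y 0 i) xM.
  rewrite -{1}[x]hsubmxK mul_row_col [LHS]mxE [X in X + _]mxE [X in _ + X]mxE.
  rewrite big_ord1 [const_mx _ _ _]mxE mulrN1 [RHS]mxE.
  under eq_bigr do rewrite [X in _ * X]mxE mulrC.
  by move=> /eqP; rewrite addrC subr_eq0 => /eqP.
exists (fun k => rsubmx x 0 k), (lsubmx x 0 0); split; last first.
  move=> u uD; rewrite -(xM (cast_ord Dd (enum_rank_in uD u))).
  by rewrite /h cast_ordK enum_rankK_in.
apply: contrapT => al0; case/eqP: x0; rewrite -[x]hsubmxK.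
have r0 : rsubmx x = 0.
  apply/rowP => k; rewrite [RHS]mxE; apply/eqP; apply: contraT => k0.
  by case: al0; exists k.
have l0 : lsubmx x = 0.
  apply/rowP => i; rewrite ord1 [RHS]mxE -(xM (Ordinal d0)).
  by rewrite r0 big1 // => k _; rewrite mxE mulr0.
by rewrite l0 r0 row_mx0.
Qed.

(** A vertex of degree at most [d] can be reflected in a hyperplane through its
    neighbours, which changes its distance to any vertex off the hyperplane. *)
Lemma globally_rigid_degree (G : graph V) : (0 < d)%N -> (d.+1 < #|V|)%N ->
  globally_rigid R d G -> forall v, (d < degree G v)%N.
Proof.
move=> d0 dV [p gp rig] v; rewrite ltnNge; apply/negP => dv.
have dp := generic_zariski gp.
have [||] := @subset_between V [set u | adj G v u] [set~ v] d.
- by apply/subsetP => u; rewrite !inE; apply: contraTneq => ->; rewrite adj_irr.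
- by rewrite dv cardsC1 -ltnS prednK ?(ltn_trans _ dV) // ltnW.
move=> D [ND Dv Dd].
have vD : v \notin D by apply/negP => /(subsetP Dv); rewrite !inE eqxx.
have [w] : exists w, w \in ~: (v |: D).
  apply/set0Pn; rewrite -card_gt0 cardsCs setCK subn_gt0.
  by rewrite cardsU1 vD Dd add1n.
rewrite !inE negb_or => /andP[wv wD].
have [al [be [[k0 ak0] alD]]] := hyperplane p Dd d0.
have off u : u \notin D -> \sum_k p u 0 k * al k != be.
  move=> uD; apply: contra_neq ak0 => ube.
  apply: (@zariski_general_position_set _ _ _ _ dp (u |: D) al be).
    by rewrite cardsU1 uD Dd.
  by move=> u'; rewrite !inE => /orP[/eqP ->|/alD].
pose n2 := \sum_k al k ^+ 2.
have n20 : n2 != 0.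
  rewrite psumr_eq0 => [|k _]; last exact: sqr_ge0.
  by apply/allPn; exists k0; rewrite ?mem_index_enum // sqrf_eq0.
pose s := \sum_k p v 0 k * al k - be.
pose q u : 'rV[R]_d := if u == v then p v - \row_k (2%:R * s / n2 * al k) else p u.
have dist u : u != v -> \sum_k (q v - q u) 0 k ^+ 2 =
    \sum_k (p v - p u) 0 k ^+ 2 +
    4%:R * s / n2 * (\sum_k p u 0 k * al k - be).
  move=> uv; rewrite /q eqxx (negPf uv).
  set c := 2%:R * s / n2.
  transitivity (\sum_k ((p v - p u) 0 k ^+ 2 -
      2%:R * c * (p v 0 k * al k - p u 0 k * al k) + c ^+ 2 * al k ^+ 2)).
    by apply: eq_bigr => k _; rewrite !mxE; ring.
  rewrite big_split sumrB -!mulr_sumr sumrB -/n2 /=.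
  have -> : \sum_k p v 0 k * al k = s + be by rewrite subrK.
  by rewrite /c; field.
have [|f iso qf] := rig q.
  have lenv u : adj G v u -> enorm (q v - q u) = enorm (p v - p u).
    move=> vu; apply/enorm_eqP; have uD : u \in D.
      by apply: (subsetP ND); rewrite inE.
    rewrite dist; last by apply: contraNneq vD => <-.
    by rewrite alD // subrr mulr0 addr0.
  have enormC (x y : 'rV[R]_d) : enorm (x - y) = enorm (y - x).
    by apply/enorm_eqP; apply: eq_bigr => k _; rewrite !mxE -sqrrN opprB.
  move=> a b; have [->|av] := eqVneq a v; first exact: lenv.
  have [->|bv] := eqVneq b v.
    by rewrite adj_sym => /lenv; rewrite enormC => ->; rewrite enormC.
  by rewrite /q (negPf av) (negPf bv).
have := iso (p v) (p w); rewrite -!qf => /enorm_eqP; rewrite dist //.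
move=> /eqP; rewrite -subr_eq0 addrC addKr => /eqP /eqP.
rewrite !mulf_eq0 invr_eq0 (negPf n20) pnatr_eq0 /= orbF !subr_eq0.
by rewrite (negPf (off _ vD)) (negPf (off _ wD)).
Qed.

End LowDegree.

(** * A highly connected core *)

Definition joined (V : finType) (G : graph V) (K : nat) :=
  forall A B : {set V}, [disjoint A & B] ->
    (#|V| <= K * #|A|)%N -> (#|V| <= K * #|B|)%N ->
    exists a b, [/\ a \in A, b \in B & adj G a b].

Lemma card_bigcup_le (I T : finType) (F : I -> {set T}) :
  (#|\bigcup_i F i| <= \sum_i #|F i|)%N.
Proof.
apply: (big_ind2 (fun (A : {set T}) n => #|A| <= n)%N); first by rewrite cards0.
  by move=> A m B n Am Bn; apply: leq_trans (leq_card_setU _ _) (leq_add Am Bn).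
by [].
Qed.

Section Core.
Context {R : realType} {d : nat} {V : finType}.
Variables (G : graph V) (chi : V -> 'I_d) (K : nat).
Hypothesis Gjoin : joined G K.
Hypothesis class_size : forall i,
  ((2 * d ^ 2 + 5) * #|V| <= K * #|[set v | chi v == i]|)%N.
Hypothesis K_small : (K <= #|V|)%N.

Definition class_nbrs (X Y : {set V}) (j : 'I_d) : {set V} :=
  [set b in ~: X | (chi b == j) && [exists a in Y, adj G a b]].

(** Bookkeeping for the successive removal of small sides of cuts: [Y i j]
    collects the removed vertices of colour [i] that were cut off from colour
    [j]. Each removal leaves at most one neighbour outside, the deleted vertex of
    the cut, whence the inequality. *)
Definition removable (X : {set V}) (Y : 'I_d -> 'I_d -> {set V}) :=
  [/\ forall i j, Y i j \subset [set v | chi v == i],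
      X = \bigcup_i \bigcup_j Y i j &
      forall i j, (#|class_nbrs X (Y i j) j| <= #|Y i j|)%N].

Lemma removable_sub X Y i j : removable X Y -> Y i j \subset X.
Proof.
by case=> _ -> _; apply: subset_trans (bigcup_sup i isT); exact: bigcup_sup.
Qed.

(** A piece and the vertices of the other class that it does not see are not
    joined by edges; the latter are many, so the piece is small. *)
Lemma removable_small X Y : removable X Y ->
  (K * #|X| <= (d ^ 2 + 2) * #|V|)%N -> (K * #|X| <= d ^ 2 * #|V|)%N.
Proof.
move=> rem KX; have [Yc XE Yn] := rem.
have small i j : (K * #|Y i j| <= #|V|)%N.
  rewrite leqNgt; apply/negP => big.
  have YX := removable_sub i j rem.
  pose B := [set b in ~: X | (chi b == j) && ~~ [exists a in Y i j, adj G a b]].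
  have [||a [b [aY]]] := Gjoin (A := Y i j) (B := B) _ (ltnW big).
  - rewrite disjoint_subset; apply/subsetP => a /(subsetP YX) aX.
    by rewrite !inE aX.
  - have : [set v | chi v == j] \subset X :|: class_nbrs X (Y i j) j :|: B.
      apply/subsetP => v; rewrite !inE => ->; case: (v \in X) => //=.
      by case: [exists _ in _, _].
    move=> /subset_leq_card/leq_trans/(_ (leq_card_setU _ _)).
    move=> /leq_trans/(_ (leq_add (leq_card_setU _ _) (leqnn _))).
    have := Yn i j; have := subset_leq_card YX; have := class_size j.
    move: KX; nia.
  - rewrite !inE => /and3P[_ _ /negP nab] ab; apply: nab.
    by apply/existsP; exists a; rewrite aY.
have : (#|X| <= \sum_i \sum_j #|Y i j|)%N.
  rewrite XE; apply: leq_trans (card_bigcup_le _) _.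
  by apply: leq_sum => i _; apply: card_bigcup_le.
move=> /(leq_mul (leqnn K))/leq_trans; apply.
rewrite big_distrr /= (leq_trans (n := \sum_(i : 'I_d) \sum_(j : 'I_d) #|V|)) //.
  apply: leq_sum => i _; rewrite big_distrr /=.
  by apply: leq_sum => j _.
by rewrite !sum_nat_const !card_ord mulnA mulnn.
Qed.

(** Outside itself, a side of a cut sees only removed vertices and the deleted
    vertex [z]. *)
Lemma removable_extend X Y i j (z : option V) (U A : {set V}) :
  removable X Y ->
  U = [set v in ~: X | (Some v != z) && (chi v \in [:: i; j])] ->
  A \subset U -> A != set0 ->
  (forall u v, u \in A -> v \in U :\: A -> adj G u v ->
     (chi u, chi v) \notin [:: (i, j); (j, i)]) ->
  exists Y', removable (X :|: A) Y'.
Proof.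
move=> rem UE AU A0 noedge; have [Yc XE Yn] := rem.
have AX v : v \in A -> v \notin X.
  by move=> /(subsetP AU); rewrite UE !inE => /andP[].
have Ac v : v \in A -> chi v \in [:: i; j].
  by move=> /(subsetP AU); rewrite UE !inE => /and3P[].
pose Ak k := [set v in A | chi v == k].
pose Y' k l := Y k l :|: (if (k, l) \in [:: (i, j); (j, i)] then Ak k else set0).
exists Y'; split.
- move=> k l; rewrite subUset Yc /=; case: ifP => _; last exact: sub0set.
  by apply/subsetP => v; rewrite !inE => /andP[].
- apply/setP => v; apply/idP/idP.
    rewrite inE => /orP[|vA].
      rewrite {1}XE => /bigcupP[k _ /bigcupP[l _ vY]].
      by apply/bigcupP; exists k => //; apply/bigcupP; exists l; rewrite // inE vY.
    have := Ac v vA; rewrite !inE => /orP[] /eqP vc.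
      apply/bigcupP; exists i => //; apply/bigcupP; exists j => //.
      by rewrite !inE eqxx /= !inE vA vc eqxx orbT.
    apply/bigcupP; exists j => //; apply/bigcupP; exists i => //.
    by rewrite !inE eqxx orbT /= !inE vA vc eqxx orbT.
  move=> /bigcupP[k _ /bigcupP[l _]]; rewrite inE => /orP[vY|].
    by rewrite inE (subsetP (removable_sub k l rem)).
  by case: ifP => _; rewrite !inE // => /andP[-> _]; rewrite orbT.
move=> k l; rewrite /Y'; case: ifP => kl; last first.
  rewrite setU0; apply: leq_trans (Yn k l); apply/subset_leq_card/subsetP => b.
  by rewrite !inE negb_or => /andP[/andP[-> _] ->].
have disj : [disjoint Y k l & Ak k].
  rewrite disjoint_sym disjoint_subset; apply/subsetP => v.
  rewrite !inE => /andP[/AX vX _]; apply: contra vX.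
  exact: (subsetP (removable_sub k l rem)).
rewrite cardsU (disjoint_setI0 disj) cards0 subn0.
have [Ak0|Ak0] := eqVneq (Ak k) set0.
  rewrite Ak0 cards0 addn0 setU0; apply: leq_trans (Yn k l).
  apply/subset_leq_card/subsetP => b.
  by rewrite !inE negb_or => /andP[/andP[-> _] ->].
pose Z : {set V} := if z is Some b then [set b] else set0.
have Z1 : (#|Z| <= #|Ak k|)%N.
  by apply: (@leq_trans 1); rewrite ?card_gt0 // /Z; case: (z) => [b|];
    rewrite ?cards1 ?cards0.
apply: leq_trans (leq_add (Yn k l) Z1); apply: leq_trans (leq_card_setU _ _).
apply/subset_leq_card/subsetP => b; rewrite inE => /andP[bXA /andP[bl]].
move: bXA; rewrite !inE negb_or => /andP[bX bA] /existsP[a /andP[]].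
rewrite !inE bX bl => /orP[aY|/andP[aA ak]] ab.
  by apply/orP; left; apply/existsP; exists a; rewrite aY.
apply/orP; right; apply: contraT => bZ; exfalso.
have bU : b \in U :\: A.
  rewrite !inE bA UE !inE bX /=; apply/andP; split.
    by apply: contraNneq bZ; rewrite /Z => <-; rewrite inE.
  by move: kl; rewrite (eqP bl) !inE => /orP[] /eqP[_ ->]; rewrite eqxx ?orbT.
by have := noedge _ _ aA bU ab; rewrite (eqP ak) (eqP bl) kl.
Qed.

(** The parts of the two sides in different classes of the pair are not joined, so
    large parts cannot occur on both sides. *)
Lemma cut_small (X : {set V}) (z : option V) i j (U A : {set V}) :
  (K * #|X| <= d ^ 2 * #|V|)%N ->
  U = [set v in ~: X | (Some v != z) && (chi v \in [:: i; j])] ->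
  A \subset U ->
  (forall u v, u \in A -> v \in U :\: A -> adj G u v ->
     (chi u, chi v) \notin [:: (i, j); (j, i)]) ->
  (K * #|A| <= 2 * #|V|)%N \/ (K * #|U :\: A| <= 2 * #|V|)%N.
Proof.
move=> KX UE AU noedge.
pose part (S : {set V}) k := [set v in S | chi v == k].
have partU k : k \in [:: i; j] ->
    (2 * #|V| <= K * (#|part A k| + #|part (U :\: A) k|))%N.
  move=> kij; pose Z : {set V} := if z is Some b then [set b] else set0.
  have Z1 : (#|Z| <= 1)%N by rewrite /Z; case: (z) => [b|]; rewrite ?cards1 ?cards0.
  have : [set v | chi v == k] \subset X :|: Z :|: (part A k :|: part (U :\: A) k).
    apply/subsetP => v; rewrite !inE => vk; rewrite vk !andbT.
    case: (v \in A) => /=; first by rewrite orbT.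
    rewrite UE !inE; case: (v \in X) => //=.
    have -> : (chi v == i) || (chi v == j).
      by move: kij; rewrite (eqP vk) !inE.
    rewrite andbT /Z orbC -implyNb; apply/implyP.
    by case: (z) => [b|//]; rewrite (inj_eq Some_inj) inE negbK eq_sym.
  move=> /subset_leq_card/leq_trans/(_ (leq_card_setU _ _)).
  move=> /leq_trans/(_ (leq_add (leq_card_setU _ _) (leq_card_setU _ _))).
  have := class_size k; move: KX K_small Z1; nia.
have cross k l : (k, l) \in [:: (i, j); (j, i)] ->
    (K * #|part A k| < #|V|)%N \/ (K * #|part (U :\: A) l| < #|V|)%N.
  move=> kl; have [|Ak] := ltnP (K * #|part A k|) #|V|; first by left.
  have [|Bl] := ltnP (K * #|part (U :\: A) l|) #|V|; first by right.
  have [|a [b [aA bB ab]]] := Gjoin (A := part A k) (B := part (U :\: A) l) _ Ak Bl.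
    by rewrite disjoint_subset; apply/subsetP => v; rewrite !inE => /andP[-> _].
  move: aA bB; rewrite ![_ \in part _ _]inE => /andP[aA /eqP ak] /andP[bB /eqP bl].
  by have := noedge _ _ aA bB ab; rewrite ak bl kl.
have le2 (S : {set V}) : S \subset U -> (#|S| <= #|part S i| + #|part S j|)%N.
  move=> SU; apply: leq_trans (leq_card_setU _ _); apply/subset_leq_card/subsetP => v.
  move=> vS; have := subsetP SU v vS; rewrite UE !inE vS => /and3P[_ _ vij].
  by rewrite vij.
have leA := le2 A AU; have leB := le2 (U :\: A) (subsetDl _ _).
have pi := partU i; have pj := partU j.
have := cross i j; have := cross j i.
rewrite !inE !eqxx orbT => /(_ isT) cji /(_ isT) cij.
move: pi pj; rewrite !inE !eqxx orbT => /(_ isT) pi /(_ isT) pj.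
case: cij => cij; case: cji => cji; [left|exfalso|exfalso|right]; nia.
Qed.

(** A maximal removable set leaves a core without such cuts. *)
Lemma core_exists : exists W : {set V},
  (K * #|~: W| <= d ^ 2 * #|V|)%N /\ colour_connected_in R W (adj G) chi.
Proof.
pose P (X : {set V}) := `[< (exists Y, removable X Y) /\
  (K * #|X| <= d ^ 2 * #|V|)%N >].
have P0 : P set0.
  apply/asboolP; rewrite cards0 muln0; split=> //; exists (fun _ _ => set0).
  split=> [i j||i j]; first exact: sub0set.
    by rewrite big1 // => i _; rewrite big1.
  rewrite cards0 leqn0 cards_eq0; apply/eqP/setP => b; rewrite !inE.
  by apply/negbTE/negP => /and3P[_ _ /existsP[a]]; rewrite inE.
have [X /asboolP[[Y rem] KX] maxX] := @arg_maxnP _ set0 P (fun X => #|X|) P0.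
exists (~: X); rewrite setCK; split=> // i j z g gE a b aW bW az bz ai bj.
apply: contrapT => gab.
pose U := [set v in ~: X | (Some v != z) && (chi v \in [:: i; j])].
pose A := [set v in U | g v == g a].
have AU : A \subset U by apply/subsetP => v; rewrite inE => /andP[].
have noedge u v : u \in A -> v \in U :\: A -> adj G u v ->
    (chi u, chi v) \notin [:: (i, j); (j, i)].
  rewrite !inE => /andP[/and3P[uX uz uij] /eqP gu].
  rewrite !negb_and => /andP[+ /and3P[vX vz vij]] uv; rewrite vX vz vij /= => gv.
  apply/negP => /orP[] /eqP[ui vj]; case/negP: gv; apply/eqP.
    by rewrite -gu; apply/esym/gE; rewrite ?inE.
  by rewrite -gu; apply: gE; rewrite ?inE // adj_sym.
have noedge' u v : u \in U :\: A -> v \in U :\: (U :\: A) -> adj G u v ->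
    (chi u, chi v) \notin [:: (i, j); (j, i)].
  rewrite setDDr setDv set0U (setIidPr AU) => uA vA uv.
  rewrite adj_sym in uv; have := noedge _ _ vA uA uv.
  by rewrite !inE !xpair_eqE orbC ![(chi v == _) && _]andbC.
have extend (B : {set V}) : B \subset U -> B != set0 ->
    (K * #|B| <= 2 * #|V|)%N ->
    (forall u v, u \in B -> v \in U :\: B -> adj G u v ->
      (chi u, chi v) \notin [:: (i, j); (j, i)]) -> False.
  move=> BU B0 KB nB.
  have [Y' rem'] := removable_extend rem erefl BU B0 nB.
  have BX : [disjoint X & B].
    rewrite disjoint_sym disjoint_subset; apply/subsetP => v /(subsetP BU).
    by rewrite !inE => /andP[].
  have cXB : #|X :|: B| = (#|X| + #|B|)%N.
    by rewrite cardsU (disjoint_setI0 BX) cards0 subn0.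
  have : P (X :|: B).
    apply/asboolP; split; first by exists Y'.
    by apply: (removable_small rem'); rewrite cXB mulnDr mulnDl leq_add.
  move=> /maxX; rewrite /= cXB -[leqRHS]addn0 leq_add2l leqn0 cards_eq0.
  by rewrite (negPf B0).
have [smallA|smallB] := cut_small KX erefl AU noedge.
  apply: (extend A AU _ smallA noedge); apply/set0Pn; exists a.
  by rewrite !inE eqxx andbT; move: aW az ai; rewrite !inE => -> -> ->.
apply: (extend (U :\: A) (subsetDl _ _) _ smallB noedge'); apply/set0Pn; exists b.
rewrite !inE; move: bW bz bj; rewrite !inE => -> -> -> /=.
by rewrite andbT; apply/eqP => gba; apply: gab.
Qed.

End Core.

(** * Expectations along the evolution *)

Section Expectation.
Context {R : realType} {n : nat}.
Local Notation E := (edge 'I_n).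
Local Notation N := 'C(n, 2).

Lemma step_prob_ge0 (V : finType) (G : graph V) (e : edge V) : 0 <= step_prob R G e.
Proof. by rewrite /step_prob; case: ifP => // _; rewrite invr_ge0 ler0n. Qed.

Lemma trajectory_prob_ge0 (w : trajectory n) : 0 <= trajectory_prob R w.
Proof. by apply: prodr_ge0 => M _; exact: step_prob_ge0. Qed.

Lemma step_prob_mem (V : finType) (G : graph V) (e : edge V) :
  e \in G -> step_prob R G e = 0.
Proof. by rewrite /step_prob => ->. Qed.

Lemma trajectory_prob_uniq (w : trajectory n) :
  ~~ uniq w -> trajectory_prob R w = 0.
Proof.
move=> nu; apply/eqP/prodf_eq0; apply: contrapT => H; case/negP: nu.
have notin (M : 'I_N) : tnth w M \notin evolution w M.
  apply/negP => wM; apply: H; exists M => //.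
  by rewrite step_prob_mem.
suff H' M : (M <= N)%N -> uniq (take M w).
  by have := H' N (leqnn _); rewrite take_oversize // size_tuple.
elim: M => [|M IHM] MN; first by rewrite take0.
have lt : (M < size w)%N by rewrite size_tuple.
have := notin (Ordinal MN); rewrite inE (tnth_nth (tnth w (Ordinal MN))) /= => wM.
by rewrite (take_nth (tnth w (Ordinal MN)) lt) rcons_uniq wM IHM // ltnW.
Qed.

Variables (u : nat -> {set E} -> E -> R) (c : nat -> R).

Let g (X : {set E}) k m (w : m.-tuple E) : R :=
  \prod_(M < m) (step_prob R (X :|: [set e in take M w]) (tnth w M) *
     u (k + M) (X :|: [set e in take M w]) (tnth w M)).

(** If every step multiplies the weight by [c k] on average, whatever the present
    graph of [k] edges is, then the expected product of weights is the product
    of the [c k]. *)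
Lemma expectation_weights_from m : forall k (X : {set E}), #|X| = k ->
  (k + m <= N)%N ->
  (forall k (X : {set E}), #|X| = k -> (k < N)%N ->
     \sum_(e in ~: X) u k X e = c k * #|~: X|%:R) ->
  \sum_(w : m.-tuple E) g X k w = \prod_(M < m) c (k + M).
Proof.
elim: m => [|m IHm] k X Xk km uc.
  rewrite big_ord0 (big_pred1 [tuple]) /g ?big_ord0 // => w; apply/esym/eqP.
  by rewrite tuple0.
rewrite (reindex (fun p : E * m.-tuple E => [tuple of p.1 :: p.2])) /=; last first.
  exists (fun w => (thead w, [tuple of behead w])) => [[x w] _|w _] /=.
    by congr pair; apply: val_inj.
  by apply/val_inj; rewrite /= [in RHS](tuple_eta w).
rewrite -(pair_bigA _ (fun x (w : m.-tuple E) => g X k [tuple of x :: w])) /=.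
have gS x (w : m.-tuple E) : g X k [tuple of x :: w] =
    step_prob R X x * u k X x * g (x |: X) k.+1 w.
  rewrite /g big_ord_recl /= addn0.
  have -> : X :|: [set e in [::]] = X by apply/setP => e; rewrite !inE orbF.
  congr (_ * _); apply: eq_bigr => M _; rewrite tnthS /bump /= add1n addSnnS.
  have -> // : X :|: [set e in take M.+1 (x :: w)] = x |: X :|: [set e in take M w].
  by apply/setP => e; rewrite !inE orbCA orbA.
under eq_bigr => x _ do under eq_bigr => w _ do rewrite gS.
have kN : (k < N)%N by apply: leq_trans km; rewrite addnS ltnS leq_addr.
have X0 : (0 < #|~: X|)%N.
  by rewrite cardsCs setCK card_edge Xk subn_gt0.
rewrite big_ord_recl addn0.
transitivity (\sum_(x in ~: X) (#|~: X|%:R^-1 * u k X x * \prod_(M < m) c (k.+1 + M))).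
  rewrite [RHS]big_mkcond; apply: eq_bigr => x _.
  rewrite -mulr_sumr inE /step_prob; case: ifP => xX /=; first by rewrite !mul0r.
  by rewrite IHm // ?cardsU1 ?xX ?Xk // addSnnS.
rewrite -mulr_suml -mulr_sumr uc // mulrCA mulVf ?mulr1; last first.
  by rewrite pnatr_eq0 -lt0n.
by congr (_ * _); apply: eq_bigr => M _; rewrite addSnnS.
Qed.

Lemma expectation_weights :
  (forall k (X : {set E}), #|X| = k -> (k < N)%N ->
     \sum_(e in ~: X) u k X e = c k * #|~: X|%:R) ->
  \sum_(w : trajectory n) trajectory_prob R w *
     \prod_(M < N) u M (evolution w M) (tnth w M) = \prod_(M < N) c M.
Proof.
move=> uc; have := @expectation_weights_from N 0 set0 (cards0 _) (leqnn _) uc.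
move=> <-; apply: eq_bigr => w _; rewrite /g /trajectory_prob -big_split.
by apply: eq_bigr => M _; rewrite set0U.
Qed.

End Expectation.

Section UpperBound.
Context {R : realType} {n : nat}.
Local Notation E := (edge 'I_n).
Local Notation N := 'C(n, 2).

Lemma expectation_weights_le (u : nat -> {set E} -> E -> R) (c : nat -> R) :
  (forall k X e, 0 <= u k X e) ->
  (forall k (X : {set E}), #|X| = k -> (k < N)%N ->
     \sum_(e in ~: X) u k X e <= c k * #|~: X|%:R) ->
  \sum_(w : trajectory n) trajectory_prob R w *
     \prod_(M < N) u M (evolution w M) (tnth w M) <= \prod_(M < N) c M.
Proof.
move=> u0 uc.
(* The slack of a step is spread evenly over its outcomes. *)
pose s k X := \sum_(e in ~: X) u k X e.
pose u' k X e := u k X e + `|c k - s k X / #|~: X|%:R|.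
have nz k (X : {set E}) : #|X| = k -> (k < N)%N -> #|~: X|%:R != 0 :> R.
  by move=> Xk kN; rewrite pnatr_eq0 -lt0n cardsCs setCK card_edge Xk subn_gt0.
rewrite -(@expectation_weights R n u' c) => [|k X Xk kN]; last first.
  rewrite big_split sumr_const /= -/(s k X) ger0_norm; last first.
    rewrite subr_ge0 ler_pdivrMr; first exact: uc.
    by rewrite lt0r (nz k) // ler0n.
  by rewrite -[X in _ + X]mulr_natr mulrBl divfK ?(nz k) // addrC subrK.
apply: ler_sum => w _; apply: ler_wpM2l; first exact: trajectory_prob_ge0.
by apply: ler_prod => M _; rewrite u0 /= lerDl.
Qed.

(** Markov's inequality for a product of weights. *)
Lemma evolution_Pr_le_weights (A : pred (trajectory n)) (C : R)
    (u : nat -> {set E} -> E -> R) (c : nat -> R) :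
  (forall k X e, 0 <= u k X e) ->
  (forall k (X : {set E}), #|X| = k -> (k < N)%N ->
     \sum_(e in ~: X) u k X e <= c k * #|~: X|%:R) ->
  0 <= C ->
  (forall w : trajectory n, uniq w -> A w ->
     1 <= C * \prod_(M < N) u M (evolution w M) (tnth w M)) ->
  evolution_Pr R A <= C * \prod_(M < N) c M.
Proof.
move=> u0 uc C0 Aw; rewrite /evolution_Pr.
apply: le_trans (ler_wpM2l C0 (expectation_weights_le u0 uc)).
rewrite mulr_sumr big_mkcond; apply: ler_sum => w _; rewrite mulrCA.
have [uw|/(trajectory_prob_uniq (R := R)) ->] := boolP (uniq w); last first.
  by rewrite if_same mul0r.
case: ifP => [/(Aw w uw) w1|_].
  by rewrite -[X in X <= _]mulr1 ler_wpM2l // trajectory_prob_ge0.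
rewrite !mulr_ge0 // ?trajectory_prob_ge0 //.
by apply: prodr_ge0 => M _; exact: u0.
Qed.

Lemma evolution_Pr_ge0 (A : pred (trajectory n)) : 0 <= evolution_Pr R A.
Proof. by apply: sumr_ge0 => w _; exact: trajectory_prob_ge0. Qed.

Lemma evolution_Pr_sub (A B : pred (trajectory n)) :
  (forall w : trajectory n, uniq w -> A w -> B w) -> evolution_Pr R A <= evolution_Pr R B.
Proof.
move=> AB; rewrite /evolution_Pr big_mkcond [leRHS]big_mkcond.
apply: ler_sum => w _.
have [uw|/(trajectory_prob_uniq (R := R)) ->] := boolP (uniq w); last by rewrite !if_same.
case: ifP => [/(AB _ uw) -> //|_].
by case: ifP => // _; exact: trajectory_prob_ge0.
Qed.

Lemma evolution_Pr_bigU (I : finType) (A : I -> pred (trajectory n)) (D : pred I) :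
  evolution_Pr R (fun w => [exists i, D i && A i w]) <=
  \sum_(i | D i) evolution_Pr R (A i).
Proof.
rewrite /evolution_Pr big_mkcond.
under [leRHS]eq_bigr do rewrite big_mkcond; rewrite exchange_big /=.
apply: ler_sum => w _.
have ge0 i : 0 <= (if A i w then trajectory_prob R w else 0).
  by case: ifP => // _; exact: trajectory_prob_ge0.
case: ifP => [/existsP[i /andP[Di Aiw]]|_]; last by apply: sumr_ge0 => i _.
rewrite (bigD1 i) //= Aiw lerDl.
by apply: sumr_ge0 => j _.
Qed.

Lemma evolution_PrU (A B : pred (trajectory n)) :
  evolution_Pr R (fun w => A w || B w) <= evolution_Pr R A + evolution_Pr R B.
Proof.
rewrite /evolution_Pr big_mkcond [X in _ <= X + _]big_mkcond.
rewrite [X in _ <= _ + X]big_mkcond -big_split; apply: ler_sum => w _ /=.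
have := trajectory_prob_ge0 (R := R) w.
by case: (A w); case: (B w) => //= w0; rewrite ?addr0 ?add0r ?lerDl.
Qed.

Lemma evolution_PrC (A : pred (trajectory n)) :
  evolution_Pr R A = 1 - evolution_Pr R (fun w => ~~ A w).
Proof.
rewrite -(trajectory_prob_sum1 R n) (bigID A) /= addrK //.
Qed.

End UpperBound.

(** * Probabilities of edge patterns *)

Section Patterns.
Context {R : realType} {n : nat}.
Local Notation E := (edge 'I_n).
Local Notation N := 'C(n, 2).

Lemma mem_evolution (w : trajectory n) M e :
  (e \in evolution w M) = [exists i : 'I_N, (i < M)%N && (tnth w i == e)].
Proof.
rewrite inE; apply/idP/existsP => [eM|[i /andP[iM /eqP <-]]].
  have ew := mem_take eM; have iN : (index e w < N)%N.
    by move: ew; rewrite -index_mem size_tuple.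
  exists (Ordinal iN); rewrite (tnth_nth e) /= nth_index // eqxx andbT.
  by move: eM; rewrite in_take.
rewrite (tnth_nth (tnth w i)) -(nth_take _ iM) mem_nth //.
by rewrite size_take_min leq_min iM size_tuple ltn_ord.
Qed.

Lemma evolutionS_sub (w : trajectory n) M M' :
  (M <= M')%N -> evolution w M \subset evolution w M'.
Proof.
move=> MM'; apply/subsetP => e; rewrite !mem_evolution => /existsP[i /andP[iM we]].
by apply/existsP; exists i; rewrite we (leq_trans iM).
Qed.

(** Sum over the set of the times at which the edges of [T] appear; at each of
    them [T] is hit with probability at most [#|T| / (N - M2)]. Every other step
    before [M1] is discounted by [theta] whenever it falls in [F], which happens
    at most [k] times, so that the discounts can be recovered. *)
Lemma pattern_Pr (T F : {set E}) (k M1 M2 : nat) (theta : R) :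
  0 < theta -> theta <= 1 -> (M1 <= M2)%N -> (M2 < N)%N -> (k <= #|F|)%N ->
  evolution_Pr R (fun w : trajectory n =>
     (T \subset evolution w M2) && (#|F :&: evolution w M1| <= k)%N) <=
  'C(M2, #|T|)%:R * (#|T|%:R / (N - M2)%:R) ^+ #|T| * theta ^- k *
  (1 - (1 - theta) * (#|F| - k)%:R / N%:R) ^+ (M1 - #|T|).
Proof.
move=> th0 th1 M12 M2N kF.
set t := #|T|; set r := 1 - _; set a := t%:R / (N - M2)%:R.
have N0 : 0 < N%:R :> R by rewrite ltr0n (leq_ltn_trans _ M2N).
have FN : (#|F| <= N)%N by rewrite -(card_edge n) max_card.
have r0 : 0 <= r.
  rewrite subr_ge0 ler_pdivrMr // mul1r.
  apply: (@le_trans _ _ (1 * (#|F| - k)%:R)).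
    by rewrite ler_wpM2r ?ler0n // gerDl oppr_le0 ltW.
  by rewrite mul1r ler_nat (leq_trans (leq_subr _ _)).
have r1 : r <= 1.
  by rewrite gerDl oppr_le0 divr_ge0 ?mulr_ge0 ?ler0n ?subr_ge0.
have a0 : 0 <= a by rewrite divr_ge0 ?ler0n.
pose times (K : {set 'I_N}) := (K \subset [set i : 'I_N | (i < M2)%N]) && (#|K| == t).
pose AK (K : {set 'I_N}) (w : trajectory n) :=
  [forall i in K, tnth w i \in T] && (#|F :&: evolution w M1| <= k)%N.
have cover (w : trajectory n) : uniq w ->
    (T \subset evolution w M2) && (#|F :&: evolution w M1| <= k)%N ->
    [exists K, times K && AK K w].
  move=> uw /andP[TM Fk]; apply/existsP.
  exists [set i : 'I_N | (i < M2)%N && (tnth w i \in T)].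
  rewrite /times /AK Fk andbT -andbA; apply/and3P; split.
  - by apply/subsetP => i; rewrite !inE => /andP[].
  - rewrite -(card_imset _ (tuple_uniqP w uw)) /t; apply/eqP/eq_card => e.
    apply/imsetP/idP => [[i]|eT]; first by rewrite inE => /andP[_ iT] ->.
    have := subsetP TM e eT; rewrite mem_evolution => /existsP[i /andP[iM /eqP we]].
    by exists i; rewrite ?inE ?we ?iM.
  - by apply/forallP => i; apply/implyP; rewrite inE => /andP[].
apply: le_trans (evolution_Pr_sub cover) _.
apply: le_trans (evolution_Pr_bigU _ _) _.
suff PK K : times K -> evolution_Pr R (AK K) <= theta ^- k * (a ^+ t * r ^+ (M1 - t)).
  apply: le_trans (ler_sum _ PK) _; rewrite sumr_const -[leLHS]mulr_natl.
  rewrite (_ : #|times| = 'C(M2, t)).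
    move: (a ^+ t) (r ^+ (M1 - t)) (theta ^- k) ('C(M2, t)%:R) => x y z C.
    by rewrite -[leRHS]mulrA -[leRHS]mulrA [x * (z * y)]mulrCA.
  have M2E : #|[set i : 'I_N | (i < M2)%N]| = M2.
    rewrite -[RHS]card_ord -(card_imset _ (f := widen_ord (ltnW M2N))); last first.
      by move=> i j /(congr1 val) /= /val_inj.
    apply: eq_card => i; rewrite inE; apply/idP/imsetP => [iM|[j _ ->] //=].
    by exists (Ordinal iM) => //; apply: val_inj.
  by rewrite -[in RHS]M2E -cards_draws cardsE.
case/andP => KM /eqP Kt.
have KM2 (i : 'I_N) : i \in K -> (i < M2)%N by move/(subsetP KM); rewrite inE.
pose inK m := if insub m is Some i then i \in K else false.
have inKE (i : 'I_N) : inK i = (i \in K) by rewrite /inK valK.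
pose u m (X : {set E}) (e : E) : R :=
  if inK m then (e \in T)%:R
  else if (m < M1)%N then
    if (#|F :&: X| <= k)%N then theta ^+ (e \in F) else 0
  else 1.
pose c m := if inK m then a else if (m < M1)%N then r else 1.
have c0 m : 0 <= c m by rewrite /c; case: ifP => // _; case: ifP.
have u0 m X e : 0 <= u m X e.
  rewrite /u; case: ifP => _; first exact: ler0n.
  by do 2!case: ifP => _ //; rewrite exprn_ge0 // ltW.
have uc m (X : {set E}) : #|X| = m -> (m < N)%N ->
    \sum_(e in ~: X) u m X e <= c m * #|~: X|%:R.
  move=> Xm mN; have XC : #|~: X| = (N - m)%N by rewrite cardsCs setCK card_edge Xm.
  rewrite /u /c; case: ifP => mK.
    have mM2 : (m < M2)%N.
      move: mK; rewrite /inK; case: insubP => // i _ <- /KM2 //.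
    apply: (@le_trans _ _ t%:R).
      rewrite -natr_sum ler_nat /t -sum1_card [leqRHS]big_mkcond [leqLHS]big_mkcond.
      by apply: leq_sum => e _; case: (e \in ~: X); case: (e \in T).
    rewrite /a mulrAC ler_pdivlMr ?ltr0n ?subn_gt0 //.
    by rewrite ler_wpM2l ?ler0n // ler_nat XC leq_sub2l // ltnW.
  case: ifP => mM1; last by rewrite sumr_const mul1r.
  have [FX|FX] := leqP #|F :&: X| k; last first.
    by rewrite big1 // mulr_ge0 ?ler0n.
  have -> : \sum_(e in ~: X) theta ^+ (e \in F) =
      #|~: X|%:R - (1 - theta) * #|F :&: ~: X|%:R.
    rewrite -!sum1_card !natr_sum mulr_sumr [X in _ - X](_ : _ =
      \sum_(e in ~: X) (1 - theta) * (e \in F)%:R).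
      rewrite -sumrB; apply: eq_bigr => e _.
      by case: (e \in F); rewrite /= ?expr1 ?expr0; ring.
    rewrite big_mkcond [RHS]big_mkcond; apply: eq_bigr => e _; rewrite inE.
    by case: (e \in F); case: (e \in ~: X) => //=; rewrite mulr0.
  rewrite /r [leRHS]mulrBl mul1r lerD2l lerN2 -!mulrA ler_wpM2l ?subr_ge0 //.
  apply: (@le_trans _ _ (#|F| - k)%:R).
    rewrite ler_piMr ?ler0n // mulrC ler_pdivrMr // mul1r ler_nat.
    by rewrite XC leq_subr.
  rewrite ler_nat leq_subLR; apply: leq_trans (leq_add FX (leqnn _)).
  by rewrite -setDE -(cardsID X F).
apply: le_trans (evolution_Pr_le_weights (C := theta ^- k) u0 uc _ _) _.
- by rewrite invr_ge0 exprn_ge0 // ltW.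
- move=> w uw /andP[/forallP wK wF].
  rewrite mulrC ler_pdivlMr ?exprn_gt0 // mul1r.
  apply: (@le_trans _ _ (\prod_(M < N) (if (M < M1)%N && (tnth w M \in F) then theta else 1))).
    rewrite -big_mkcond prodr_const; apply: ler_wiXn2l => //; first exact: ltW.
    rewrite -(card_imset _ (tuple_uniqP w uw)); apply: leq_trans wF.
    apply/subset_leq_card/subsetP => e /imsetP[i]; rewrite inE => /andP[iM iF] ->.
    apply/andP; split=> //; rewrite mem_evolution.
    by apply/existsP; exists i; rewrite iM eqxx.
  apply: ler_prod => i _; apply/andP; split.
    by case: ifP => // _; exact: ltW.
  rewrite /u inKE; have [iK|_] := boolP (i \in K).
    by rewrite (implyP (wK i) iK); case: ifP.
  case: (ltnP i M1) => //= iM; rewrite (leq_trans _ wF); last first.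
    by apply/subset_leq_card/setIS/evolutionS_sub/ltnW.
  by case: (_ \in F); rewrite /= ?expr1 ?expr0.
- apply: ler_wpM2l; first by rewrite invr_ge0 exprn_ge0 // ltW.
  rewrite (bigID (mem K)) /=; apply: ler_pM.
  + by apply: prodr_ge0 => i _.
  + by apply: prodr_ge0 => i _.
  + rewrite -Kt -prodr_const le_eqVlt; apply/orP; left; apply/eqP.
    by apply: eq_bigr => i iK; rewrite /c inKE iK.
  rewrite (bigID (fun i : 'I_N => (i < M1)%N)) /= [X in _ * X]big1 ?mulr1; last first.
    by move=> i /andP[iK iM]; rewrite /c inKE (negPf iK) (negPf iM).
  rewrite (eq_bigr (fun=> r)) => [|i /andP[iK iM]]; last first.
    by rewrite /c inKE (negPf iK) iM.
  rewrite prodr_const; apply: ler_wiXn2l => //.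
  have M1E : #|[set i : 'I_N | (i < M1)%N]| = M1.
    rewrite -[RHS]card_ord -(card_imset _ (f := widen_ord (ltnW (leq_ltn_trans M12 M2N)))); last first.
      by move=> i j /(congr1 val) /= /val_inj.
    apply: eq_card => i; rewrite inE; apply/idP/imsetP => [iM|[j _ ->] //=].
    by exists (Ordinal iM) => //; apply: val_inj.
  rewrite leq_subLR -Kt -[leqLHS]M1E -(cardsID K [set i : 'I_N | (i < M1)%N]) leq_add //.
    by apply/subset_leq_card/subsetIr.
  by apply/subset_leq_card/subsetP => i; rewrite !inE.
Qed.

End Patterns.

Section Avoid.
Context {R : realType} {n : nat}.
Local Notation E := (edge 'I_n).
Local Notation N := 'C(n, 2).

Lemma avoid_Pr (F : {set E}) (M : nat) : (M <= N)%N ->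
  evolution_Pr R (fun w : trajectory n => F :&: evolution w M == set0) =
  \prod_(m < M) (1 - #|F|%:R / (N - m)%:R).
Proof.
move=> MN; pose c m : R := if (m < M)%N then 1 - #|F|%:R / (N - m)%:R else 1.
(* Once F is touched the weight is irrelevant; it is chosen to keep the
   conditional expectation equal to c. *)
pose u m (X : {set E}) (e : E) : R :=
  if (m < M)%N then if F :&: X == set0 then (e \notin F)%:R else c m else 1.
have uc m (X : {set E}) : #|X| = m -> (m < N)%N ->
    \sum_(e in ~: X) u m X e = c m * #|~: X|%:R.
  move=> Xm mN; have XC : #|~: X| = (N - m)%N by rewrite cardsCs setCK card_edge Xm.
  rewrite /u /c; have [mM|mM] := ltnP m M; last by rewrite sumr_const mul1r.
  have [/eqP FX|_] := eqVneq (F :&: X) set0; last by rewrite sumr_const mulr_natr.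
  rewrite XC mulrBl mul1r divfK ?pnatr_eq0 -?lt0n ?subn_gt0 // -XC.
  have FC : F \subset ~: X by rewrite -disjoints_subset -setI_eq0.
  apply/eqP; rewrite eq_sym subr_eq -!natr_sum -natrD eqr_nat.
  rewrite -(cardsID F (~: X)) (setIidPr FC) addnC eqn_add2r -sum1_card.
  rewrite big_mkcond [eqbRHS]big_mkcond; apply/eqP/eq_bigr => e _.
  by rewrite !inE; case: (e \in F); case: (e \in X).
rewrite -[RHS](_ : \prod_(m < N) c m = _); last first.
  rewrite (big_ord_widen _ (fun m => 1 - #|F|%:R / (N - m)%:R) MN).
  by rewrite [RHS]big_mkcond.
rewrite -(expectation_weights uc) /evolution_Pr big_mkcond.
apply: eq_bigr => w _; case: eqP => [FM|/eqP].
  rewrite big1 ?mulr1 // => m _; rewrite /u; case: ifP => // mM.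
  have sub0 : F :&: evolution w m == set0.
    by rewrite -subset0 -FM setIS // evolutionS_sub // ltnW.
  rewrite sub0 (_ : tnth w m \notin F) //; apply/negP => mF.
  have : tnth w m \in F :&: evolution w M.
    by rewrite in_setI mF mem_evolution; apply/existsP; exists m; rewrite mM eqxx.
  by rewrite FM inE.
move=> /set0Pn[e]; rewrite in_setI mem_evolution => /andP[eF /existsP[i /andP[iM /eqP we]]].
pose P (i : 'I_N) := (i < M)%N && (tnth w i \in F).
have Pi : P i by rewrite /P iM we.
have [j /andP[jM jF] minj] := @arg_minnP _ i P (fun i => i : nat) Pi.
rewrite (bigD1 j) //= /u jM (_ : _ == set0) ?jF ?mul0r ?mulr0 //.
apply: contraT => /set0Pn[e']; rewrite in_setI mem_evolution => /andP[e'F].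
move=> /existsP[k /andP[kj /eqP wk]]; have := minj k.
by rewrite /P (ltn_trans kj jM) wk e'F leqNgt kj => /(_ isT).
Qed.

End Avoid.

(** * Edges between two sets *)

Section Cross.
Context {V : finType}.
Implicit Types (A B X : {set V}) (G : graph V).

Definition cross A B : {set edge V} :=
  [set f | [exists a in A, [exists b in B, val f == [set a; b]]]].

(** The default value [f0] is returned when [a = b]. *)
Definition link (f0 : edge V) (a b : V) : edge V := insubd f0 [set a; b].

Lemma val_link f0 a b : a != b -> val (link f0 a b) = [set a; b].
Proof. by move=> ab; rewrite val_insubd cards2 ab. Qed.

Lemma set2_inj A B a b a' b' : [disjoint A & B] ->
  a \in A -> b \in B -> a' \in A -> b' \in B ->
  [set a; b] = [set a'; b'] -> (a, b) = (a', b').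
Proof.
move=> dAB aA bB a'A b'B E.
have nAB x : x \in A -> x \in B -> False.
  by move=> xA xB; have := disjointFr dAB xA; rewrite xB.
have : a \in [set a'; b'] by rewrite -E set21.
have : b \in [set a'; b'] by rewrite -E set22.
rewrite !inE => /orP[/eqP bE|/eqP ->] /orP[/eqP aE|/eqP aE].
- by case: (nAB b); rewrite // bE.
- by case: (nAB b); rewrite // bE.
- by rewrite aE.
- by case: (nAB a); rewrite // aE.
Qed.

Lemma card_cross A B : [disjoint A & B] -> (#|A| * #|B| <= #|cross A B|)%N.
Proof.
move=> dAB; have [->|/set0Pn[a0 a0A]] := eqVneq A set0; first by rewrite cards0.
have [->|/set0Pn[b0 b0B]] := eqVneq B set0; first by rewrite cards0 muln0.
have neq a b : a \in A -> b \in B -> a != b.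
  by move=> aA bB; apply: contraTneq bB => <-; rewrite (disjointFr dAB aA).
have ab0 : #|[set a0; b0]| == 2 by rewrite cards2 neq.
pose f0 : edge V := Sub [set a0; b0] ab0.
rewrite -cardsX -(card_in_imset (f := fun x => link f0 x.1 x.2)).
  apply/subset_leq_card/subsetP => f /imsetP[[a b]]; rewrite in_setX => /andP[aA bB] ->.
  rewrite inE; apply/existsP; exists a; rewrite aA; apply/existsP; exists b.
  by rewrite bB /= val_link ?neq.
move=> [a b] [a' b']; rewrite !inE /= => /andP[aA bB] /andP[a'A b'B].
move=> /(congr1 val); rewrite !val_link ?neq //.
exact: (set2_inj dAB).
Qed.

Lemma cross_adj A B G : cross A B :&: G != set0 ->
  exists a b, [/\ a \in A, b \in B & adj G a b].
Proof.
move=> /set0Pn[f]; rewrite !inE => /andP[/existsP[a /andP[aA /existsP[b]]]].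
move=> /andP[bB fE] fG; exists a, b; split=> //.
by apply/existsP; exists f; rewrite fG.
Qed.

(** Edges leaving [X] are counted from their end in [X]. *)
Lemma card_cross_le (X : {set V}) G (k : nat) :
  (forall v, v \in X -> (#|[set u in ~: X | adj G v u]| <= k)%N) ->
  (#|cross X (~: X) :&: G| <= k * #|X|)%N.
Proof.
move=> degk; have [->|/set0Pn[f0 _]] := eqVneq (cross X (~: X) :&: G) set0.
  by rewrite cards0.
pose Y v := if v \in X then [set link f0 v u | u in [set u in ~: X | adj G v u]] else set0.
have sub : cross X (~: X) :&: G \subset \bigcup_v Y v.
  apply/subsetP => f; rewrite inE => /andP[]; rewrite inE.
  move=> /existsP[a /andP[aX /existsP[b /andP[bX /eqP fE]]]] fG.
  have ab : a != b by apply: contraTneq bX => <-; rewrite inE aX.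
  have -> : f = link f0 a b by apply: val_inj; rewrite val_link.
  apply/bigcupP; exists a => //; rewrite /Y aX; apply: imset_f; rewrite inE bX.
  by rewrite /=; apply/existsP; exists f; rewrite fG fE eqxx.
apply: leq_trans (subset_leq_card sub) _; apply: leq_trans (card_bigcup_le _) _.
rewrite -sum1_card big_distrr /= [leqRHS]big_mkcond; apply: leq_sum => v _.
rewrite /Y; case: ifP => [vX|_]; last by rewrite cards0.
by rewrite muln1; apply: leq_trans (leq_imset_card _ _) (degk v vX).
Qed.

Definition star_edges (X : {set V}) (phi : V -> V) : {set edge V} :=
  [set f | [exists v in X, val f == [set v; phi v]]].

(** An edge contains at most two of the vertices, hence at least half of the
    pairs are distinct. *)
Lemma card_star_edges (X : {set V}) (phi : V -> V) :
  (forall v, v \in X -> phi v != v) ->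
  (#|star_edges X phi| <= #|X|)%N /\ (#|X| <= 2 * #|star_edges X phi|)%N.
Proof.
move=> phiN; have [->|/set0Pn[v0 v0X]] := eqVneq X set0.
  rewrite cards0; split=> //; rewrite leqn0 cards_eq0; apply/eqP/setP => f.
  by rewrite !inE; apply/negbTE/negP => /existsP[v]; rewrite inE.
have v01 : #|[set v0; phi v0]| == 2 by rewrite cards2 [v0 == _]eq_sym phiN.
pose f0 : edge V := Sub [set v0; phi v0] v01.
split.
  apply: leq_trans (leq_imset_card (fun v => link f0 v (phi v)) X).
  apply/subset_leq_card/subsetP => f; rewrite inE => /existsP[v /andP[vX /eqP fE]].
  apply/imsetP; exists v => //; apply: val_inj.
  by rewrite val_link // eq_sym phiN.
pose Y (f : edge V) := if f \in star_edges X phi then val f else set0.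
have sub : X \subset \bigcup_f Y f.
  apply/subsetP => v vX; apply/bigcupP; exists (link f0 v (phi v)) => //.
  have nv : v != phi v by rewrite eq_sym phiN.
  rewrite /Y inE; case: existsP => [_|[]]; first by rewrite val_link // set21.
  by exists v; rewrite vX val_link // eqxx.
apply: leq_trans (subset_leq_card sub) _; apply: leq_trans (card_bigcup_le _) _.
rewrite -sum1_card big_distrr /= [leqRHS]big_mkcond; apply: leq_sum => f _.
by rewrite /Y; case: ifP => _; rewrite ?cards0 // (eqP (valP f)).
Qed.

Lemma star_edges_sub (X : {set V}) (phi : V -> V) G :
  (forall v, v \in X -> adj G v (phi v)) -> star_edges X phi \subset G.
Proof.
move=> phiG; apply/subsetP => f; rewrite inE => /existsP[v /andP[vX /eqP fE]].
have /existsP[f' /andP[f'G /eqP f'E]] := phiG v vX.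
by rewrite (_ : f = f') //; apply: val_inj; rewrite fE f'E.
Qed.

End Cross.

(** * Bounds on the exceptional events *)

Section Analysis.
Context {R : realType}.

Lemma onem_expR_le (y : R) (m : nat) : y <= 1 -> (1 - y) ^+ m <= expR (- (y * m%:R)).
Proof.
move=> y1; rewrite -mulNr expRM_natr lerXn2r ?nnegrE ?subr_ge0 ?expR_ge0 //.
exact: expR_ge1Dx.
Qed.

Lemma expn_fact_le (t : nat) : (t%:R ^+ t / t`!%:R : R) <= expR t%:R.
Proof.
case: t => [|t]; first by rewrite expr0 fact0 divr1 expR0.
by rewrite (le_trans _ (expR_ge1Dxn t _)) ?ler0n // lerDr.
Qed.

Lemma ffact_expn_le (m t : nat) : (m ^_ t <= m ^ t)%N.
Proof.
elim: t => [|t IHt] //.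
by rewrite ffactnSr expnSr leq_mul // leq_subr.
Qed.

(** [C(m, t) t^t <= (e m)^t] serves twice: for the sets of times at which [t]
    given edges appear, and for sets of vertices together with a choice of a
    neighbour in the set for each of them. *)
Lemma bin_expn_le (m t : nat) :
  'C(m, t)%:R * t%:R ^+ t <= (expR 1 * m%:R) ^+ t :> R.
Proof.
have t0 : (0 : R) < t`!%:R by rewrite ltr0n fact_gt0.
have -> : (t%:R ^+ t : R) = t`!%:R * (t%:R ^+ t / t`!%:R).
  by rewrite mulrCA mulfV ?mulr1 // gt_eqF.
rewrite [leLHS]mulrA -natrM bin_ffact exprMn mulrC -expRM_natl mulr1.
apply: ler_pM; rewrite ?divr_ge0 ?exprn_ge0 ?ler0n ?expn_fact_le //.
by rewrite -natrX ler_nat ffact_expn_le.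
Qed.

Lemma sum_by_card (T : finType) (F : nat -> R) :
  \sum_(X : {set T}) F #|X| = \sum_(x < #|T|.+1) 'C(#|T|, x)%:R * F x.
Proof.
have lt (X : {set T}) : (#|X| < #|T|.+1)%N by rewrite ltnS max_card.
rewrite (partition_big (fun X : {set T} => Ordinal (lt X)) xpredT) //=.
apply: eq_bigr => x _.
rewrite (eq_bigr (fun=> F x)) => [|X /eqP <- //].
rewrite sumr_const -[LHS]mulr_natl -card_draws cardsE; congr (_%:R * _).
Qed.

Lemma geometric_le (q : R) (m : nat) : 0 <= q -> q <= 2^-1 ->
  \sum_(1 <= x < m.+1) q ^+ x <= 2 * q.
Proof.
move=> q0 q1; elim: m => [|m IHm]; first by rewrite big_geq // mulr_ge0.
rewrite big_nat_recl // expr1.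
have -> : \sum_(1 <= i < m.+1) q ^+ i.+1 = q * \sum_(1 <= x < m.+1) q ^+ x.
  by rewrite mulr_sumr; apply: eq_bigr => i _; rewrite exprS.
have := ler_wpM2l q0 IHm; have : q * (2 * q) <= q.
  by rewrite -[leRHS]mulr1 ler_wpM2l //; lra.
lra.
Qed.

End Analysis.

Section BadEvents.
Context {R : realType} {n : nat}.
Local Notation E := (edge 'I_n).
Local Notation N := 'C(n, 2).

(** The discount [1/8] costs only a factor [8 ^+ k] and keeps [7/8] of the decay,
    enough for the union bound over detached sets. *)
Lemma pattern_Pr_expR (T F : {set E}) (k M1 M2 : nat) :
  (M1 <= M2)%N -> (M2 < N)%N -> (k <= #|F|)%N ->
  evolution_Pr R (fun w : trajectory n =>
     (T \subset evolution w M2) && (#|F :&: evolution w M1| <= k)%N) <=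
  (expR 1 * M2%:R / (N - M2)%:R) ^+ #|T| * 8 ^+ k *
  expR (- (7 / 8 * (#|F| - k)%:R * (M1 - #|T|)%:R / N%:R)).
Proof.
move=> M12 M2N kF.
have N0 : 0 < N%:R :> R by rewrite ltr0n (leq_ltn_trans _ M2N).
have FN : (#|F| <= N)%N by rewrite -(card_edge n) max_card.
have th0 : (0 : R) < 8^-1 by rewrite invr_gt0.
have th1 : (8^-1 : R) <= 1 by rewrite invf_le1 // ler1n.
apply: le_trans (pattern_Pr T th0 th1 M12 M2N kF) _.
apply: ler_pM.
- by rewrite !mulr_ge0 ?ler0n ?exprn_ge0 ?mulr_ge0 ?invr_ge0 ?ler0n ?exprn_ge0.
- rewrite exprn_ge0 // subr_ge0 ler_pdivrMr // mul1r.
  apply: (@le_trans _ _ (1 * (#|F| - k)%:R)).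
    by rewrite ler_wpM2r ?ler0n // gerDl oppr_le0 ltW.
  by rewrite mul1r ler_nat (leq_trans (leq_subr _ _)).
- rewrite exprVn invrK ler_wpM2r ?exprn_ge0 //.
  rewrite !exprMn mulrA ler_wpM2r ?exprn_ge0 ?invr_ge0 ?ler0n //.
  by rewrite -exprMn bin_expn_le.
have -> : (1 - 8^-1 : R) = 7 / 8 by field.
set y := 7 / 8 * _ / _.
have -> : 7 / 8 * (#|F| - k)%:R * (M1 - #|T|)%:R / N%:R = y * (M1 - #|T|)%:R.
  by rewrite /y mulrAC.
apply: onem_expR_le; rewrite /y ler_pdivrMr // mul1r.
apply: (@le_trans _ _ (1 * (#|F| - k)%:R)).
  by rewrite ler_wpM2r ?ler0n // ler_pdivrMr // mul1r ler_nat.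
by rewrite mul1r ler_nat (leq_trans (leq_subr _ _)).
Qed.

(** Union bound over pairs of disjoint sets of linear size. *)
Lemma not_joined_Pr (K M : nat) : (0 < K)%N -> (M < N)%N ->
  evolution_Pr R (fun w : trajectory n => ~~ `[< joined (evolution w M) K >]) <=
  4 ^+ n * expR (- (7 / 8 * (n%:R / K%:R) ^+ 2 * M%:R / N%:R)).
Proof.
move=> K0 MN.
pose D (AB : {set 'I_n} * {set 'I_n}) :=
  [&& [disjoint AB.1 & AB.2], (n <= K * #|AB.1|)%N & (n <= K * #|AB.2|)%N].
pose A (AB : {set 'I_n} * {set 'I_n}) (w : trajectory n) :=
  (set0 \subset evolution w M) && (#|cross AB.1 AB.2 :&: evolution w M| <= 0)%N.
apply: (@le_trans _ _ (evolution_Pr R (fun w => [exists AB, D AB && A AB w]))).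
  apply: evolution_Pr_sub => w _ /asboolPn nj; apply: contrapT => H; apply: nj.
  move=> X Y dXY; rewrite card_ord => nX nY; apply: cross_adj.
  apply/negP => XY0; apply: H; apply/existsP; exists (X, Y).
  by rewrite /D /A /= dXY nX nY sub0set leqn0 cards_eq0.
apply: le_trans (evolution_Pr_bigU _ _) _.
set B := expR _.
apply: (@le_trans _ _ (\sum_(AB | D AB) B)).
  apply: ler_sum => -[X Y] /and3P[/= dXY nX nY].
  apply: le_trans (pattern_Pr_expR _ (leqnn M) MN (leq0n _)) _.
  rewrite cards0 !expr0 !mul1r !subn0 ler_expR lerN2.
  rewrite ler_wpM2r ?invr_ge0 ?ler0n // ler_wpM2r ?ler0n // ler_wpM2l ?divr_ge0 //.
  apply: (@le_trans _ _ (#|X| * #|Y|)%:R); last by rewrite ler_nat card_cross.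
  have K0' : (0 : R) < K%:R by rewrite ltr0n.
  rewrite natrM expr2 ler_pM ?divr_ge0 ?ler0n // ler_pdivrMr // mulrC -natrM ler_nat //.
rewrite sumr_const -[leLHS]mulr_natl ler_wpM2r ?expR_ge0 // -natrX ler_nat.
apply: leq_trans (max_card _) _.
by rewrite card_prod -cardsT -powersetT card_powerset cardsT card_ord -expnMn.
Qed.

Lemma low_degree_Pr (d M : nat) : (M < N)%N -> (d < n)%N ->
  evolution_Pr R (fun w : trajectory n =>
     [exists v, (degree (evolution w M) v <= d)%N]) <=
  n%:R * (8 ^+ d * expR (- (7 / 8 * (n.-1 - d)%:R * M%:R / N%:R))).
Proof.
move=> MN dn.
pose A v (w : trajectory n) := (set0 \subset evolution w M) &&
  (#|cross [set v] (~: [set v]) :&: evolution w M| <= d)%N.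
apply: (@le_trans _ _ (evolution_Pr R (fun w => [exists v, xpredT v && A v w]))).
  apply: evolution_Pr_sub => w _ /existsP[v dv]; apply/existsP; exists v.
  rewrite /A sub0set /=; apply: (@leq_trans (d * #|[set v]|)); last first.
    by rewrite cards1 muln1.
  apply: card_cross_le => u; rewrite inE => /eqP ->; apply: leq_trans dv.
  by apply/subset_leq_card/subsetP => u'; rewrite !inE => /andP[].
apply: le_trans (evolution_Pr_bigU _ _) _.
have Fv (v : 'I_n) : (n.-1 <= #|cross [set v] (~: [set v])|)%N.
  apply: leq_trans (card_cross _); last by rewrite -subsets_disjoint.
  by rewrite cards1 mul1n cardsC1 card_ord.
set B := 8 ^+ d * _; apply: (@le_trans _ _ (\sum_(v : 'I_n) B)).
  apply: ler_sum => v _.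
  have dF : (d <= #|cross [set v] (~: [set v])|)%N.
    by apply: leq_trans (Fv v); rewrite -ltnS prednK // (leq_ltn_trans _ dn).
  apply: le_trans (pattern_Pr_expR _ (leqnn M) MN dF) _.
  rewrite cards0 expr0 mul1r subn0 ler_wpM2l ?exprn_ge0 // ler_expR lerN2.
  rewrite ler_wpM2r ?invr_ge0 ?ler0n // ler_wpM2r ?ler0n // ler_wpM2l ?divr_ge0 //.
  by rewrite ler_nat leq_sub2r.
by rewrite sumr_const card_ord -[leLHS]mulr_natl.
Qed.

(** When the minimum degree exceeds [d] between the times [M1] and [M2], the
    vertices beyond the reach of the core would form such a set; using both times
    spares a union bound over the times in between. *)
Definition detached (d M1 M2 : nat) (w : trajectory n) (X : {set 'I_n}) :=
  (#|cross X (~: X) :&: evolution w M1| <= d * #|X|)%N &&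
  [forall v in X, exists u in X, adj (evolution w M2) v u].

(** Union bound over [X] and over a choice of a neighbour for each vertex of
    [X]; these neighbours span between [|X| / 2] and [|X|] edges. *)
Lemma detached_Pr (d M1 M2 : nat) (be ga : R) :
  (M1 <= M2)%N -> (M2 < N)%N -> (16 * d < n)%N ->
  0 <= be -> be <= 1 -> expR 1 * M2%:R / (N - M2)%:R <= be ^+ 2 ->
  (forall x, (0 < x)%N -> (16 * x <= n)%N ->
    ga * x%:R <= 7 / 8 * (x * (n - x) - d * x)%:R * (M1 - x)%:R / N%:R) ->
  expR 1 * n%:R * be * 8 ^+ d * expR (- ga) <= 2^-1 ->
  evolution_Pr R (fun w : trajectory n =>
    [exists X : {set 'I_n}, [&& X != set0, (16 * #|X| <= n)%N & detached d M1 M2 w X]])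
  <= 2 * (expR 1 * n%:R * be * 8 ^+ d * expR (- ga)).
Proof.
move=> M12 M2N dn be0 be1 beE gaE q1; set q := _ * expR (- ga) in q1 *.
have n0 : (0 < n)%N by apply: leq_ltn_trans dn.
pose v0 : 'I_n := Ordinal n0.
pose I : finType := ({set 'I_n} * {ffun 'I_n -> 'I_n})%type.
pose D (Xf : I) := [&& Xf.1 != set0, (16 * #|Xf.1| <= n)%N,
   Xf.2 \in pffun_on v0 (mem Xf.1) (mem Xf.1) &
   [forall v in Xf.1, Xf.2 v != v]].
pose A (Xf : I) (w : trajectory n) :=
  (star_edges Xf.1 Xf.2 \subset evolution w M2) &&
  (#|cross Xf.1 (~: Xf.1) :&: evolution w M1| <= d * #|Xf.1|)%N.
pose h x : R := (be * 8 ^+ d * expR (- ga)) ^+ x.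
apply: (@le_trans _ _ (evolution_Pr R (fun w => [exists Xf, D Xf && A Xf w]))).
  apply: evolution_Pr_sub => w _ /existsP[X /and3P[X0 Xn /andP[Xd /forall_inP Xnbr]]].
  pose f : {ffun 'I_n -> 'I_n} := [ffun v => if v \in X then
    odflt v0 [pick u | (u \in X) && adj (evolution w M2) v u] else v0].
  have fP v : v \in X -> f v \in X /\ adj (evolution w M2) v (f v).
    move=> vX; rewrite ffunE vX; case: pickP => [u /andP[] //|no].
    by have /existsP[u] := Xnbr v vX; rewrite no.
  apply/existsP; exists (X, f); rewrite /D /A /= X0 Xn Xd andbT /= -andbA.
  apply/and3P; split.
  - apply/pffun_onP; split; last first.
      by move=> v /mapP[u]; rewrite mem_enum => uX ->; case: (fP u uX).
    by apply/subsetP => v; rewrite !inE ffunE; case: ifP; rewrite ?eqxx.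
  - apply/forall_inP => v vX; have [_ vf] := fP v vX.
    by apply: contraTneq vf => ->; rewrite adj_irr.
  - by apply: star_edges_sub => v vX; case: (fP v vX).
apply: le_trans (evolution_Pr_bigU _ _) _.
have bound (Xf : I) : D Xf -> evolution_Pr R (A Xf) <= h #|Xf.1|.
  case: Xf => X f /and4P[/= X0 Xn _ /forall_inP fN].
  have [tX Xt] := card_star_edges fN; set t := #|star_edges X f| in tX Xt.
  set x := #|X| in tX Xt Xn *.
  have x0 : (0 < x)%N by rewrite card_gt0.
  have Fx : (x * (n - x) <= #|cross X (~: X)|)%N.
    apply: leq_trans (card_cross _); last by rewrite -subsets_disjoint.
    by rewrite [#|~: X|]cardsCs setCK card_ord.
  have dF : (d * x <= x * (n - x))%N by rewrite mulnC leq_mul2l; lia.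
  apply: le_trans (pattern_Pr_expR _ M12 M2N (leq_trans dF Fx)) _.
  rewrite -/t /h [leRHS]exprMn [X in _ <= X * _]exprMn -exprM -expRM_natr.
  apply: ler_pM; rewrite ?expR_ge0 ?mulr_ge0 ?exprn_ge0 ?divr_ge0 ?mulr_ge0 ?expR_ge0 ?ler0n //.
    apply: ler_wpM2r; first exact: exprn_ge0.
    apply: (@le_trans _ _ ((be ^+ 2) ^+ t)).
      by rewrite lerXn2r ?nnegrE ?exprn_ge0 ?divr_ge0 ?mulr_ge0 ?expR_ge0 ?ler0n.
    by rewrite -exprM; apply: ler_wiXn2l.
  rewrite ler_expR mulNr lerN2; apply: le_trans (gaE x x0 Xn) _.
  rewrite ler_wpM2r ?invr_ge0 ?ler0n //.
  apply: ler_pM; rewrite ?mulr_ge0 ?invr_ge0 ?ler0n //.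
    by rewrite ler_wpM2l ?divr_ge0 // ler_nat leq_sub2r.
  by rewrite ler_nat leq_sub2l.
apply: le_trans (ler_sum _ bound) _.
have h0 x : 0 <= h x by rewrite exprn_ge0 ?mulr_ge0 ?exprn_ge0 ?expR_ge0.
pose H x : R := if x == 0%N then 0 else x%:R ^+ x * h x.
apply: (@le_trans _ _ (\sum_(X : {set 'I_n}) H #|X|)).
  apply: (@le_trans _ _ (\sum_(Xf : I | (Xf.1 != set0) &&
      (Xf.2 \in pffun_on v0 (mem Xf.1) (mem Xf.1))) h #|Xf.1|)).
    rewrite big_mkcond [leRHS]big_mkcond; apply: ler_sum => Xf _.
    by rewrite /D; case: (Xf.1 != set0); case: (_ <= n)%N; case: (_ \in _);
      case: [forall _ in _, _] => //=.
  rewrite -(pair_big_dep (fun X : {set 'I_n} => X != set0)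
    (fun X f => f \in pffun_on v0 (mem X) (mem X)) (fun X _ => h #|X|)) /=.
  rewrite big_mkcond; apply: ler_sum => X _; rewrite /H -cards_eq0.
  case: eqP => //= _; rewrite sumr_const card_pffun_on -[leLHS]mulr_natl.
  by rewrite natrX.
rewrite sum_by_card card_ord big_ord_recl /H /= mulr0 add0r.
apply: le_trans (geometric_le n _ q1); last first.
  by rewrite /q !mulr_ge0 ?expR_ge0 ?ler0n ?exprn_ge0.
rewrite big_add1 /= big_mkord; apply: ler_sum => x _.
rewrite /bump /= add1n /h mulrA.
apply: (@le_trans _ _ ((expR 1 * n%:R) ^+ x.+1 * (be * 8 ^+ d * expR (- ga)) ^+ x.+1)).
  by rewrite ler_wpM2r ?exprn_ge0 ?mulr_ge0 ?exprn_ge0 ?expR_ge0 ?bin_expn_le.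
by rewrite -exprMn /q !mulrA.
Qed.

End BadEvents.

(** * Isolated vertices *)

Section Isolated.
Context {R : realType} {n : nat}.
Local Notation E := (edge 'I_n).
Local Notation N := 'C(n, 2).

Definition star (v : 'I_n) : {set E} := cross [set v] (~: [set v]).

Lemma card_star v : #|star v| = n.-1.
Proof.
apply/eqP; rewrite eqn_leq; apply/andP; split.
  have := @card_cross_le _ [set v] [set: E] n.-1; rewrite setIT cards1 muln1.
  apply=> u; rewrite inE => /eqP ->.
  rewrite -[X in (_ <= X.-1)%N]card_ord -(cardsC1 v).
  by apply/subset_leq_card/subsetP => u'; rewrite inE => /andP[].
apply: leq_trans (card_cross _); last by rewrite -subsets_disjoint.
by rewrite cards1 mul1n cardsC1 card_ord.
Qed.

Lemma star_mem v f : f \in star v -> v \in val f.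
Proof.
rewrite inE => /existsP[a /andP[]]; rewrite inE => /eqP -> /existsP[b /andP[_]].
by move=> /eqP ->; rewrite set21.
Qed.

(** Two stars share only the edge between their centres. *)
Lemma card_starU u v : u != v ->
  (2 * n - 3 <= #|star u :|: star v|)%N /\ (#|star u :|: star v| <= 2 * n)%N.
Proof.
move=> uv; have I1 : (#|star u :&: star v| <= 1)%N.
  apply/card_le1_eqP => f g; rewrite !in_setI => /andP[fu fv] /andP[gu gv].
  have E2 h : h \in star u -> h \in star v -> val h = [set u; v].
    move=> hu hv; apply/esym/eqP; rewrite eqEcard (eqP (valP h)) cards2 uv andbT.
    by apply/subsetP => x; rewrite !inE => /orP[] /eqP ->; rewrite star_mem.
  by apply: val_inj; rewrite !E2.
by rewrite cardsU !card_star; lia.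
Qed.

Lemma star_degree (G : graph 'I_n) v : (0 < degree G v)%N -> star v :&: G != set0.
Proof.
rewrite card_gt0 => /set0Pn[u]; rewrite inE => vu.
have uv : u != v by apply: contraTneq vu => ->; rewrite adj_irr.
case/existsP: vu => f /andP[fG /eqP fE]; apply/set0Pn; exists f.
rewrite in_setI fG andbT inE; apply/existsP; exists v; rewrite inE eqxx /=.
by apply/existsP; exists u; rewrite !inE uv fE /=.
Qed.

Lemma expR_onem_le (a y : R) : 0 <= a -> a < y -> expR (- (a / (y - a))) <= 1 - a / y.
Proof.
move=> a0 ay; have ya : 0 < y - a by rewrite subr_gt0.
have y0 : 0 < y := le_lt_trans a0 ay.
rewrite expRN -[leRHS]invrK lef_pV2 ?posrE ?expR_gt0 ?invr_gt0 //; last first.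
  by rewrite subr_gt0 ltr_pdivrMr // mul1r.
apply: le_trans _ (expR_ge1Dx _); rewrite le_eqVlt; apply/orP; left; apply/eqP.
by field; rewrite !gt_eqF.
Qed.

Variable M : nat.
Hypothesis MN : (4 * n <= N - M)%N.
Hypothesis n1 : (1 < n)%N.

Let iso1 : R := \prod_(m < M) (1 - n.-1%:R / (N - m)%:R).
Let y (m : 'I_M) : R := (N - m)%:R.

Lemma y_ge m : 4 * n%:R <= y m.
Proof. by rewrite /y -natrM ler_nat; have := ltn_ord m; lia. Qed.

Lemma y_geM m : (N - M)%:R <= y m.
Proof. by rewrite /y ler_nat; have := ltn_ord m; lia. Qed.

Lemma n_gt0 : 0 < n%:R :> R.
Proof. by rewrite ltr0n ltnW. Qed.

Lemma predn_nat : n.-1%:R = n%:R - 1 :> R.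
Proof. by rewrite -subn1 natrB // ltnW. Qed.

Lemma iso1_ge :
  expR (- (M%:R * (n.-1%:R / ((N - M)%:R - n.-1%:R)))) <= iso1.
Proof.
rewrite mulrC -mulNr expRM_natr /iso1 -[M in _ ^+ M]card_ord -prodr_const.
have nn := n_gt0; have pn := predn_nat.
have NMn : 4 * n%:R <= (N - M)%:R :> R by rewrite -natrM ler_nat.
apply: ler_prod => m _; rewrite expR_ge0 /=.
have ym := y_geM m.
apply: le_trans (expR_onem_le (ler0n _ _) _); last by rewrite -/(y m); lra.
rewrite ler_expR lerN2 ler_wpM2l ?ler0n // lef_pV2 ?posrE -/(y m); [|lra|lra].
by rewrite lerB.
Qed.

Lemma iso1_gt0 : 0 < iso1.
Proof. exact: lt_le_trans (expR_gt0 _) iso1_ge. Qed.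

(** The events are nearly independent: because of the shared edge, each step costs
    at most a factor [1 + 2 / y], where [y] is the number of absent edges. *)
Lemma two_isolated_Pr u v : u != v ->
  evolution_Pr R (fun w : trajectory n =>
    (star u :|: star v) :&: evolution w M == set0) <=
  iso1 ^+ 2 * expR (2 * M%:R / (N - M)%:R).
Proof.
move=> uv; have [Fge Fle] := card_starU uv.
rewrite avoid_Pr; last by lia.
rewrite [2 * M%:R / _]mulrAC expRM_natr mulrC /iso1 expr2.
rewrite -[M in _ ^+ M]card_ord -prodr_const -!big_split /=.
apply: ler_prod => m _; rewrite -/(y m).
have ym := y_geM m; have ym4 := y_ge m; have nn := n_gt0; have pn := predn_nat.
have y0 : 0 < y m by lra.
have y0' : 0 < (N - M)%:R :> R.
  by rewrite ltr0n; move: MN n1; lia.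
have Fle' : #|star u :|: star v|%:R <= 2 * n%:R :> R by rewrite -natrM ler_nat.
have Fge' : 2 * n%:R - 3 <= #|star u :|: star v|%:R :> R.
  rewrite lerBlDr -natrM -natrD ler_nat; lia.
apply/andP; split.
  by rewrite subr_ge0 ler_pdivrMr // mul1r; lra.
apply: (@le_trans _ _ ((1 + 2 / y m) * ((1 - n.-1%:R / y m) * (1 - n.-1%:R / y m)))).
  rewrite pn; set z := (y m)^-1.
  have z0 : 0 < z by rewrite invr_gt0.
  have nz : n%:R * z <= 4^-1.
    by rewrite /z -ler_pdivlMr ?invr_gt0 // invrK mulrC; lra.
  have nz0 : 0 < n%:R * z by rewrite mulr_gt0.
  apply: (@le_trans _ _ (1 - (2 * n%:R - 3) * z)).
    by rewrite lerD2l lerN2 ler_wpM2r // ltW.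
  set a := n%:R * z in nz nz0.
  have -> : (2 * n%:R - 3) * z = 2 * a - 3 * z by rewrite /a; ring.
  have -> : (n%:R - 1) * z = a - z by rewrite /a; ring.
  have za : z <= a.
    by rewrite /a ler_peMl ?ler1n ?(ltW z0) // ltnW.
  nra.
rewrite ler_wpM2r ?mulr_ge0 //.
  by rewrite subr_ge0 ler_pdivrMr // mul1r; lra.
  by rewrite subr_ge0 ler_pdivrMr // mul1r; lra.
apply: (@le_trans _ _ (1 + 2 / (N - M)%:R)); last exact: expR_ge1Dx.
by rewrite lerD2l ler_wpM2l // lef_pV2 ?posrE.
Qed.

(** Chebyshev's inequality for the number of isolated vertices. *)
Lemma no_isolated_Pr :
  evolution_Pr R (fun w : trajectory n =>
    [forall v, (0 < degree (evolution w M) v)%N]) <=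
  n%:R^-1 * expR (M%:R * (n.-1%:R / ((N - M)%:R - n.-1%:R))) +
  (expR (2 * M%:R / (N - M)%:R) - 1).
Proof.
have nn := n_gt0; have i0 := iso1_gt0.
pose J v (w : trajectory n) : R := (star v :&: evolution w M == set0)%:R.
pose Z w := \sum_v J v w.
pose P (w : trajectory n) : R := trajectory_prob R w.
have MN' : (M <= N)%N by lia.
have PrE (A : pred (trajectory n)) : evolution_Pr R A = \sum_w P w * (A w)%:R.
  rewrite /evolution_Pr big_mkcond; apply: eq_bigr => w _.
  by case: (A w); rewrite ?mulr1 ?mulr0.
have EJ v : \sum_w P w * J v w = iso1.
  by rewrite -PrE avoid_Pr // card_star.
pose mu := n%:R * iso1.
have EZ : \sum_w P w * Z w = mu.
  under eq_bigr do rewrite mulr_sumr; rewrite exchange_big /=.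
  by rewrite (eq_bigr (fun=> iso1)) // sumr_const card_ord -[LHS]mulr_natl.
set ex := expR (2 * M%:R / (N - M)%:R).
have EZ2 : \sum_w P w * Z w ^+ 2 <= mu + mu ^+ 2 * ex.
  have -> : \sum_w P w * Z w ^+ 2 = \sum_u \sum_v \sum_w P w * (J u w * J v w).
    under [RHS]eq_bigr do rewrite exchange_big /=.
    rewrite [RHS]exchange_big /=; apply: eq_bigr => w _.
    rewrite expr2 /Z mulr_suml mulr_sumr; apply: eq_bigr => u _.
    by rewrite !mulr_sumr.
  apply: (@le_trans _ _ (\sum_(u : 'I_n) (iso1 + n%:R * (iso1 ^+ 2 * ex)))).
    apply: ler_sum => u _; rewrite (bigD1 u) //= lerD //.
      rewrite -(EJ u) le_eqVlt; apply/orP; left; apply/eqP/eq_bigr => w _.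
      by rewrite /J; case: (_ == _); rewrite ?mulr1 ?mulr0.
    apply: (@le_trans _ _ (\sum_(v | v != u) iso1 ^+ 2 * ex)).
      apply: ler_sum => v vu; apply: le_trans _ (two_isolated_Pr vu).
      rewrite PrE; apply: ler_sum => w _; rewrite ler_wpM2l ?trajectory_prob_ge0 //.
      by rewrite /J setIUl setU_eq0 mulrC -natrM mulnb.
    have c0 : 0 <= iso1 ^+ 2 * ex by rewrite mulr_ge0 ?expR_ge0 // sqr_ge0.
    rewrite sumr_const -[leLHS]mulr_natl ler_wpM2r //.
    by rewrite ler_nat -[X in (_ <= X)%N](card_ord n) max_card.
  rewrite sumr_const card_ord -[leLHS]mulr_natl /mu le_eqVlt.
  by apply/orP; left; apply/eqP; ring.
have mu0 : 0 < mu by rewrite mulr_gt0.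
have cheb : evolution_Pr R (fun w : trajectory n =>
    [forall v, (0 < degree (evolution w M) v)%N]) * mu ^+ 2 <=
    \sum_w P w * (Z w - mu) ^+ 2.
  rewrite PrE mulr_suml; apply: ler_sum => w _; rewrite -mulrA.
  rewrite ler_wpM2l ?trajectory_prob_ge0 //.
  case: forallP => [deg|_]; last by rewrite mul0r sqr_ge0.
  rewrite mul1r /Z big1 ?sub0r ?sqrrN // => v _.
  by rewrite /J (negPf (star_degree (deg v))).
have var : \sum_w P w * (Z w - mu) ^+ 2 =
    \sum_w P w * Z w ^+ 2 - mu ^+ 2.
  have -> : \sum_w P w * (Z w - mu) ^+ 2 = \sum_w P w * Z w ^+ 2 -
      2 * mu * (\sum_w P w * Z w) + mu ^+ 2 * \sum_w P w.
    rewrite !mulr_sumr -sumrB -big_split; apply: eq_bigr => w _ /=; ring.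
  by rewrite EZ [\sum_w P w]trajectory_prob_sum1; ring.
rewrite var in cheb.
have : evolution_Pr R (fun w : trajectory n =>
    [forall v, (0 < degree (evolution w M) v)%N]) <= mu^-1 + (ex - 1).
  rewrite -(ler_pM2r (x := mu ^+ 2)) ?exprn_gt0 //; apply: le_trans cheb _.
  have -> : (mu^-1 + (ex - 1)) * mu ^+ 2 = mu + mu ^+ 2 * ex - mu ^+ 2.
    by move: mu0 => m0; field; rewrite gt_eqF.
  by rewrite lerD2r.
move=> /le_trans; apply; rewrite lerD2r /mu invfM ler_wpM2l ?invr_ge0 ?ler0n //.
rewrite -[leRHS]invrK lef_pV2 ?posrE ?invr_gt0 ?expR_gt0 // -expRN.
exact: iso1_ge.
Qed.

End Isolated.

(** * Hitting times along a typical trajectory *)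

Lemma first_timeE (n : nat) (P : pred nat) (M : nat) :
  (M <= 'C(n, 2))%N -> P M -> (forall M', (M' < M)%N -> ~~ P M') ->
  first_time n P = M.
Proof.
move=> MN PM noP; rewrite /first_time.
have -> : 'C(n, 2).+1 = (M + ('C(n, 2) - M).+1)%N by lia.
rewrite iotaD find_cat /= add0n PM addn0 size_iota ifN //.
by apply/hasPn => M'; rewrite mem_iota add0n => /noP.
Qed.

Lemma min_degree_le (V : finType) (G : graph V) v : (min_degree G <= degree G v)%N.
Proof.
rewrite /min_degree; have : v \in index_enum V by rewrite mem_index_enum.
elim: (index_enum V) => // u r IHr; rewrite inE big_cons geq_min.
by case/orP => [/eqP ->|/IHr ->]; rewrite ?leqnn ?orbT.
Qed.

Lemma min_degree_ge (V : finType) (G : graph V) k :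
  (k <= #|V|)%N -> (forall v, (k <= degree G v)%N) -> (k <= min_degree G)%N.
Proof.
move=> kV kG; rewrite /min_degree.
by elim/big_rec: _ => [|v x _ kx]; rewrite ?leq_min ?kG.
Qed.

Lemma degree_mono (V : finType) (G H : graph V) v :
  G \subset H -> (degree G v <= degree H v)%N.
Proof.
move=> GH; apply/subset_leq_card/subsetP => u; rewrite !inE.
exact: adjS.
Qed.

Lemma degree_add_edge (V : finType) (G : graph V) (e : edge V) v :
  (degree (e |: G) v <= (degree G v).+1)%N.
Proof.
pose Q := [set u | val e == [set v; u]].
have Q1 : (#|Q| <= 1)%N.
  apply/card_le1_eqP => u u'; rewrite !inE => /eqP eu /eqP eu'.
  have : u \in val e by rewrite eu set22.
  rewrite eu' !inE => /orP[/eqP uv|/eqP //].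
  by have := valP e; rewrite eu uv setUid cards1.
suff : (degree (e |: G) v <= degree G v + #|Q|)%N by move: Q1; lia.
apply: leq_trans (leq_card_setU _ _).
apply/subset_leq_card/subsetP => u; rewrite !inE => /existsP[f /andP[]].
rewrite in_setU1 => /orP[/eqP -> -> |fG fE]; first by rewrite orbT.
by apply/orP; left; apply/existsP; exists f; rewrite fG.
Qed.

Lemma joinedS (V : finType) (G H : graph V) K :
  G \subset H -> joined G K -> joined H K.
Proof.
move=> GH jG A B dAB KA KB; have [a [b [aA bB ab]]] := jG A B dAB KA KB.
by exists a, b; split=> //; apply: adjS ab.
Qed.

Section Residues.
Variables (d n : nat).
Hypothesis d0 : (0 < d)%N.

Definition residue (v : 'I_n) : 'I_d := Ordinal (ltn_pmod v d0).

Lemma card_residue i : (n %/ d <= #|[set v | residue v == i]|)%N.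
Proof.
have lt (k : 'I_(n %/ d)) : (k * d + i < n)%N.
  have := ltn_ord k; have := ltn_ord i; have := leq_trunc_div n d.
  move: (n %/ d)%N k => m [k km] /=; nia.
rewrite -[leqLHS]card_ord -(card_imset _ (f := fun k => Ordinal (lt k))).
  apply/subset_leq_card/subsetP => v /imsetP[k _ ->]; rewrite inE.
  by apply/eqP/val_inj; rewrite /= modnMDl modn_small.
move=> k k' /(congr1 val) /= /eqP; rewrite eqn_add2r eqn_pmul2r //.
by move=> /eqP kk'; apply: val_inj.
Qed.

End Residues.

Section Trajectory.
Context {R : realType} {d n : nat}.
Local Notation N := 'C(n, 2).
Variables (K M1 M2 : nat) (w : trajectory n).
Hypothesis d0 : (0 < d)%N.
Hypothesis n_large : (2 * K <= n)%N.
Hypothesis K_large : (16 * d * (d ^ 2 + 1) <= K)%N.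
Hypothesis M2N : (M2 <= N)%N.
Hypothesis Gjoin : joined (evolution w M1) K.
Hypothesis nodetached : forall X : {set 'I_n}, X != set0 -> (16 * #|X| <= n)%N ->
  ~~ detached d M1 M2 w X.

(** Between the times [M1] and [M2] minimum degree [d + 1] suffices: the core of
    the graph at time [M1] is rigid, and a set outside it that cannot be reached
    would be detached. *)
Lemma rigid_of_min_degree M : (M1 <= M)%N -> (M <= M2)%N ->
  (forall v, (d < degree (evolution w M) v)%N) ->
  globally_rigid R d (evolution w M).
Proof.
move=> M1M MM2 deg; set G := evolution w M.
have GK : joined G K := joinedS (evolutionS_sub w M1M) Gjoin.
pose chi := @residue d n d0.
have csize i : ((2 * d ^ 2 + 5) * #|'I_n| <= K * #|[set v | chi v == i]|)%N.
  rewrite card_ord; have := @card_residue d n d0 i; have := ltn_ceil n d0.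
  move: (n %/ d)%N #|_| => m c; move: n_large K_large d0; clear; nia.
have KV : (K <= #|'I_n|)%N by rewrite card_ord; move: n_large; clear; lia.
have [W [KW conn]] := @core_exists R d _ G chi K GK csize KV.
have W16 : (16 * #|~: W| <= n)%N.
  by move: KW K_large d0 n_large; rewrite card_ord; clear; nia.
have WE : (#|W| + #|~: W| = n)%N by rewrite cardsC card_ord.
apply: (@globally_rigid_criterion R d _ G W chi) => //.
- by move: WE W16 n_large K_large d0; clear; nia.
- move=> i; have : (1 < #|[set v | chi v == i] :&: W|)%N.
    have := cardsID W [set v | chi v == i].
    have := subset_leq_card (subsetIr [set v | chi v == i] (~: W)); rewrite -setDE.
    move: (csize i) KW KV K_large d0 n_large; rewrite card_ord.
    move: #|_ :&: W| #|_ :\: W| #|~: W| #|[set v | _]| => a b c e; clear; nia.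
  case/card_gt1P => u [u' []]; rewrite !inE => /andP[/eqP ui uW] /andP[/eqP u'i u'W] uu'.
  by exists u, u'.
move=> X XW X0; apply: contrapT => noX.
have few v : v \in X -> (#|[set u in ~: X | adj G v u]| <= d)%N.
  by move=> vX; rewrite leqNgt; apply/negP => dv; apply: noX; exists v.
have X16 : (16 * #|X| <= n)%N.
  by apply: leq_trans W16; rewrite leq_mul2l subset_leq_card.
apply: (negP (nodetached X0 X16)); apply/andP; split.
  apply: card_cross_le => v vX; apply: leq_trans (few v vX).
  apply/subset_leq_card/subsetP => u; rewrite !inE => /andP[-> /=].
  exact: adjS (evolutionS_sub w M1M).
apply/forall_inP => v vX; apply: contraT => /existsPn noX'.
have := deg v; rewrite ltnNge => /negP; case; apply: leq_trans (few v vX).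
apply/subset_leq_card/subsetP => u; rewrite !inE => vu; rewrite vu andbT.
apply/negP => uX; have := noX' u; rewrite uX /=.
by rewrite (adjS (evolutionS_sub w MM2) vu).
Qed.

Hypothesis deg2 : forall v, (d < degree (evolution w M2) v)%N.
Hypothesis deg1 : exists v, degree (evolution w M1) v = 0.

Lemma hitting_times_eq : M_GR R d w = M_deg d.+1 w.
Proof.
pose P M := [forall v, (d < degree (evolution w M) v)%N].
have PM2 : P M2 by apply/forallP.
have [M PM minM] := ex_minnP (ex_intro P M2 PM2).
have MM2 : (M <= M2)%N := minM _ PM2.
have MN : (M <= N)%N := leq_trans MM2 M2N.
have M1M : (M1 < M)%N.
  rewrite ltnNge; apply/negP => MM1; have [v dv] := deg1.
  have := degree_mono v (evolutionS_sub w MM1); rewrite dv leqNgt.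
  by have /forallP/(_ v) := PM; case: (degree _ _).
have before M' : (M' < M)%N -> exists v, (degree (evolution w M') v <= d)%N.
  move=> M'M; have : ~~ P M' by apply/negP => /minM; rewrite leqNgt M'M.
  by case/forallPn => v; rewrite -leqNgt; exists v.
have dn : (d.+1 < #|'I_n|)%N.
  by rewrite card_ord; move: n_large K_large d0; clear; nia.
rewrite /M_GR /M_deg !(@first_timeE n _ M) //.
- have ge : (d.+1 <= min_degree (evolution w M))%N.
    by apply: min_degree_ge; [exact: ltnW|exact/forallP].
  rewrite eqn_leq ge andbT.
  have [v dv] := before M.-1 (ltac:(lia)).
  apply: leq_trans (min_degree_le _ v) _.
  have lt : (M.-1 < N)%N by lia.
  have -> : M = (Ordinal lt).+1 by rewrite /= prednK // (leq_ltn_trans _ M1M).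
  by rewrite evolutionS; apply: leq_trans (degree_add_edge _ _ _) _.
- move=> M' /before[v dv]; rewrite neq_ltn ltnS.
  by rewrite (leq_trans (min_degree_le _ v) dv).
- by apply/asboolP; apply: rigid_of_min_degree; [exact: ltnW| |exact/forallP].
- move=> M' /before[v dv]; apply/asboolPn => rig.
  by have := globally_rigid_degree d0 dn rig v; rewrite ltnNge dv.
Qed.

End Trajectory.

(** * Asymptotics *)

Section Asymptotics.
Context {R : realType}.

Lemma expRN_le_inv (y : R) : 0 < y -> expR (- y) <= y^-1.
Proof.
move=> y0; rewrite expRN lef_pV2 ?posrE ?expR_gt0 //.
by apply: le_trans (expR_ge1Dx y); rewrite lerDr.
Qed.

Lemma expR1_le4 : expR 1 <= 4 :> R.
Proof.
have h : expR (2^-1) <= 2 :> R.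
  rewrite -[leLHS]invrK -expRN -[leRHS]invrK lef_pV2 ?posrE ?expR_gt0 ?invr_gt0 //.
  by apply: le_trans (expR_ge1Dx _); lra.
have -> : expR 1 = expR 2^-1 ^+ 2 :> R by rewrite -expRM_natr mulVf.
have -> : (4 : R) = 2 ^+ 2 by ring.
by rewrite lerXn2r ?nnegrE ?expR_ge0.
Qed.

Variables (d K n : nat).
Hypothesis d0 : (0 < d)%N.
Hypothesis K0 : (0 < K)%N.
Let L : R := ln n%:R.
Let x : R := n%:R.
(* Large enough for every error term below to be O(1 / L). *)
Hypothesis L_ge : 100 * d.+1%:R + 6 * K%:R ^+ 2 <= L.

(* Isolated vertices disappear near [n ln n / 2], and the last edges between two
   vertices of bounded degree near [n ln n / 4]; [M1] lies between these times.
   [M2] lies beyond the time at which the minimum degree reaches [d + 1]. *)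
Let M1 := Num.truncn (2 / 5 * x * L).
Let M2 := Num.truncn (x * L).
Local Notation N := 'C(n, 2).

Lemma L_100 : 100 <= L.
Proof.
apply: le_trans L_ge; have : 1 <= d.+1%:R :> R by rewrite ler1n.
by have := sqr_ge0 (K%:R : R); lra.
Qed.

Lemma x_gt0 : 0 < x.
Proof.
rewrite /x ltr0n lt0n; apply: contraTneq L_100 => n0.
by rewrite /L n0 ln0 // -ltNge.
Qed.

Lemma x_expR : x = expR L.
Proof. by rewrite /L lnK // posrE x_gt0. Qed.

Lemma x_ge : 16 * L ^+ 2 <= x.
Proof.
have L100 := L_100; rewrite x_expR.
apply: le_trans (expR_ge1Dxn 2 _); last by lra.
have -> : (3`!%:R : R) = 6 by [].
rewrite !exprS expr0 mulr1; have : 0 <= L * L by nra.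
by move=> LL; nra.
Qed.

Lemma x_geL : 1600 * L <= x.
Proof. by apply: le_trans x_ge; have := L_100; rewrite expr2; nra. Qed.

Lemma xL_ge : 100 * x <= x * L.
Proof. by rewrite mulrC ler_wpM2l ?L_100 // ltW ?x_gt0. Qed.

Lemma xx_ge : 1600 * (x * L) <= x ^+ 2.
Proof. by rewrite expr2 mulrCA ler_wpM2l ?x_geL // ltW ?x_gt0. Qed.

Lemma N_eq : N%:R = x * (x - 1) / 2 :> R.
Proof.
have n0 : (0 < n)%N by rewrite -(ltr0n R) x_gt0.
apply: (mulIf (x := 2)); first by rewrite pnatr_eq0.
rewrite divfK ?pnatr_eq0 // -natrM -[2%N]/(2`!) bin_ffact ffactnS ffactn1.
by rewrite natrM -subn1 natrB.
Qed.

Lemma N_le : N%:R <= x ^+ 2 / 2 :> R.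
Proof. by rewrite N_eq expr2; have := x_gt0; nra. Qed.

Lemma N_ge : 49 / 100 * x ^+ 2 <= N%:R :> R.
Proof.
have := xx_ge; have := xL_ge; have := x_gt0; rewrite N_eq.
have -> : x * (x - 1) / 2 = x ^+ 2 / 2 - x / 2 by field.
lra.
Qed.

Lemma N_gt0 : 0 < N%:R :> R.
Proof. by apply: lt_le_trans N_ge; have := x_gt0; rewrite expr2; nra. Qed.

Lemma M1_le : M1%:R <= 2 / 5 * x * L.
Proof. by rewrite truncn_le; have := x_gt0; have := L_100; nra. Qed.

Lemma M1_ge : 39 / 100 * x * L <= M1%:R.
Proof.
have := truncnS_gt (2 / 5 * x * L); rewrite -/M1 -[M1.+1%:R]natr1.
by have := xL_ge; have := x_geL; have := L_100; lra.
Qed.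

Lemma M2_le : M2%:R <= x * L.
Proof. by rewrite truncn_le; have := x_gt0; have := L_100; nra. Qed.

Lemma M2_ge : 9 / 10 * x * L <= M2%:R.
Proof.
have := truncnS_gt (x * L); rewrite -/M2 -[M2.+1%:R]natr1.
by have := xL_ge; have := x_geL; have := L_100; lra.
Qed.

Lemma M1_M2 : (M1 <= M2)%N.
Proof. by apply: le_truncn; have := x_gt0; have := L_100; nra. Qed.

Lemma M2_lt : (M2 < N)%N.
Proof.
rewrite -(ltr_nat R); apply: le_lt_trans M2_le _; apply: lt_le_trans N_ge.
by have := xx_ge; have := xL_ge; have := x_gt0; lra.
Qed.

Lemma M1_lt : (M1 < N)%N.
Proof. exact: leq_ltn_trans M1_M2 M2_lt. Qed.

Lemma d_le : 100 * d%:R <= L.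
Proof.
apply: le_trans L_ge; rewrite -[d.+1%:R]natr1.
by have := sqr_ge0 (K%:R : R); lra.
Qed.

Lemma joined_bound :
  evolution_Pr R (fun w : trajectory n => ~~ `[< joined (evolution w M1) K >]) <= L^-1.
Proof.
have L100 := L_100; have x0 := x_gt0; have xL := x_geL.
apply: le_trans (not_joined_Pr K0 M1_lt) _.
have K1 : (0 : R) < K%:R by rewrite ltr0n.
have e3 : 3 * x <= 7 / 8 * (x / K%:R) ^+ 2 * M1%:R / N%:R.
  rewrite ler_pdivlMr ?N_gt0 // expr_div_n.
  have -> : 7 / 8 * (x ^+ 2 / K%:R ^+ 2) * M1%:R =
      7 / 8 * x ^+ 2 * M1%:R / K%:R ^+ 2 by ring.
  rewrite ler_pdivlMr ?exprn_gt0 //.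
  apply: (@le_trans _ _ (3 * x * (x ^+ 2 / 2) * K%:R ^+ 2)).
    by rewrite ler_wpM2r ?sqr_ge0 // ler_wpM2l ?N_le // mulr_ge0 // ltW.
  have KL : 6 * K%:R ^+ 2 <= L.
    by apply: le_trans L_ge; rewrite lerDr mulr_ge0 ?ler0n.
  have M1g : 39 / 100 * x * (6 * K%:R ^+ 2) <= M1%:R.
    by apply: le_trans M1_ge; rewrite ler_wpM2l // mulr_ge0 ?divr_ge0 // ltW.
  have xx : 0 <= x ^+ 2 by rewrite sqr_ge0.
  have := ler_wpM2l xx M1g.
  have : 0 <= x ^+ 2 * (x * K%:R ^+ 2) by rewrite !mulr_ge0 ?sqr_ge0 // ltW.
  by move: (K%:R ^+ 2) (M1%:R) (x ^+ 2) => k m y; lra.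
have four : (4 ^+ n : R) <= expR (2 * x).
  rewrite expRM_natr lerXn2r ?nnegrE ?expR_ge0 //.
  have -> : expR 2 = expR 1 ^+ 2 :> R by rewrite -expRM_natr mul1r.
  have -> : (4 : R) = 2 ^+ 2 by ring.
  rewrite lerXn2r ?nnegrE ?expR_ge0 //.
  by apply: le_trans (expR_ge1Dx 1); lra.
apply: (@le_trans _ _ (expR (2 * x) * expR (- (3 * x)))).
  by apply: ler_pM; rewrite ?exprn_ge0 ?expR_ge0 // ler_expR lerN2.
rewrite -expRD; have -> : 2 * x - 3 * x = - x by ring.
apply: le_trans (expRN_le_inv x0) _.
by rewrite lef_pV2 ?posrE //; lra.
Qed.

Lemma degree_bound :
  evolution_Pr R (fun w : trajectory n =>
     [exists v, (degree (evolution w M2) v <= d)%N]) <= 8 ^+ d * (5 / 2) / L.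
Proof.
have L100 := L_100; have x0 := x_gt0; have xL := x_geL; have dL := d_le.
have dn : (d < n)%N by rewrite -(ltr_nat R) -/x; lra.
apply: le_trans (low_degree_Pr M2_lt dn) _.
have e : 14 / 10 * L <= 7 / 8 * (n.-1 - d)%:R * M2%:R / N%:R.
  rewrite ler_pdivlMr ?N_gt0 // -subn1 -subnDA natrB ?add1n // -[d.+1%:R]natr1 -/x.
  apply: (@le_trans _ _ (14 / 10 * L * (x ^+ 2 / 2))).
    by rewrite ler_wpM2l ?N_le //; lra.
  apply: (@le_trans _ _ (7 / 8 * (9 / 10 * x) * (9 / 10 * x * L))).
    have : 0 <= L * x ^+ 2 by rewrite mulr_ge0 ?sqr_ge0 //; lra.
    by rewrite expr2; nra.
  apply: ler_pM; rewrite ?M2_ge //.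
  - by lra.
  - by rewrite !mulr_ge0 //; lra.
  - by lra.
rewrite mulrCA -[leRHS]mulrA ler_wpM2l ?exprn_ge0 // [n%:R]x_expR -expRD.
apply: (@le_trans _ _ (expR (- (2 / 5 * L)))); first by rewrite ler_expR; lra.
apply: le_trans (expRN_le_inv _) _; first by lra.
by rewrite invfM invf_div.
Qed.

Lemma isolated_bound :
  evolution_Pr R (fun w : trajectory n =>
    [forall v, (0 < degree (evolution w M1) v)%N]) <= 10 / L.
Proof.
have L100 := L_100; have x0 := x_gt0; have xL := x_geL.
have M1l := M1_le; have Ng := N_ge.
have n1 : (1 < n)%N by rewrite -(ltr_nat R) -/x; lra.
have NM : (N - M1)%:R = N%:R - M1%:R :> R by rewrite natrB // ltnW ?M1_lt.
have pn : n.-1%:R = x - 1 :> R by rewrite -subn1 natrB // ltnW.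
have xx : 1600 * L * x <= x ^+ 2 by rewrite expr2 ler_wpM2r // ltW.
have Lx : 100 * x <= L * x by rewrite ler_wpM2r // ltW.
have MN : (4 * n <= N - M1)%N.
  by rewrite -(ler_nat R) NM natrM -/x; lra.
apply: le_trans (no_isolated_Pr MN n1) _.
rewrite NM pn [n%:R]x_expR -expRN -expRD.
have D0 : 45 / 100 * x ^+ 2 <= N%:R - M1%:R - (x - 1) by lra.
have xx0 : 0 < x ^+ 2 by rewrite exprn_gt0.
have a1 : M1%:R * ((x - 1) / (N%:R - M1%:R - (x - 1))) <= 8 / 9 * L.
  rewrite mulrA ler_pdivrMr; last by lra.
  apply: (@le_trans _ _ (2 / 5 * x * L * x)).
    by apply: ler_pM => //; lra.
  apply: (@le_trans _ _ (8 / 9 * L * (45 / 100 * x ^+ 2))).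
    by rewrite expr2; nra.
  by rewrite ler_wpM2l //; lra.
have a2 : 2 * M1%:R / (N%:R - M1%:R) <= 2 * L / x.
  rewrite ler_pdivrMr; last by lra.
  rewrite mulrAC ler_pdivlMr //.
  apply: (@le_trans _ _ (2 * (2 / 5 * x * L) * x)); first by rewrite ler_wpM2r ?(ltW x0) //; lra.
  apply: (@le_trans _ _ (2 * L * (45 / 100 * x ^+ 2))).
    have : 0 <= L * x ^+ 2 by rewrite mulr_ge0 ?ltW //; lra.
    by rewrite expr2; nra.
  by rewrite ler_wpM2l //; lra.
set s := 2 * L / x in a2.
have s0 : 0 <= s by rewrite divr_ge0 ?ltW //; lra.
have sL : s <= (8 * L)^-1.
  rewrite /s ler_pdivrMr // [leRHS]mulrC ler_pdivlMr; last by lra.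
  by have := x_ge; rewrite expr2; lra.
have sL' : (8 * L)^-1 <= 4^-1 by rewrite lef_pV2 ?posrE; lra.
have Li : 0 < L^-1 by rewrite invr_gt0; lra.
have es : expR s - 1 <= 2 * s.
  have : expR s <= (1 - s)^-1.
    rewrite -[leLHS]invrK -expRN lef_pV2 ?posrE ?expR_gt0; [|by []|lra].
    exact: expR_ge1Dx.
  move=> es; have : (1 - s)^-1 <= 1 + 2 * s.
    rewrite -[leLHS]mul1r ler_pdivrMr; last by lra.
    have : 0 <= s * (1 - 2 * s) by rewrite mulr_ge0 //; lra.
    lra.
  by lra.
have e1 : expR (- L + M1%:R * ((x - 1) / (N%:R - M1%:R - (x - 1)))) <= 9 / L.
  apply: (@le_trans _ _ (expR (- (L / 9)))); first by rewrite ler_expR; lra.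
  by apply: le_trans (expRN_le_inv _) _; [lra|rewrite invf_div].
have e2 : expR (2 * M1%:R / (N%:R - M1%:R)) <= expR s by rewrite ler_expR.
have : 2 * s <= L^-1.
  by move: sL; rewrite invfM; lra.
lra.
Qed.

Lemma detached_bound : 2 * (16 * 8 ^+ d * 409) / L <= 1 ->
  evolution_Pr R (fun w : trajectory n =>
    [exists X : {set 'I_n}, [&& X != set0, (16 * #|X| <= n)%N & detached d M1 M2 w X]])
  <= 2 * (16 * 8 ^+ d * 409) / L.
Proof.
have L100 := L_100; have x0 := x_gt0; have xL := x_geL; have dL := d_le.
move=> small.
(* [be ^+ 2], about [L ^+ 2 / n], bounds the cost of an edge inside the set, of
   which there is one for every two vertices; [expR (- ga)] bounds the cost for
   each vertex of having few edges to the outside. The factor [n] for the choice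
   of a vertex is beaten because [1 - 1/2 - 57/100 < 0]. *)
pose be := 4 * L * expR (- (L / 2)); pose ga := 57 / 100 * L.
have L0 : 0 < L by lra.
have be2 : be ^+ 2 = 16 * L ^+ 2 / x.
  rewrite /be !exprMn -expRM_natr mulNr divfK ?pnatr_eq0 // x_expR expRN.
  by congr (_ * _); ring.
have be0 : 0 <= be by rewrite !mulr_ge0 ?expR_ge0 // ltW.
have be1 : be <= 1.
  rewrite -(@ler_pXn2r _ 2) ?nnegrE // expr1n be2 ler_pdivrMr // mul1r.
  exact: x_ge.
have N0 := N_gt0.
have M2N := ltnW M2_lt.
have beE : expR 1 * M2%:R / (N - M2)%:R <= be ^+ 2.
  have NM : 4^-1 * x ^+ 2 <= (N - M2)%:R.
    rewrite natrB //; have := N_ge; have := M2_le; have := xx_ge.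
    by have := xL_ge; lra.
  have xx0 : 0 < x ^+ 2 by rewrite exprn_gt0.
  rewrite be2 ler_pdivrMr; last by apply: lt_le_trans NM; rewrite mulr_gt0 // invr_gt0.
  apply: (@le_trans _ _ (16 * L ^+ 2 / x * (4^-1 * x ^+ 2))); last first.
    by rewrite ler_wpM2l // divr_ge0 ?(ltW x0) // mulr_ge0 ?sqr_ge0.
  have -> : 16 * L ^+ 2 / x * (4^-1 * x ^+ 2) = 4 * (x * L) * L.
    by field; rewrite gt_eqF.
  apply: (@le_trans _ _ (4 * (x * L))).
    by apply: ler_pM; rewrite ?expR_ge0 ?ler0n ?expR1_le4 ?M2_le.
  by rewrite ler_peMr ?mulr_ge0 ?ltW //; lra.
have gaE y : (0 < y)%N -> (16 * y <= n)%N ->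
    ga * y%:R <= 7 / 8 * (y * (n - y) - d * y)%:R * (M1 - y)%:R / N%:R.
  move=> y0; rewrite -(ler_nat R) natrM -/x => yn.
  have y0' : 0 < y%:R :> R by rewrite ltr0n.
  have yn' : (y <= n)%N by rewrite -(ler_nat R) -/x; lra.
  have dny : (d <= n - y)%N by rewrite -(ler_nat R) natrB // -/x; lra.
  have yM : (y <= M1)%N.
    rewrite -(ler_nat R); apply: le_trans M1_ge; have : 100 * x <= L * x.
      by rewrite ler_wpM2r // ltW.
    by lra.
  rewrite [(d * y)%N]mulnC -mulnBr natrM natrB // natrB // natrB // -/x.
  rewrite ler_pdivlMr //.
  apply: (@le_trans _ _ (ga * y%:R * (x ^+ 2 / 2))).
    by rewrite ler_wpM2l ?N_le // /ga !mulr_ge0 // ltW.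
  apply: (@le_trans _ _ (7 / 8 * (y%:R * (9 / 10 * x)) * (38 / 100 * x * L))).
    have : 0 <= y%:R * L * (x * x) by rewrite !mulr_ge0 ?ltW.
    by rewrite /ga expr2; lra.
  apply: ler_pM.
  - by rewrite !mulr_ge0 ?divr_ge0 ?ltW.
  - by rewrite !mulr_ge0 ?divr_ge0 ?ltW.
  - by rewrite ler_wpM2l ?divr_ge0 // ler_wpM2l ?ltW //; lra.
  have : 100 * x <= L * x by rewrite ler_wpM2r // ltW.
  by have := M1_ge; lra.
have qE : expR 1 * n%:R * be * 8 ^+ d * expR (- ga) <= 16 * 8 ^+ d * 409 / L.
  have -> : expR 1 * n%:R * be * 8 ^+ d * expR (- ga) =
      expR 1 * (4 * 8 ^+ d) * (L * (expR L * expR (- (L / 2)) * expR (- ga))).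
    by rewrite [n%:R]x_expR /be; ring.
  rewrite -!expRD; have -> : L - L / 2 - ga = - (7 / 100 * L) by rewrite /ga; field.
  have -> : 16 * 8 ^+ d * 409 / L = 4 * (4 * 8 ^+ d) * (409 / L) by ring.
  apply: ler_pM; rewrite ?mulr_ge0 ?expR_ge0 ?exprn_ge0 ?(ltW L0) //.
    by rewrite ler_wpM2r ?mulr_ge0 ?exprn_ge0 // expR1_le4.
  (* The constant 409 comes from 20000 / 49 < 409. *)
  have E2 : (7 / 100 * L) ^+ 2 / 2 <= expR (7 / 100 * L).
    apply: le_trans (expR_ge1Dxn 1 _); last by lra.
    by have -> : (2`!%:R : R) = 2 by []; rewrite lerDr.
  rewrite expRN ler_pdivrMr ?expR_gt0 //.
  apply: le_trans (ler_wpM2l _ E2); last by rewrite divr_ge0 ?ltW.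
  have -> : 409 / L * ((7 / 100 * L) ^+ 2 / 2) = 409 * (49 / 20000) * L.
    by field; rewrite gt_eqF.
  by lra.
have dn : (16 * d < n)%N by rewrite -(ltr_nat R) natrM -/x; lra.
have q2 : expR 1 * n%:R * be * 8 ^+ d * expR (- ga) <= 2^-1.
  by apply: le_trans qE _; move: small; rewrite -!mulrA; lra.
apply: le_trans (detached_Pr M1_M2 M2_lt dn be0 be1 beE gaE q2) _.
by rewrite -[leRHS]mulrA ler_wpM2l.
Qed.

Lemma hitting_times_Pr : (16 * d * (d ^ 2 + 1) <= K)%N ->
  2 * (16 * 8 ^+ d * 409) / L <= 1 ->
  1 - (1 + 8 ^+ d * (5 / 2) + 10 + 2 * (16 * 8 ^+ d * 409)) / L <=
  evolution_Pr R (fun w : trajectory n => M_GR R d w == M_deg d.+1 w).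
Proof.
move=> KL small; rewrite evolution_PrC lerD2l lerN2.
have L100 := L_100; have x0 := x_gt0; have xL := x_geL.
pose b1 (w : trajectory n) := ~~ `[< joined (evolution w M1) K >].
pose b2 (w : trajectory n) := [exists v, (degree (evolution w M2) v <= d)%N].
pose b3 (w : trajectory n) := [forall v, (0 < degree (evolution w M1) v)%N].
pose b4 (w : trajectory n) := [exists X : {set 'I_n},
  [&& X != set0, (16 * #|X| <= n)%N & detached d M1 M2 w X]].
apply: (@le_trans _ _ (evolution_Pr R (fun w => ((b1 w || b2 w) || b3 w) || b4 w))).
  apply: evolution_Pr_sub => w _; apply: contraR.
  rewrite !negb_or => /andP[/andP[/andP[/negPn/asboolP jo /existsPn b2w]
    /forallPn[v b3w]] /existsPn b4w].
  apply/eqP; apply: (@hitting_times_eq R d n K M1 M2 w d0 _ KL (ltnW M2_lt) jo).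
  - rewrite -(ler_nat R) natrM -/x; have K1 : 1 <= K%:R :> R by rewrite ler1n.
    have : 6 * K%:R ^+ 2 <= L.
      by apply: le_trans L_ge; rewrite lerDr mulr_ge0 ?ler0n.
    by rewrite expr2; nra.
  - move=> X X0 X16; have := b4w X; rewrite X0 X16 /=; by [].
  - by move=> u; have := b2w u; rewrite -ltnNge.
  - by exists v; apply/eqP; rewrite -leqn0 leqNgt.
apply: le_trans (evolution_PrU _ _) _.
rewrite [in leRHS]mulrDl; apply: lerD; last exact: detached_bound.
apply: le_trans (evolution_PrU _ _) _.
rewrite [in leRHS]mulrDl; apply: lerD; last exact: isolated_bound.
apply: le_trans (evolution_PrU _ _) _.
rewrite [in leRHS]mulrDl; apply: lerD; last exact: degree_bound.
by rewrite mul1r; exact: joined_bound.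
Qed.

End Asymptotics.

Lemma evolution_Pr_le1 (R : realType) (n : nat) (A : pred (trajectory n)) :
  evolution_Pr R A <= 1.
Proof. by rewrite evolution_PrC gerDl oppr_le0 evolution_Pr_ge0. Qed.

Local Open Scope classical_set_scope.
Local Open Scope ring_scope.

Theorem corollary1p4 (R : realType) (d : nat) (hd : (1 <= d)%N) :
  (fun n : nat =>
     @evolution_Pr R n (fun w => M_GR R d w == M_deg d.+1 w)) @ \oo --> (1 : R).
Proof.
pose K := (16 * d * (d ^ 2 + 1))%N.
have K0 : (0 < K)%N by rewrite !muln_gt0 hd /= addn1.
pose C : R := 1 + 8 ^+ d * (5 / 2) + 10 + 2 * (16 * 8 ^+ d * 409).
apply/cvgrPdist_le => e e0.
pose L0 : R := 100 * d.+1%:R + 6 * K%:R ^+ 2 + 2 * (16 * 8 ^+ d * 409) + C / e.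
have e8 : 0 <= 8 ^+ d :> R by rewrite exprn_ge0.
have C0 : 0 < C by rewrite /C; lra.
have Ce : 0 < C / e by rewrite divr_gt0.
have dd : 0 <= d.+1%:R :> R by rewrite ler0n.
have KK : 0 <= K%:R ^+ 2 :> R by rewrite sqr_ge0.
near=> n.
have nL : L0 <= ln n%:R.
  have n0 : expR L0 <= n%:R by near: n; exact: nbhs_infty_ger.
  rewrite -[leLHS]expRK ler_ln ?posrE ?expR_gt0 //.
  exact: lt_le_trans (expR_gt0 _) n0.
have L0' : 0 < ln n%:R :> R by apply: lt_le_trans nL; rewrite /L0; lra.
have := @hitting_times_Pr R d K n hd K0 _ (leqnn _) _.
rewrite -/C => H; rewrite ger0_norm; last by rewrite subr_ge0 evolution_Pr_le1.
rewrite lerBlDr -lerBlDl; apply: le_trans (H _ _).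
- rewrite lerD2l lerN2 ler_pdivrMr // mulrC -ler_pdivrMr //.
  by apply: le_trans nL; rewrite /L0; lra.
- by apply: le_trans nL; rewrite /L0; lra.
- by rewrite ler_pdivrMr // mul1r; apply: le_trans nL; rewrite /L0; lra.
Unshelve. all: by end_near.
Qed.
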